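(* For every integer $N\geq1$ there exist an integer $L_N\geq1$ and a constant $C_N>0$, both depending only on $N$, such that for every integer $d\geq5$ and every integer $1\leq n\leq d^4$ there exist complex coefficients $\alpha_\nu=\alpha_{\nu,d,n}$, $\beta_\nu=\beta_{\nu,d,n}$ and parameters $r_\nu=r_{\nu,d,n}$, $\widetilde r_\nu=\widetilde r_{\nu,d,n}$ in $(0,1)$, for $1\leq\nu\leq L_N$, such that $$\sum_{\nu=1}^{L_N}\bigl(|\alpha_\nu|+|\beta_\nu|\bigr)\leq C_N$$ and $$\sup_{\xi\in\mathbb T^d}\left|s_n^d(\xi)-\sum_{\nu=1}^{L_N}\alpha_\nu\widehat{g_{r_\nu}^d}(\xi)-\sum_{\nu=1}^{L_N}\beta_\nu\widehat{g_{\widetilde r_\nu}^d}(\xi-\mathbf h)\right|\leq C_N\min\{n,d\}^{-N}.$$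
   Context: $\mathbb T^d=\mathbb R^d/\mathbb Z^d$ and $\mathbf h=(\tfrac12,\ldots,\tfrac12)\in\mathbb T^d$. For integers $d\ge5$, $n\ge0$, $\mathcal S_n^d=\{x\in\mathbb Z^d: x_1^2+\cdots+x_d^2=n\}$ and $$s_n^d(\xi)=\frac1{|\mathcal S_n^d|}\sum_{x\in\mathcal S_n^d}e^{2\pi i x\cdot\xi},\qquad \xi\in\mathbb T^d.$$ For $0<r<1$, $\Theta(r)=\sum_{k\in\mathbb Z}r^{k^2}$ and $g_r^d(x)=\Theta(r)^{-d}r^{|x|^2}$ for $x\in\mathbb Z^d$, where $|x|^2=x_1^2+\cdots+x_d^2$. The Fourier transform of $g\in\ell^1(\mathbb Z^d)$ is $\widehat g(\xi)=\sum_{x\in\mathbb Z^d}g(x)e^{2\pi i x\cdot\xi}$, $\xi\in\mathbb T^d$. *)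

(* Defs.v *)
From HB Require Import structures.
From mathcomp Require Import all_boot all_order all_algebra finmap.
From mathcomp Require Import complex zify.
From mathcomp Require Import all_classical all_reals all_analysis.
From mathcomp.analysis.showcase Require Import summability.

Set Implicit Arguments.
Unset Strict Implicit.
Unset Printing Implicit Defensive.

Import Order.TTheory GRing.Theory Num.Theory.
Import numFieldNormedType.Exports.

Local Open Scope classical_set_scope.
Local Open Scope ring_scope.
Local Open Scope complex_scope.

(* Infinite sums are unordered: [sum] from [summability] is the limit of the
   finite partial sums along the directed set of finite subsets of the index
   type.  It is used below only for absolutely summable families; [R^o] and
   [R[i]^o] are R and R[i] seen as normed modules over themselves. *)

Section lattice.
Variables (R : realType) (d : nat).
Implicit Types (x : 'rV[int]_d) (xi : 'rV[R]_d).

Definition normsq x : int := \sum_(i < d) x 0 i ^+ 2.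

Definition dotp x xi : R := \sum_(i < d) (x 0 i)%:~R * xi 0 i.

(* The complex number e^(2 pi i x.xi).  A point of the torus R^d/Z^d is given by any
   representative xi in R^d; see [expi2piDint]. *)
Definition expi2pi x xi : R[i] :=
  let t := 2 * pi * dotp x xi in cos t +i* sin t.

Definition sphere (n : nat) : set 'rV[int]_d := [set x | normsq x = n%:Z].

Definition sphere_mean (n : nat) xi : R[i] :=
  #|` fset_set (sphere n)|%:R^-1 * \sum_(x \in sphere n) expi2pi x xi.

Definition fourier (g : 'rV[int]_d -> R[i]) xi : R[i] :=
  sum (fun x => g x * expi2pi x xi : R[i]^o).

Definition halfv : 'rV[R]_d := const_mx 2^-1.

End lattice.

Definition Theta (R : realType) (r : R) : R :=
  sum (fun k : int => r ^ (k ^+ 2) : R^o).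

Definition gauss (R : realType) (d : nat) (r : R) (x : 'rV[int]_d) : R :=
  Theta r ^- d * r ^ normsq x.

Definition fourier_gauss (R : realType) (d : nat) (r : R) (xi : 'rV[R]_d) :
  R[i] := fourier (fun x => (gauss r x)%:C) xi.

Lemma finite_sphere (d n : nat) : finite_set (@sphere d n).
Proof.
pose f (z : {ffun 'I_d -> 'I_(n.*2.+1)}) : 'rV[int]_d :=
  \row_i ((z i : nat)%:Z - n%:Z).
apply: (@sub_finite_set _ _ (f @` setT)); last exact/finite_image/finite_finset.
move=> x /= xn.
have xi_le i : `|x 0 i| <= n%:Z.
  have : x 0 i ^+ 2 <= n%:Z.
    by rewrite -xn /normsq (bigD1 i)//= lerDl sumr_ge0// => j _; exact: sqr_ge0.
  by rewrite expr2; move: (x 0 i) => z; case: (lerP 0 z) => z0 h; nia.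
exists [ffun i => inord (absz (x 0 i + n%:Z))] => //.
apply/rowP => i; rewrite mxE ffunE inordK.
  rewrite gez0_abs ?addrK//.
  by have := xi_le i; rewrite ler_norml => /andP[+ _]; rewrite -lerBlDr sub0r.
have /andP[xl xu] : - n%:Z <= x 0 i <= n%:Z by rewrite -ler_norml.
rewrite ltnS -lez_nat gez0_abs -?lerBlDr ?sub0r//.
by rewrite -addnn PoszD lerD2r.
Qed.

(* Hence [sphere_mean n] and [fourier g] descend to R^d/Z^d. *)
Lemma expi2piDint (R : realType) (d : nat) (x k : 'rV[int]_d) (xi : 'rV[R]_d) :
  expi2pi x (xi + map_mx intr k) = expi2pi x xi.
Proof.
have cs (t : R) (m : nat) :
    cos (t + 2 * pi * m%:R) = cos t /\ sin (t + 2 * pi * m%:R) = sin t.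
  rewrite mulr_natl mulr_natr.
  by rewrite (periodicn (@cosD2pi R)) (periodicn (@sinD2pi R)).
have csz (t : R) (m : int) :
    cos (t + 2 * pi * m%:~R) = cos t /\ sin (t + 2 * pi * m%:~R) = sin t.
  case: m => m; first exact: cs.
  have [<- <-] := cs (t + 2 * pi * (Negz m)%:~R) m.+1.
  by rewrite NegzE mulrNz mulrN addrNK.
rewrite /expi2pi.
have -> : dotp x (xi + map_mx intr k) =
    dotp x xi + (\sum_(i < d) x 0 i * k 0 i)%:~R.
  rewrite /dotp rmorph_sum/= -big_split/=; apply: eq_bigr => i _.
  by rewrite !mxE mulrDr intrM.
by rewrite mulrDr !(csz _ _).1 !(csz _ _).2.
Qed.

(* Main.v *)
(* Write D = min(n, d).  By Cauchy's formula the sphere sum is the coefficient of z^n in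
   prod_j th(z, xi_j), where th(z, t) = sum_k z^(k^2) e(k t), integrated over the circle of radius
   q chosen so that the mean of k^2 under the weights q^(k^2) is n / d (saddle point).  Only half
   of the circle is needed: the other half is the first one with xi replaced by xi - h.  Here th
   is truncated at |k| <= T and the integral is replaced by a finite average over equally spaced
   angles, so everything is algebraic until T tends to infinity.

   With u = e^(i phi) - 1, on the minor arcs |phi| >> 1 - q the integrand is exponentially small
   in D.  On the major arc the Jacobi triple product gives th(z, t) = th(z, 0) G(z, t), where
   G(q (1 + u), t) is analytic of modulus at most 1 on a disc |u| <= c (1 - q).  The function
   u |-> prod_j G(q (1 + u), xi_j) is therefore approximated by its Lagrange interpolant at 2N
   real nodes spaced by w = (1 - q) / sqrt D, with an error of order
   (|u| / w + 1)^(2N) D^(-N); its value at a node is the Fourier transform of a Gaussian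
   g_r, with r in (0, 1).  The remaining factor th(q (1 + u), 0)^d / th(q, 0)^d is bounded by a
   Gaussian in phi / w, so integration gains a factor w, which is lost again on dividing by the
   value at xi = 0: a local limit theorem bounds that value below by a multiple of w. *)

Require Import Defs.
From HB Require Import structures.
From mathcomp Require Import all_boot all_order all_algebra finmap.
From mathcomp Require Import complex zify ring lra.
From mathcomp Require Import all_classical all_reals all_analysis.
From mathcomp.analysis.showcase Require Import summability.
Import Order.TTheory GRing.Theory Num.Theory.
Import numFieldNormedType.Exports.
Local Open Scope ring_scope.
Local Open Scope complex_scope.

Set Implicit Arguments.
Unset Strict Implicit.
Unset Printing Implicit Defensive.

(** The error may not depend on d although the integrand is a product of d factors. Dividing every
    factor by its value at t = 0 is what makes this possible: each quotient G is at most 1 in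
    modulus on the whole disc, hence so is the product of d of them, and interpolation sees one
    bounded function whatever d and xi are. All that remains, the d-th power of th at t = 0 and the
    oscillating phase, is free of xi and goes into the coefficients, which therefore serve all xi at
    once.

    The shift by h comes from parity: k and k^2 agree mod 2, so replacing z by -z amounts to
    replacing t by t - 1/2. The second family thus has the coefficients (-1)^n alpha.

    The bound n <= d^4 keeps w above a multiple of D^(-4), so that errors exponentially small in D
    survive the division by w. D comes from d q, the total loss over d coordinates, which is of the
    order of min(n, d).

    Analyticity enters as uniform approximability by polynomials on a disc, and the triple product
    in its finite form with Gaussian binomials. *)

Local Notation cn := (@ComplexField.Normc.normc _).
Local Notation Re := (@complex.Re _).
Local Notation Im := (@complex.Im _).

(** * Complex modulus, the unit circle and elementary trigonometric inequalities *)

Section Modulus.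
Variable R : realType.
Implicit Types (z w : R[i]) (x y t : R).

Lemma normE z : `|z| = (cn z)%:C.
Proof. by []. Qed.

Lemma cn_sqr z : cn z ^+ 2 = Re z ^+ 2 + Im z ^+ 2.
Proof. by case: z => a b /=; rewrite sqr_sqrtr// addr_ge0// sqr_ge0. Qed.

Lemma cn_ge0 z : 0 <= cn z.
Proof. by case: z => a b /=; exact: sqrtr_ge0. Qed.

Lemma cnM z w : cn (z * w) = cn z * cn w.
Proof. exact: ComplexField.Normc.normcM. Qed.

Lemma cn1 : cn (1 : R[i]) = 1.
Proof. exact: ComplexField.Normc.normc1. Qed.

Lemma cn0 : cn (0 : R[i]) = 0.
Proof. exact: ComplexField.Normc.normc0. Qed.

Lemma cnV z : cn z^-1 = (cn z)^-1.
Proof. exact: ComplexField.Normc.normcV. Qed.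

Lemma cnX z n : cn (z ^+ n) = cn z ^+ n.
Proof. by elim: n => [|n IH]; rewrite ?expr0 ?cn1// !exprS cnM IH. Qed.

Lemma cnN z : cn (- z) = cn z.
Proof. exact: normcN. Qed.

Lemma cnD z w : cn (z + w) <= cn z + cn w.
Proof. exact: le_normcD. Qed.

Lemma cnB z w : cn (z - w) <= cn z + cn w.
Proof. by rewrite -(cnN w) cnD. Qed.

Lemma cnBC z w : cn (z - w) = cn (w - z).
Proof. by rewrite -cnN opprB. Qed.

Lemma cn_triB z w v : cn (z - v) <= cn (z - w) + cn (w - v).
Proof. by rewrite -[z - v](subrKA w) cnD. Qed.

Lemma cn_lb z w : cn z - cn w <= cn (z + w).
Proof. by have := cnB (z + w) w; rewrite addrK; lra. Qed.

Lemma cn_real x : cn x%:C = `|x|.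
Proof. by rewrite /= expr0n/= addr0 sqrtr_sqr. Qed.

Lemma cn_nat n : cn (n%:R : R[i]) = n%:R.
Proof. by rewrite -[n%:R](rmorph_nat (real_complex R)) cn_real ger0_norm. Qed.

Lemma cn_eq0 z : (cn z == 0) = (z == 0).
Proof.
apply/eqP/eqP => [/ComplexField.Normc.eq0_normc//|->]; exact: cn0.
Qed.

Lemma cn_gt0 z : (0 < cn z) = (z != 0).
Proof. by rewrite lt_def cn_ge0 cn_eq0 andbT. Qed.

Lemma Re_le_cn z : `|Re z| <= cn z.
Proof.
rewrite -(ler_pXn2r (n := 2))// ?nnegrE ?normr_ge0 ?cn_ge0//.
by rewrite cn_sqr real_normK ?num_real// lerDl sqr_ge0.
Qed.

Lemma cn_sum (I : Type) (r : seq I) (P : pred I) (F : I -> R[i]) :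
  cn (\sum_(i <- r | P i) F i) <= \sum_(i <- r | P i) cn (F i).
Proof.
elim/big_rec2: _ => [|i a b _ H]; first by rewrite cn0.
by apply: (le_trans (cnD _ _)); rewrite lerD2l.
Qed.

Lemma cn_prod (I : Type) (r : seq I) (P : pred I) (F : I -> R[i]) :
  cn (\prod_(i <- r | P i) F i) = \prod_(i <- r | P i) cn (F i).
Proof. by rewrite (big_morph (fun z => cn z) cnM cn1). Qed.

Lemma cn_prod_le1 (I : Type) (r : seq I) (P : pred I) (F : I -> R[i]) :
  (forall i, P i -> cn (F i) <= 1) -> cn (\prod_(i <- r | P i) F i) <= 1.
Proof. by move=> H; rewrite cn_prod prodr_ile1// => i /H; rewrite cn_ge0. Qed.

(** Telescoping: the factors are exchanged one at a time, each at a cost [e], while the other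
    factors stay at most 1. *)
Lemma cn_prodB (d : nat) (F G : 'I_d -> R[i]) (e : R) :
  (forall j, cn (F j) <= 1) -> (forall j, cn (G j) <= 1) ->
  (forall j, cn (F j - G j) <= e) ->
  cn (\prod_j F j - \prod_j G j) <= d%:R * e.
Proof.
elim: d F G => [|d IH] F G HF HG HFG.
  by rewrite !big_ord0 subrr cn0 mul0r.
rewrite !big_ord_recl.
set a := F ord0; set b := G ord0; set A := \prod_(_ < d) _; set B := \prod_(_ < d) _.
have -> : a * A - b * B = a * (A - B) + (a - b) * B by ring.
have HA : cn (A - B) <= d%:R * e by apply: IH => j.
have HB : cn B <= 1 by apply: cn_prod_le1 => j _.
apply: (le_trans (cnD _ _)); rewrite !cnM mulrSr mulrDl mul1r lerD//.
  by rewrite -[leRHS]mul1r ler_pM ?cn_ge0 ?HF.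
by rewrite -[leRHS]mulr1 ler_pM ?cn_ge0 ?HFG.
Qed.

(** Drives the chain [sin_le], [cos_ge], [sin_ge]: the derivative of each difference is nonnegative
    by the preceding inequality. *)
Lemma deriv_ge0_le (f df : R -> R) x : (forall u : R, is_derive u (1 : R) f (df u)) ->
  (forall u, 0 <= u -> 0 <= df u) -> 0 <= x -> f 0 <= f x.
Proof.
move=> Df df0 x0.
have drv (u : R) : derivable f u (1:R) by have [] := Df u.
apply: (@ger0_derive1_le_cc _ f 0 x) => [u _|u||||] //.
- rewrite in_itv/= => /andP[u0 _].
  by rewrite derive1E (@derive_val _ _ _ _ _ _ _ (Df u)) df0// ltW.
- by apply: derivable_within_continuous => u _.
- by rewrite in_itv/= lexx x0.
- by rewrite in_itv/= lexx x0.
Qed.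

Lemma sin_le x : 0 <= x -> sin x <= x.
Proof.
move=> x0; rewrite -subr_ge0.
pose f (u : R) : R := u - sin u.
have Df (u : R) : is_derive u 1 f (1 - cos u).
  by rewrite /f; apply: is_derive_eq.
have /(_ x0) : 0 <= x -> f 0 <= f x.
  by apply: deriv_ge0_le Df _ => u u0; rewrite subr_ge0 cos_le1.
by rewrite /f sin0 subrr.
Qed.

Lemma cos_ge x : 1 - x ^+ 2 / 2 <= cos x.
Proof.
wlog x0 : x / 0 <= x.
  move=> H; have [/H//|x0] := leP 0 x.
  by rewrite -cosN -sqrrN H// oppr_ge0 ltW.
pose f (u : R) : R := cos u + u * u / 2.
have Df (u : R) : is_derive u 1 f (u - sin u).
  rewrite /f; apply: is_derive_eq.
  by rewrite /GRing.scale/=; field.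
have /(_ x0) : 0 <= x -> f 0 <= f x.
  by apply: deriv_ge0_le Df _ => u u0; rewrite subr_ge0 sin_le.
by rewrite /f cos0 => ?; lra.
Qed.

Lemma sin_ge x : 0 <= x -> x - x ^+ 3 / 6 <= sin x.
Proof.
move=> x0; pose f (u : R) : R := sin u - u + u * u * u / 6.
have Df (u : R) : is_derive u 1 f (cos u - 1 + u ^+ 2 / 2).
  rewrite /f; apply: is_derive_eq.
  by rewrite /GRing.scale/=; field.
have /(_ x0) : 0 <= x -> f 0 <= f x.
  by apply: deriv_ge0_le Df _ => u u0; have := cos_ge u; lra.
by rewrite /f sin0 => ?; lra.
Qed.

Lemma sin_sub_le x : `|sin x - x| <= `|x| ^+ 3 / 6.
Proof.
wlog x0 : x / 0 <= x.
  move=> H; have [/H//|x0] := leP 0 x.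
  have := H (- x); rewrite sinN !normrN -opprD normrN; apply; lra.
rewrite (ger0_norm x0) distrC ger0_norm; last by rewrite subr_ge0 sin_le.
by have := sin_ge x0; lra.
Qed.

Lemma sin_ge_third x : 0 <= x <= pi / 2 -> x / 3 <= sin x.
Proof.
move=> /andP[x0 x1]; have x2 : x <= 2 by have := @pihalf_lt2 R; lra.
apply: le_trans (sin_ge x0); nra.
Qed.

Definition ce x : R[i] := cos x +i* sin x.

Lemma ceD x y : ce (x + y) = ce x * ce y.
Proof.
apply/eqP; rewrite eq_complex/= cosD sinD eqxx/= addrC; apply/eqP; ring.
Qed.

Lemma ce0 : ce 0 = 1.
Proof. by rewrite /ce cos0 sin0. Qed.

Lemma cn_ce x : cn (ce x) = 1.
Proof. by rewrite /= cos2Dsin2 sqrtr1. Qed.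

Lemma ceN x : ce (- x) = (ce x)^-1.
Proof.
have H : ce (- x) * ce x = 1 by rewrite -ceD addNr ce0.
have c0 : ce x != 0 by rewrite -cn_eq0 cn_ce oner_neq0.
by apply: (mulIf c0); rewrite H mulVf.
Qed.

Lemma ceX x n : ce x ^+ n = ce (n%:R * x).
Proof.
by elim: n => [|n IH]; rewrite ?mul0r ?ce0// exprS IH -ceD -natr1; congr ce; ring.
Qed.

Lemma ce_sum (I : Type) (r : seq I) (P : pred I) (F : I -> R) :
  ce (\sum_(i <- r | P i) F i) = \prod_(i <- r | P i) ce (F i).
Proof. exact: (big_morph ce ceD ce0). Qed.

Lemma ce_2pi_nat n : ce (2 * pi * n%:R) = 1.
Proof.
rewrite mulrC -ceX /ce.
by rewrite mulr_natl cos2pi sin2pi expr1n.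
Qed.

Lemma cn_ceB1_sqr x : cn (ce x - 1) ^+ 2 = 2 * (1 - cos x).
Proof.
rewrite cn_sqr/= oppr0 addr0.
have := cos2Dsin2 x; move: (cos x) (sin x) => a b; lra.
Qed.

Lemma cn_ceB1 x : cn (ce x - 1) <= `|x|.
Proof.
rewrite -(ler_pXn2r (n := 2))// ?nnegrE ?normr_ge0 ?cn_ge0//.
rewrite cn_ceB1_sqr real_normK ?num_real//; have := cos_ge x; lra.
Qed.

Lemma ce_neq1 x : 0 < x < 2 * pi -> ce x != 1.
Proof.
move=> /andP[x0 x1]; apply/eqP => /(congr1 (fun z => Re z))/= cx.
have : 0 < sin (x / 2) by apply: sin_gt0_pi; rewrite divr_gt0//=; lra.
have := cos_mulr2n (x / 2); rewrite mulr2n -splitr cx.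
have := cos2Dsin2 (x / 2); nra.
Qed.

End Modulus.

(** * Sums over the symmetric windows |k| <= T *)

Section SymmetricSums.
Variable V : zmodType.
Implicit Types (f g : int -> V) (T : nat).

(** The term at 0 is kept apart and the others come in pairs, so that induction on T adds both ends
    at once and even or odd summands are handled termwise. *)
Definition isum T f : V := f 0 + \sum_(k < T) (f k.+1%:Z + f (- k.+1%:Z)).

Lemma isum0 f : isum 0 f = f 0.
Proof. by rewrite /isum big_ord0 addr0. Qed.

Lemma isumS T f : isum T.+1 f = isum T f + (f T.+1%:Z + f (- T.+1%:Z)).
Proof. by rewrite /isum big_ord_recr/= addrA. Qed.

Lemma isum_ord T f : isum T f = \sum_(k < (T.*2).+1) f (k%:Z - T%:Z).
Proof.
elim: T => [|T IH]; first by rewrite isum0 big_ord1 subr0.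
rewrite isumS IH doubleS [in RHS]big_ord_recl [in RHS]big_ord_recr/=.
rewrite [RHS]addrCA; congr (_ + _).
  by apply: eq_bigr => i _; congr (f _); rewrite /bump/=; lia.
by rewrite addrC; congr (f _ + f _); rewrite /bump/=; lia.
Qed.

Lemma eq_isum T f g : (forall k, (absz k <= T)%N -> f k = g k) -> isum T f = isum T g.
Proof.
move=> H; rewrite /isum H//; congr (_ + _); apply: eq_bigr => i _.
by have iT := ltn_ord i; rewrite !H//; lia.
Qed.

Lemma isumN T f : isum T (fun k => f (- k)) = isum T f.
Proof.
rewrite /isum oppr0; congr (_ + _); apply: eq_bigr => i _.
by rewrite opprK addrC.
Qed.

Lemma isumD T f g : isum T (fun k => f k + g k) = isum T f + isum T g.
Proof.
rewrite /isum addrACA -big_split; congr (_ + _); apply: eq_bigr => i _ /=.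
by rewrite addrACA.
Qed.

Lemma isumB T f g : isum T (fun k => f k - g k) = isum T f - isum T g.
Proof.
apply/eqP; rewrite eq_sym subr_eq -isumD; apply/eqP/eq_isum => k _.
by rewrite subrK.
Qed.

Lemma isum_shift1 T f :
  isum T (fun k => f (k + 1)) = isum T f + f T.+1%:Z - f (- T%:Z).
Proof.
elim: T => [|T IH]; first by rewrite !isum0 oppr0 [f 0 + _]addrC addrK.
rewrite !isumS IH.
have -> : - T.+1%:Z + 1 = - T%:Z :> int by lia.
have -> : T.+1%:Z + 1 = T.+2%:Z :> int by lia.
by rewrite [f _ + f (- T%:Z)]addrC addrA subrK [in RHS]addrA [RHS]addrAC addrK.
Qed.

Lemma isum_shift T S a f : (S + a <= T)%N ->
  (forall k, (S < absz k)%N -> f k = 0) ->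
  isum T (fun k => f (k + a%:Z)) = isum T f.
Proof.
elim: a S f => [|a IH] S f ST Hf.
  by apply: eq_isum => k _; rewrite addr0.
transitivity (isum T (fun k => f (k + 1))).
  rewrite -(IH S.+1 (fun k => f (k + 1))); first last.
  - by move=> k Sk; apply: Hf; lia.
  - by rewrite addSnnS.
  by apply: eq_isum => k _; congr (f _); lia.
by rewrite isum_shift1 !Hf ?subr0 ?addr0//; lia.
Qed.

Lemma isum_shiftN T S a f : (S + a <= T)%N ->
  (forall k, (S < absz k)%N -> f k = 0) ->
  isum T (fun k => f (k - a%:Z)) = isum T f.
Proof.
move=> ST Hf; rewrite -isumN -[RHS]isumN.
rewrite -(@isum_shift T S a (fun k => f (- k))) => [|//|k Sk].
  by apply: eq_isum => k _; congr (f _); lia.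
by apply: Hf; lia.
Qed.

End SymmetricSums.

Lemma raddf_isum (U V : zmodType) (h : {additive U -> V}) T (f : int -> U) :
  h (isum T f) = isum T (fun k => h (f k)).
Proof.
rewrite /isum raddfD raddf_sum; congr (_ + _).
by apply: eq_bigr => i _; rewrite raddfD.
Qed.

Lemma isumZl (A : comNzRingType) T (c : A) (f : int -> A) :
  isum T (fun k => c * f k) = c * isum T f.
Proof.
rewrite /isum mulrDr mulr_sumr; congr (_ + _).
by apply: eq_bigr => i _; rewrite mulrDr.
Qed.

Lemma isumZr (A : comNzRingType) T (c : A) (f : int -> A) :
  isum T (fun k => f k * c) = isum T f * c.
Proof. by rewrite mulrC -isumZl; apply: eq_isum => k _; rewrite mulrC. Qed.

(** * Truncated theta series and the loss due to second differences of the phases *)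

Section Theta.
Variable R : realType.
Implicit Types (q phi t : R) (z : R[i]) (T : nat).

Lemma isum_real T (f : int -> R) : isum T (fun k => (f k)%:C) = (isum T f)%:C.
Proof. by rewrite (raddf_isum (real_complex R)). Qed.

Lemma le_isum T (f g : int -> R) :
  (forall k, (absz k <= T)%N -> f k <= g k) -> isum T f <= isum T g.
Proof.
move=> H; rewrite /isum lerD ?H//; apply: ler_sum => i _.
by have iT := ltn_ord i; rewrite lerD// H//; lia.
Qed.

Lemma cn_isum T (f : int -> R[i]) : cn (isum T f) <= isum T (fun k => cn (f k)).
Proof.
apply: (le_trans (cnD _ _)); rewrite lerD2l; apply: (le_trans (cn_sum _ _ _)).
by apply: ler_sum => i _; exact: cnD.
Qed.

Definition sq (k : int) : nat := (absz k ^ 2)%N.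

Definition phase (k : int) t : R := 2 * pi * (k%:~R * t).

Definition th T z t : R[i] := isum T (fun k => z ^+ sq k * ce (phase k t)).

Definition Th T q : R := isum T (fun k => q ^+ sq k).

Lemma th0 T q : th T q%:C 0 = (Th T q)%:C.
Proof.
rewrite -isum_real; apply: eq_isum => k _.
by rewrite /phase !mulr0 ce0 mulr1 rmorphXn.
Qed.

Lemma cn_thle T z t : cn (th T z t) <= Th T (cn z).
Proof.
apply: (le_trans (cn_isum _ _)); apply: le_isum => k _.
by rewrite cnM cnX cn_ce mulr1.
Qed.

Lemma Th_E T q : Th T q = 1 + 2 * \sum_(k < T) q ^+ (k.+1 ^ 2).
Proof.
rewrite /Th /isum expr0 mulr_sumr; congr (_ + _).
by apply: eq_bigr => i _; rewrite /sq abszN/=; ring.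
Qed.

Lemma Th_ge1 T q : 0 <= q -> 1 <= Th T q.
Proof.
by move=> q0; rewrite Th_E lerDl mulr_ge0// sumr_ge0// => i _; rewrite exprn_ge0.
Qed.

Lemma Th_gt0 T q : 0 <= q -> 0 < Th T q.
Proof. by move=> /(Th_ge1 T); exact: lt_le_trans. Qed.

(** After division by the middle phase, |e^(ix) + 1 + e^(iy)|^2 <= 9 - 2 (1 - cos x) - 2 (1 - cos
    y), and the last two terms dominate 1 - cos (x + y). The denominator 6 comes from (3 - e/6)^2 >=
    9 - e. *)
Lemma triple_le (a b c : R) :
  cn (ce a + ce b + ce c) <= 3 - (1 - cos (a - 2 * b + c)) / 6.
Proof.
set e := 1 - cos _.
have e2 : 0 <= e <= 2.
  by rewrite /e; have := cos_geN1 (a - 2 * b + c); have := cos_le1 (a - 2 * b + c); lra.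
rewrite -(ler_pXn2r (n := 2))// ?nnegrE ?cn_ge0//; last by lra.
suff : cn (ce a + ce b + ce c) ^+ 2 <= 9 - e by nra.
pose x := a - b; pose y := c - b.
have -> : ce a + ce b + ce c = ce b * (ce x + 1 + ce y).
  by rewrite !mulrDr mulr1 -!ceD /x /y; congr (ce _ + _ + ce _); ring.
have -> : e = 1 - (cos x * cos y - sin x * sin y).
  by rewrite /e -cosD /x /y; congr (1 - cos _); ring.
rewrite cnM cn_ce mul1r cn_sqr/= addr0.
have := cos2Dsin2 x; have := cos2Dsin2 y.
move: (cos x) (sin x) (cos y) (sin y) => cx sx cy sy Hy Hx.
(* H1 and H2 are the real and imaginary parts of |1 - 2 e^(ix) + e^(i(x+y))|^2 >= 0, which expands
   to H7. *)
have H1 := sqr_ge0 (1 - 2 * cx + (cx * cy - sx * sy)).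
have H2 := sqr_ge0 (2 * sx - (sx * cy + cx * sy)).
have H3 : (cx * cy - sx * sy) ^+ 2 + (sx * cy + cx * sy) ^+ 2 = 1.
  by transitivity ((cx ^+ 2 + sx ^+ 2) * (cy ^+ 2 + sy ^+ 2)); [ring|rewrite Hx Hy mulr1].
have H4 : cx * (cx * cy - sx * sy) + sx * (sx * cy + cx * sy) = cy.
  by transitivity ((cx ^+ 2 + sx ^+ 2) * cy); [ring|rewrite Hx mul1r].
have H5 := sqr_ge0 (cx - cy); have H6 := sqr_ge0 (sx - sy).
move: H1 H2; set p := cx * cy - sx * sy; set r := sx * cy + cx * sy.
rewrite -/p -/r in H3 H4 * => H1 H2.
have H7 : 1 - p <= 2 * (1 - cx) + 2 * (1 - cy) by nra.
nra.
Qed.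

Lemma isum_ind_ge T H : (0 < H <= T.+1)%N ->
  H%:R <= isum T (fun k => (absz k < H)%N%:R : R).
Proof.
move=> /andP[H0 HT].
rewrite /isum H0 (eq_bigr (fun i : 'I_T => 2 * ((i.+1 < H)%N%:R : R))); last first.
  by move=> i _; rewrite abszN/=; ring.
rewrite -mulr_sumr -(big_mkord xpredT (fun i => ((i.+1 < H)%N%:R : R))).
rewrite (@big_cat_nat _ _ _ H.-1)//=; last by lia.
have S2 : 0 <= \sum_(H.-1 <= i < T) ((i.+1 < H)%N%:R : R) by apply: sumr_ge0.
have -> : \sum_(0 <= i < H.-1) ((i.+1 < H)%N%:R : R) = H.-1%:R.
  rewrite big_nat (eq_bigr (fun=> 1)); last first.
    by move=> i /andP[_ iH]; case: ltnP => //; lia.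
  by rewrite -big_nat sumr_const_nat subn0.
have -> : (H%:R : R) = H.-1%:R + 1 by rewrite natr1 prednK.
have : (0 : R) <= H.-1%:R by [].
lra.
Qed.

(* The phases of the terms k - h, k, k + h have second difference 2 phi h^2 whatever t is, so
   by [triple_le] each such triple loses a fixed proportion of its mass. *)
Lemma th_loss T H h q phi t : 0 <= q <= 1 -> (0 < H)%N -> (0 < h <= H)%N ->
  (2 * H <= T)%N ->
  cn (th T (q%:C * ce phi) t) <=
  Th T q - H%:R * (q ^+ ((2 * H - 1) ^ 2) / 18) * (1 - cos (2 * phi * (h ^ 2)%:R)).
Proof.
move=> /andP[q0 q1] H0 /andP[h0 hH] HT.
(* The indices k and k +- h with |k| < H stay within 2H - 1, where every weight is at least 3 m. At
   most three triples pass through a given index ([c] counts them), so each can take mass m from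
   it. *)
pose m : R := q ^+ ((2 * H - 1) ^ 2) / 3.
have m0 : 0 <= m by rewrite /m divr_ge0// exprn_ge0.
pose I (k : int) : R := (absz k < H)%N%:R.
have I0 k : 0 <= I k by rewrite /I ler0n.
have supp k : (H.-1 < absz k)%N -> I k = 0.
  by move=> ?; rewrite /I; case: ltnP => //; lia.
pose E (k : int) : R[i] := ce (phi * (sq k)%:R + phase k t).
pose c (k : int) : R := I k + I (k + h%:Z) + I (k - h%:Z).
have thE : th T (q%:C * ce phi) t = isum T (fun k => (q ^+ sq k)%:C * E k).
  apply: eq_isum => k _.
  by rewrite exprMn ceX /E ceD mulrA (mulrC phi) rmorphXn.
pose e := 1 - cos (2 * phi * (h ^ 2)%:R).
have split : th T (q%:C * ce phi) t =
    isum T (fun k => (q ^+ sq k - m * c k)%:C * E k) +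
    isum T (fun k => (m * I k)%:C * (E (k - h%:Z) + E k + E (k + h%:Z))).
  rewrite thE.
  transitivity (isum T (fun k => (q ^+ sq k - m * c k)%:C * E k) +
     isum T (fun k => (m * c k)%:C * E k)).
    by rewrite -isumD; apply: eq_isum => k _; rewrite -mulrDl -rmorphD/= subrK.
  congr (_ + _).
  transitivity (isum T (fun k => (m * I k)%:C * E k) +
    isum T (fun k => (m * I (k + h%:Z))%:C * E k) +
    isum T (fun k => (m * I (k - h%:Z))%:C * E k)).
    rewrite -!isumD; apply: eq_isum => k _.
    by rewrite -!mulrDl -!rmorphD/= /c; congr (_%:C * _); ring.
  have -> : isum T (fun k => (m * I (k + h%:Z))%:C * E k) =
            isum T (fun k => (m * I k)%:C * E (k - h%:Z)).
    rewrite -(@isum_shift _ T H.-1 h (fun k => (m * I k)%:C * E (k - h%:Z))).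
    - by apply: eq_isum => k _; rewrite addrK.
    - by lia.
    - by move=> k /supp ->; rewrite mulr0 mul0r.
  have -> : isum T (fun k => (m * I (k - h%:Z))%:C * E k) =
            isum T (fun k => (m * I k)%:C * E (k + h%:Z)).
    rewrite -(@isum_shiftN _ T H.-1 h (fun k => (m * I k)%:C * E (k + h%:Z))).
    - by apply: eq_isum => k _; rewrite subrK.
    - by lia.
    - by move=> k /supp ->; rewrite mulr0 mul0r.
  by rewrite -!isumD; apply: eq_isum => k _; ring.
have csum : isum T c = 3 * isum T I.
  rewrite /c !isumD (@isum_shift _ T H.-1) ?(@isum_shiftN _ T H.-1)//; try by lia.
  by ring.
have cle k : m * c k <= q ^+ sq k.
  have c3 : c k <= 3.
    have Ile j : I j <= 1 by rewrite /I; case: ltnP.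
    by have := Ile k; have := Ile (k + h%:Z); have := Ile (k - h%:Z); rewrite /c; lra.
  have [kH|kH] := leqP (absz k) (2 * H - 1).
    apply: (@le_trans _ _ (q ^+ ((2 * H - 1) ^ 2))); first by rewrite -[leRHS](@divfK _ 3)// ler_wpM2l.
    by apply: ler_wiXn2l => //; rewrite /sq leq_sqr.
  rewrite /c !supp; [|lia..]; rewrite !addr0 mulr0 exprn_ge0//.
rewrite split; apply: (le_trans (cnD _ _)).
have B1 : cn (isum T (fun k => (q ^+ sq k - m * c k)%:C * E k)) <=
    Th T q - m * (3 * isum T I).
  rewrite -csum -isumZl -isumB; apply: (le_trans (cn_isum _ _)).
  apply: le_isum => k _; rewrite cnM cn_ce mulr1 cn_real ger0_norm//.
  by rewrite subr_ge0.
have B2 : cn (isum T (fun k => (m * I k)%:C * (E (k - h%:Z) + E k + E (k + h%:Z)))) <=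
    m * (isum T I * (3 - e / 6)).
  rewrite -isumZr -isumZl; apply: (le_trans (cn_isum _ _)).
  apply: le_isum => k _; have mI : 0 <= m * I k by exact: mulr_ge0.
  rewrite cnM cn_real ger0_norm// [leRHS]mulrA ler_wpM2l//.
  apply: le_trans (triple_le _ _ _) _; rewrite lerD2l lerN2 ler_pM2r// /e.
  rewrite lerD2l lerN2 le_eqVlt; apply/orP; left; apply/eqP; congr cos.
  rewrite /phase /sq !natrX !natr_absz.
  have ab (j : int) : (`|j|%:~R ^+ 2 : R) = j%:~R ^+ 2.
    by rewrite intr_norm real_normK// num_real.
  by rewrite !ab !rmorphB !rmorphD/=; ring.
have e0 : 0 <= e by rewrite /e subr_ge0 cos_le1.
have IH : H%:R <= isum T I by apply: isum_ind_ge => //; lia.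
have -> : q ^+ ((2 * H - 1) ^ 2) / 18 = m / 6 by rewrite /m; field.
rewrite -/e.
have : m * H%:R * e <= m * isum T I * e by rewrite ler_wpM2r// ler_wpM2l.
lra.
Qed.

End Theta.

(** * The scale of the theta weights, and decay off the positive real axis *)

Section Estimates.
Variable R : realType.
Implicit Types (q y phi t x : R) (T H k n : nat).

Lemma exprn_le_expR q n : 0 <= q -> q ^+ n <= expR (- ((1 - q) * n%:R)).
Proof.
move=> q0; rewrite -mulNr expRM_natr lerXn2r// ?nnegrE ?expR_ge0//.
by have := expR_ge1Dx (- (1 - q)); lra.
Qed.

Lemma exprn_ge_expR q n : 2^-1 <= q <= 1 -> expR (- (2 * (1 - q) * n%:R)) <= q ^+ n.
Proof.
move=> /andP[q0 q1]; rewrite -mulNr expRM_natr lerXn2r// ?nnegrE ?expR_ge0//; first by lra.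
rewrite expRN -[leRHS]invrK lef_pV2 ?posrE ?expR_gt0 ?invr_gt0//; last by lra.
apply: le_trans (expR_ge1Dx _).
rewrite -[leLHS]mul1r ler_pdivrMr; [nra|lra].
Qed.

(** The j-th power of x / j <= exp (x / j). *)
Lemma pow_expRN_le (j : nat) x : (0 < j)%N -> 0 <= x -> x ^+ j * expR (- x) <= j%:R ^+ j.
Proof.
move=> j0 x0; have jR : (0 : R) < j%:R by rewrite ltr0n.
have -> : expR (- x) = expR (- (x / j%:R)) ^+ j.
  by rewrite -expRM_natr; congr expR; field; rewrite gt_eqF.
rewrite -exprMn; apply: lerXn2r; rewrite ?nnegrE ?mulr_ge0 ?expR_ge0//.
rewrite expRN ler_pdivrMr ?expR_gt0//.
have := expR_ge1Dx (x / j%:R) => h.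
apply: (@le_trans _ _ (j%:R * (x / j%:R))); first by rewrite mulrCA divff ?mulr1// gt_eqF.
by rewrite ler_pM2l//; lra.
Qed.

(** H is the integer part of 1 / sqrt y. For y = 1 - q it is the scale up to which q^(k^2) does not
    decay; everything about [Th] and its moments is measured against it. *)
Lemma floor_invsqrt y : 0 < y <= 1 ->
  exists H, [/\ (0 < H)%N, H%:R ^+ 2 * y <= 1 & 1 < (H.+1)%:R ^+ 2 * y].
Proof.
move=> /andP[y0 y1]; pose s := Num.sqrt y.
have s0 : 0 < s by rewrite sqrtr_gt0.
have s00 : 0 <= s by exact: ltW.
have sy : s ^+ 2 = y by rewrite sqr_sqrtr// ltW.
have s1 : s <= 1 by rewrite -sqrtr1 ler_wsqrtr.
have v1 : 1 <= s^-1 by rewrite invf_ge1.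
exists (Num.truncn s^-1).
have /andP[h1 h2] : (Num.truncn s^-1)%:R <= s^-1 < (Num.truncn s^-1).+1%:R.
  by apply: truncn_itv; rewrite invr_ge0 ltW.
split.
- by rewrite -(ltr_nat R); move: h2; rewrite -natr1; lra.
- rewrite -sy -exprMn expr_le1// ?mulr_ge0//.
  by rewrite -(ler_pdivlMr _ _ s0) mul1r.
- rewrite -sy -exprMn expr_gt1// ?mulr_ge0//.
  by rewrite -(ltr_pdivrMr _ _ s0) mul1r.
Qed.

(** The terms up to H + 1 are at most 1; beyond, q^(k^2) <= exp (-y k^2) <= 1 / (y k^2) <= (H+1)^2 /
    k^2, whose sum telescopes. In all 1 + 4 (H + 1) <= 9 H. *)
Lemma Th_le9 T H q : 0 <= q < 1 -> (0 < H)%N -> 1 < H.+1%:R ^+ 2 * (1 - q) ->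
  Th T q <= 9 * H%:R.
Proof.
move=> /andP[q0 q1] H0 Hy; set y := 1 - q in Hy.
have y0 : 0 < y by rewrite /y; lra.
have b k : q ^+ (k.+1 ^ 2) <= H.+1%:R ^+ 2 / k.+1%:R ^+ 2.
  apply: (le_trans (exprn_le_expR _ q0)); rewrite -/y expRN natrX.
  have hk : (0 : R) < k.+1%:R ^+ 2 by rewrite exprn_gt0.
  rewrite ler_pdivlMr// mulrC ler_pdivrMr ?expR_gt0//.
  have := expR_ge1Dx (y * k.+1%:R ^+ 2) => he.
  apply: (@le_trans _ _ (H.+1%:R ^+ 2 * (y * k.+1%:R ^+ 2))).
    by rewrite mulrA ler_peMl// ltW.
  by rewrite ler_wpM2l ?sqr_ge0//; lra.
have b1 k : q ^+ k <= 1 by rewrite exprn_ile1// ltW.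
pose S k := \sum_(i < k) q ^+ (i.+1 ^ 2).
have S1 k : S k <= k%:R.
  elim: k => [|k IH]; first by rewrite /S big_ord0.
  by rewrite /S big_ord_recr/= -natr1 lerD.
have S2 k : S (H.+1 + k)%N <= 2 * H.+1%:R - H.+1%:R ^+ 2 / (H.+1 + k)%:R.
  elim: k => [|k IH].
    rewrite addn0; apply: (le_trans (S1 _)).
    by rewrite expr2 mulfK//; lra.
  rewrite addnS /S big_ord_recr/= -/(S _).
  apply: (le_trans (lerD IH (b _))).
  set m := (H.+1 + k)%N; have m0 : (0 : R) < m%:R by rewrite ltr0n.
  rewrite -addrA lerD2l -(natr1 m); set A := H.+1%:R ^+ 2.
  have A0 : 0 <= A by rewrite sqr_ge0.
  have m1 : (0 : R) < m%:R + 1 by lra.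
  have -> : - (A / m%:R) + A / (m%:R + 1) ^+ 2 =
    - (A / (m%:R + 1)) - A * (m%:R * (m%:R + 1) ^+ 2)^-1.
    by field; rewrite !gt_eqF.
  by rewrite gerDl oppr_le0 mulr_ge0// invr_ge0 mulr_ge0 ?sqr_ge0.
have ST : S T <= 2 * H.+1%:R.
  have [TH|TH] := leqP T H.+1.
    by apply: (le_trans (S1 _)); rewrite -natrM ler_nat; lia.
  have := S2 (T - H.+1)%N; rewrite subnKC ?(ltnW TH)// => /le_trans; apply.
  by rewrite gerBl divr_ge0// sqr_ge0.
have HR : (1 : R) <= H%:R by rewrite ler1n.
rewrite Th_E -/(S T); move: ST; rewrite -natr1; lra.
Qed.

(** The factor q on the left is for H = 1, where the power is q itself and may be small. For H >= 2
    one has q >= 3/4, and (2H-1)^2 <= 4 H^2 gives the exponent 8. *)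
Lemma exprn_H_ge q H : 0 < q < 1 -> (0 < H)%N -> H%:R ^+ 2 * (1 - q) <= 1 ->
  expR (- 8) * q <= q ^+ ((2 * H - 1) ^ 2).
Proof.
move=> /andP[q0 q1] H0 Hy.
case: H H0 Hy => [//|[|H]] _ Hy.
  by rewrite exp1n expr1 ler_piMl ?ltW// -expR0 ler_ltW ?ltr_expR//; lra.
have hq : 3 / 4 <= q.
  have : (2 : R) ^+ 2 * (1 - q) <= 1; last by lra.
  apply: le_trans Hy; rewrite ler_wpM2r ?lerXn2r ?nnegrE ?ler_nat//; lra.
apply: (@le_trans _ _ (expR (- 8))); first by rewrite ler_piMr ?expR_ge0// ltW.
apply: le_trans (@exprn_ge_expR q _ _); last by lra.
rewrite ler_expR lerN2.
apply: (@le_trans _ _ (2 * (1 - q) * (4 * H.+2%:R ^+ 2))); last by lra.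
rewrite ler_wpM2l//; first by lra.
by rewrite -natrX -natrM ler_nat; nia.
Qed.

(** Makes the second difference 2 phi h^2 of [th_loss] neither negligible nor larger than pi: h = H
    if phi H^2 <= 1, h = 1 if phi > 1, and otherwise h is the integer part of 1 / sqrt phi. *)
Lemma choose_step y phi H : 0 < y -> 0 < phi <= pi / 2 -> (0 < H)%N ->
  1 < H.+1%:R ^+ 2 * y ->
  exists2 h : nat, (0 < h <= H)%N &
    Num.min 1 (phi / y) / 4 <= phi * (h ^ 2)%:R <= pi / 2.
Proof.
move=> y0 /andP[p0 p1] H0 Hy.
have pi2 : 1 <= pi / 2 :> R by exact: pihalf_ge1.
have m1 : Num.min 1 (phi / y) <= 1 by rewrite ge_min lexx.
have [HH|HH] := leP (phi * (H ^ 2)%:R) 1.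
  exists H; first by rewrite H0 leqnn.
  rewrite (le_trans HH)// andbT.
  apply: (@le_trans _ _ (phi / y / 4)); first by rewrite ler_pM2r ?invr_gt0// ge_min lexx orbT.
  rewrite -mulrA ler_pM2l// ler_pdivrMr// -[leLHS]mul1r ler_pdivrMr//.
  have : (H.+1 ^ 2 <= 4 * H ^ 2)%N by nia.
  rewrite -(ler_nat R) natrM !natrX.
  nra.
have [pl|pl] := leP phi 1; last first.
  exists 1%N; first by rewrite H0.
  by rewrite exp1n mulr1 p1 andbT; lra.
have [h [h0 h1 h2]] := floor_invsqrt (introT andP (conj p0 pl)).
exists h.
  rewrite h0/= leqNgt; apply/negP => hH.
  suff : (H ^ 2)%:R <= h%:R ^+ 2 :> R by nra.
  by rewrite natrX lerXn2r ?nnegrE// ler_nat ltnW.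
rewrite natrX; apply/andP; split; last by lra.
have : (h.+1 ^ 2 <= 4 * h ^ 2)%N by nia.
rewrite -(ler_nat R) natrM !natrX => h3.
nra.
Qed.

(** exp (-8) comes from [exprn_H_ge], 9 from [Th_le9], 18 from [th_loss], and 72 from 2 sin^2 a with
    sin a >= a / 3 and a at least a quarter of the minimum in [choose_step]. *)
Definition decay_cst : R := expR (- 8) / (9 * 18 * 72).

Lemma decay_cst_gt0 : 0 < decay_cst.
Proof. by rewrite divr_gt0 ?expR_gt0 ?mulr_gt0. Qed.

(** At least H triples of weight of order q lose mass, and [Th] is at most 9 H, so the loss is
    proportional to [Th]. The condition on T gives 2H <= T, which keeps the triples inside the
    truncation. *)
Lemma th_decay T q phi t : 0 < q < 1 ->
  4 <= T%:R ^+ 2 * (1 - q) -> `|phi| <= pi / 2 ->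
  cn (th T (q%:C * ce phi) t) <=
    Th T q * (1 - decay_cst * q * Num.min 1 (`|phi| / (1 - q)) ^+ 2).
Proof.
move=> /andP[q0 q1] HT Hphi.
have [->|phi0] := eqVneq phi 0.
  rewrite normr0 mul0r [Num.min _ _]min_r// expr0n mulr0 subr0 mulr1.
  by apply: (le_trans (cn_thle _ _ _)); rewrite ce0 mulr1 cn_real ger0_norm// ltW.
have y01 : 0 < 1 - q <= 1 by lra.
have y0 : 0 < 1 - q by lra.
have [H [H0 H1 H2]] := floor_invsqrt y01.
have p0 : 0 < `|phi| <= pi / 2 by rewrite normr_gt0 phi0.
have [h hH /andP[h1 h2]] := choose_step y0 p0 H0 H2.
set mn := Num.min 1 _ in h1 *.
have mn0 : 0 <= mn by rewrite le_min ler01 divr_ge0// ltW.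
have TH : (2 * H <= T)%N.
  rewrite -(ler_nat R) -(ler_pXn2r (n := 2))// ?nnegrE// natrM.
  by rewrite -(ler_pM2r y0); apply: le_trans HT; lra.
have q01 : 0 <= q <= 1 by lra.
apply: (le_trans (th_loss _ _ q01 H0 hH TH)).
rewrite [leRHS]mulrBr mulr1 lerD2l lerN2.
set a := `|phi| * (h ^ 2)%:R in h1 h2.
have -> : cos (2 * phi * (h ^ 2)%:R) = 1 - 2 * sin a ^+ 2.
  rewrite -mulrA -cos_norm normrM (ger0_norm (x := 2))// normrM (ger0_norm (x := _%:R))//.
  by rewrite -/a mulr_natl cos_mulr2n cos2sin2; lra.
have a0 : 0 <= a <= pi / 2 by rewrite h2 (le_trans _ h1)// divr_ge0.
have sa := sin_ge_third a0.
have s2 : mn ^+ 2 / 72 <= 1 - (1 - 2 * sin a ^+ 2).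
  have : (mn / 12) ^+ 2 <= sin a ^+ 2; last by lra.
  by apply: lerXn2r; rewrite ?nnegrE; lra.
have g1 := exprn_H_ge (introT andP (conj q0 q1)) H0 H1.
have g2 : Th T q <= 9 * H%:R by apply: Th_le9 => //; rewrite q1 ltW.
have T0 : 0 <= Th T q by rewrite ltW// Th_gt0// ltW.
have H0R : (0 : R) <= H%:R by [].
have e8 := @expR_gt0 R (- 8).
apply: (@le_trans _ _ (H%:R * (expR (- 8) * q / 18) * (mn ^+ 2 / 72))).
  apply: (@le_trans _ _ (9 * H%:R * (decay_cst * q * mn ^+ 2))).
    by rewrite ler_wpM2r// !mulr_ge0 ?sqr_ge0 ?(ltW decay_cst_gt0)// ltW.
  by rewrite le_eqVlt /decay_cst; apply/orP; left; apply/eqP; field.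
apply: ler_pM => //.
- by rewrite !mulr_ge0 ?expR_ge0// ltW.
- by rewrite divr_ge0 ?sqr_ge0.
- by rewrite ler_wpM2l// ler_wpM2r.
Qed.

End Estimates.

(** * Moments of k^2 and the saddle point *)

Section Moments.
Variable R : realType.
Implicit Types (q y phi t x m : R) (T H k n j : nat).

(** Unnormalised: the j-th moment of k^2 under the weights q^(k^2) is the quotient by [Th]. *)
Definition mom T j q : R := isum T (fun k : int => (sq k)%:R ^+ j * q ^+ sq k).

Lemma momE T j q : (0 < j)%N ->
  mom T j q = 2 * \sum_(k < T) (k.+1 ^ 2)%:R ^+ j * q ^+ (k.+1 ^ 2).
Proof.
move=> j0; rewrite /mom /isum /sq/= exp0n// expr0n gtn_eqF// mul0r add0r mulr_sumr.
by apply: eq_bigr => i _; ring.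
Qed.

Lemma sum_half n (f : nat -> R) :
  \sum_(k < n.*2) f k./2 = 2 * \sum_(k < n) f k.
Proof.
elim: n => [|n IH]; first by rewrite !big_ord0 mulr0.
by rewrite doubleS !big_ord_recr/= IH uphalf_double doubleK; ring.
Qed.

Definition mom_cst j : R := 4 * (9 ^+ j * j%:R ^+ j).

Lemma mom_cst_ge0 j : 0 <= mom_cst j.
Proof. by rewrite /mom_cst !mulr_ge0 ?exprn_ge0. Qed.

(** For k >= 2 and i = floor (k / 2), q^(k^2) <= q q^(i^2) q^(i^2): one q^(i^2) absorbs (9 i^2)^j by
    [pow_expRN_le], the other sums to at most 2 Th since each i occurs twice. The single factor q is
    kept because q may be near 0, and it later combines with d. *)
Lemma mom_le T j q : (0 < j)%N -> 0 < q < 1 ->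
  mom T j q <= mom_cst j * (q / (1 - q) ^+ j) * Th T q.
Proof.
move=> j0 /andP[q0 q1]; set y := 1 - q; have y0 : 0 < y by rewrite /y; lra.
have y1 : y <= 1 by rewrite /y; lra.
have j1 : (1 : R) <= j%:R by rewrite ler1n.
have q00 := ltW q0; have q11 := ltW q1.
pose B := 9 ^+ j * j%:R ^+ j / y ^+ j.
have B1 : 1 <= B.
  rewrite /B ler_pdivlMr ?exprn_gt0// mul1r -exprMn.
  by apply: lerXn2r; rewrite ?nnegrE; lra.
have term k : (k.+1 ^ 2)%:R ^+ j * q ^+ (k.+1 ^ 2) <= q * B * q ^+ (k.+1./2 ^ 2).
  case: k => [|k].
    by rewrite exp1n !expr1n mul1r expr1 expr0 mulr1 ler_peMr.
  set i := k.+2./2; have i0 : (0 < i)%N by rewrite /i/=.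
  have ki : (k.+2 <= 3 * i)%N by rewrite /i; have := odd_double_half k.+2; lia.
  have ki2 : (2 * i <= k.+2)%N by rewrite /i; have := odd_double_half k.+2; lia.
  apply: (@le_trans _ _ ((9 * (i ^ 2)%:R) ^+ j * (q * (q ^+ (i ^ 2) * q ^+ (i ^ 2))))).
    apply: ler_pM; rewrite ?exprn_ge0//.
      apply: lerXn2r; rewrite ?nnegrE// ?mulr_ge0//.
      by rewrite -natrM ler_nat; nia.
    by rewrite -exprD -exprS; apply: ler_wiXn2l => //; nia.
  rewrite exprMn mulrC -!mulrA ler_pM2l//.
  rewrite [leRHS]mulrA [leRHS]mulrC mulrC -!mulrA.
  rewrite [leLHS]mulrCA.
  have h := @pow_expRN_le R j (y * (i ^ 2)%:R) j0 (mulr_ge0 (ltW y0) (ler0n _ _)).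
  have h2 := exprn_le_expR (i ^ 2) q00.
  rewrite -/y in h2.
  have iq : (i ^ 2)%:R ^+ j * q ^+ (i ^ 2) <= j%:R ^+ j / y ^+ j.
    rewrite ler_pdivlMr ?exprn_gt0//; apply: le_trans h.
    by rewrite exprMn mulrAC [X in X * _ <= _]mulrC ler_wpM2l// mulr_ge0 ?exprn_ge0// ltW.
  rewrite /B; set Q := q ^+ (i ^ 2) in iq *.
  have Q0 : 0 <= Q by rewrite exprn_ge0.
  have : 9 ^+ j * Q * ((i ^ 2)%:R ^+ j * Q) <= 9 ^+ j * Q * (j%:R ^+ j / y ^+ j).
    by rewrite ler_wpM2l// mulr_ge0// exprn_ge0.
  by lra.
rewrite momE//.
apply: (@le_trans _ _ (2 * \sum_(k < T) q * B * q ^+ (k.+1./2 ^ 2))).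
  by rewrite ler_pM2l//; apply: ler_sum => k _; exact: term.
rewrite -mulr_sumr.
have S1 : \sum_(k < T) q ^+ (k.+1./2 ^ 2) <= 2 * Th T q.
  apply: (@le_trans _ _ (\sum_(k < T.+1.*2) q ^+ (k./2 ^ 2))).
    rewrite -!(big_mkord xpredT (fun k => q ^+ (k./2 ^ 2))).
    rewrite -(big_mkord xpredT (fun k => q ^+ (k.+1./2 ^ 2))).
    rewrite -(big_add1 _ _ 0 T.+1 xpredT (fun k => q ^+ (k./2 ^ 2))).
    rewrite [leRHS](@big_cat_nat _ _ _ T.+1)//=; last by lia.
    rewrite [X in _ <= X + _]big_ltn//.
    have : 0 <= \sum_(T.+1 <= i < T.+1.*2) q ^+ (i./2 ^ 2).
      by apply: sumr_ge0 => i _; rewrite exprn_ge0.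
    by rewrite /= expr0; lra.
  rewrite (sum_half T.+1 (fun k => q ^+ (k ^ 2))) ler_pM2l// big_ord_recl expr0 Th_E lerD2l.
  rewrite ler_peMl// ?sumr_ge0//; first by move=> i _; rewrite exprn_ge0.
  by rewrite ler1n.
have -> : mom_cst j * (q / y ^+ j) * Th T q = 2 * (q * B * (2 * Th T q)).
  by rewrite /mom_cst /B; ring.
by rewrite ler_pM2l// ler_wpM2l// mulr_ge0//; lra.
Qed.

Lemma Th_ge12 T q : (0 < T)%N -> 0 <= q -> 1 + 2 * q <= Th T q.
Proof.
move=> T0 q0; rewrite Th_E lerD2l ler_pM2l//; case: T T0 => // T _.
rewrite big_ord_recl expr1 lerDl sumr_ge0// => i _; exact: exprn_ge0.
Qed.

(** k^2 >= 1 for k != 0 gives Th - 1 <= mom, and Th >= 1 + 2 q gives 1 - 1 / Th >= 2 q / 3. *)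
Lemma mom1_ge T q : (0 < T)%N -> 0 < q < 1 -> 2 / 3 * q * Th T q <= mom T 1 q.
Proof.
move=> T0 /andP[q0 q1].
have h1 : Th T q - 1 <= mom T 1 q.
  rewrite Th_E momE// addrAC subrr add0r ler_pM2l//; apply: ler_sum => i _.
  by rewrite expr1 ler_peMl ?exprn_ge0 ?(ltW q0)// ler1n expn_gt0.
have h2 := Th_ge12 T0 (ltW q0).
nra.
Qed.

Lemma cube_le_sum K : (K ^ 3 <= 3 * \sum_(k < K) k.+1 ^ 2)%N.
Proof.
elim: K => // K; rewrite big_ord_recr/=; move: (\sum_(k < K) _)%N => S.
by rewrite !expnS !expn0; nia.
Qed.

Definition gap_cst : R := 2 * expR (- 2) / 27.

Lemma gap_cst_gt0 : 0 < gap_cst.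
Proof. by rewrite divr_gt0 ?mulr_gt0 ?expR_gt0. Qed.

(** For k <= K = min (H, T) the weight is at least exp (-2), so the first moment is at least 2 exp
    (-2) K^3 / 3, while Th <= 9 K. The minimum with T accounts for the truncation. *)
Lemma mom1_ge_sqr T q H : (0 < T)%N -> 0 < q < 1 -> (1 < H)%N ->
  H%:R ^+ 2 * (1 - q) <= 1 -> 1 < H.+1%:R ^+ 2 * (1 - q) ->
  gap_cst * (minn H T)%:R ^+ 2 * Th T q <= mom T 1 q.
Proof.
move=> T0 /andP[q0 q1] H1 Hy1 Hy2; set K := minn H T.
have HK : (K <= H)%N := geq_minl _ _.
have TK : (K <= T)%N := geq_minr _ _.
have q12 : 2^-1 <= q <= 1.
  have : (2 : R) ^+ 2 * (1 - q) <= 1; last by lra.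
  apply: le_trans Hy1; rewrite ler_wpM2r//; first by lra.
  by apply: lerXn2r; rewrite ?nnegrE// ler_nat.
have T9 : Th T q <= 9 * K%:R.
  rewrite /K; case: leqP => HT.
    by apply: Th_le9 => //; [rewrite q1 ltW|exact: ltnW].
  apply: (@le_trans _ _ (1 + 2 * T%:R)); last first.
    have TR : (1 : R) <= T%:R by rewrite ler1n.
    lra.
  rewrite Th_E lerD2l ler_pM2l// -[leRHS]mulr1 mulr_natl -[X in _ <= _ *+ X](card_ord T).
  rewrite -sumr_const; apply: ler_sum => i _.
  by rewrite exprn_ile1// ltW.
have hq : expR (- 2) <= q ^+ (H ^ 2).
  apply: le_trans (exprn_ge_expR _ q12).
  by rewrite ler_expR lerN2 natrX; lra.
have h3 : 2 * (expR (- 2) * (K%:R ^+ 3 / 3)) <= mom T 1 q.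
  rewrite momE// ler_pM2l//.
  apply: (@le_trans _ _ (expR (- 2) * \sum_(k < K) (k.+1 ^ 2)%:R)).
    rewrite ler_pM2l ?expR_gt0//.
    have := cube_le_sum K; rewrite -(ler_nat R) natrM natrX natr_sum; lra.
  rewrite mulr_sumr.
  rewrite -(big_mkord xpredT (fun k => (k.+1 ^ 2)%:R ^+ 1 * q ^+ (k.+1 ^ 2))).
  rewrite (@big_cat_nat _ _ _ K)//= big_mkord -[leLHS]addr0 lerD//; last first.
    by apply: sumr_ge0 => i _; rewrite mulr_ge0 ?exprn_ge0// ltW.
  apply: ler_sum => i _; rewrite expr1 mulrC ler_wpM2l//.
  apply: (le_trans hq); apply: ler_wiXn2l; rewrite ?(ltW q0) ?(ltW q1)//.
  by have := ltn_ord i; nia.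
apply: le_trans h3; rewrite /gap_cst.
have e0 := @expR_gt0 R (- 2).
have : expR (- 2) * K%:R ^+ 2 * Th T q <= expR (- 2) * K%:R ^+ 2 * (9 * K%:R).
  by rewrite ler_wpM2l// mulr_ge0 ?sqr_ge0// ltW.
lra.
Qed.

(* Keeps q away from 1 uniformly in the truncation T. *)
Lemma gap_le T q m : (0 < T)%N -> 0 < q < 1 -> mom T 1 q = m * Th T q ->
  m < gap_cst * T%:R ^+ 2 ->
  (1 - q)^-1 <= 4 / gap_cst * Num.max 1 m.
Proof.
move=> T0 /andP[q0 q1] hm mT.
have y01 : 0 < 1 - q <= 1 by lra.
have y0 : 0 < 1 - q by lra.
have c0 := gap_cst_gt0.
have c1 : gap_cst <= 1.
  have : expR (- 2) <= 1 :> R by rewrite expR_le1; lra.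
  by rewrite /gap_cst; lra.
have [H [H0 H1 H2]] := floor_invsqrt y01.
have mx1 : 1 <= Num.max 1 m by rewrite le_max lexx.
have mxm : m <= Num.max 1 m by rewrite le_max lexx orbT.
rewrite -[leLHS]mul1r ler_pdivrMr//.
have [Hb|Hs] := leqP 2 H; last first.
  have HE : H = 1%N by move: H0 Hs; clear; lia.
  rewrite HE in H2; apply: (le_trans (ltW H2)).
  rewrite ler_wpM2r//; first exact: ltW.
  rewrite -mulrA -[leLHS]mulr1; apply: ler_pM => //; first by lra.
  by rewrite -[leLHS]mulr1 ler_pM// invf_ge1.
have := mom1_ge_sqr T0 (introT andP (conj q0 q1)) Hb H1 H2.
rewrite hm ler_pM2r ?Th_gt0 ?(ltW q0)// => h.
(* If T < H, the lower bound would read gap_cst T^2 <= m, against the choice of T. *)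
have KH : minn H T = H.
  case: (leqP H T) => // TH; exfalso.
  move: h; rewrite (minn_idPr (ltnW TH)); lra.
rewrite KH in h.
apply: (le_trans (ltW H2)); rewrite ler_wpM2r//; first exact: ltW.
apply: (@le_trans _ _ (4 * H%:R ^+ 2)).
  by rewrite -!natrX -natrM ler_nat; move: H0; clear; nia.
rewrite -mulrA ler_pM2l// ler_pdivlMl//; lra.
Qed.

(* T is large but finite, so the saddle-point equation is a polynomial one and [poly_ivt] applies. *)
Lemma mean_exists T m : (0 < T)%N -> 0 < m -> 9 * m < T%:R ^+ 2 ->
  exists2 q : R, 0 < q < 1 & mom T 1 q = m * Th T q.
Proof.
move=> T0 m0 mT.
pose p : {poly R} := isum T (fun k : int => ((sq k)%:R - m)%:P * 'X^(sq k)).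
have pE x : p.[x] = mom T 1 x - m * Th T x.
  rewrite /mom /Th -isumZl -isumB /p.
  rewrite -horner_evalE (raddf_isum (horner_eval x)); apply: eq_isum => k _.
  by rewrite /= horner_evalE hornerM hornerC hornerXn expr1; ring.
have p0 : p.[0] < 0.
  rewrite pE momE// Th_E !big1 ?mulr0 ?addr0 ?mulr1 ?sub0r ?oppr_lt0// => i _.
    by rewrite expr0n expn_eq0.
  by rewrite expr0n expn_eq0/= mulr0.
have TR : (1 : R) <= T%:R by rewrite ler1n.
have p1 : 0 < p.[1].
  rewrite pE momE// Th_E.
  rewrite (eq_bigr (fun k : 'I_T => (k.+1 ^ 2)%:R)); last first.
    by move=> i _; rewrite expr1n mulr1 expr1.
  rewrite [\sum_(k < T) 1 ^+ _](eq_bigr (fun=> 1)); last by move=> i _; rewrite expr1n.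
  rewrite sumr_const card_ord -natr_sum.
  have := cube_le_sum T; rewrite -(ler_nat R) natrM natrX.
  have : T%:R * (9 * m) < T%:R * T%:R ^+ 2 by rewrite ltr_pM2l//; lra.
  rewrite -exprS; move: (\sum_(k < T) _)%N => S; nra.
have [x /andP[x0 x1] /rootP px] := @poly_ivt R p 0 1 ler01 (introT andP (conj (ltW p0) (ltW p1))).
exists x; last by apply/eqP; rewrite -subr_eq0 -pE px.
rewrite !lt_def x0 x1 !andbT; apply/andP; split.
  by apply/eqP => x00; rewrite x00 in px; rewrite px ltxx in p0.
by apply/eqP => x11; rewrite -x11 in px; rewrite px ltxx in p1.
Qed.

End Moments.

(** * The characteristic function of k^2 near phi = 0 *)

Section LocalLimit.
Variable R : realType.
Implicit Types (q y phi t x m s a c : R) (T H n j d Q : nat).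

(** (1 + s)^j <= exp (j s), then completion of the square in j s - c s^2. *)
Lemma powgauss_le j c : 0 < c ->
  exists2 G : R, 0 < G & forall s, 0 <= s -> (1 + s) ^+ j * expR (- (c * s ^+ 2)) <= G.
Proof.
move=> c0; exists (expR (j%:R ^+ 2 / (4 * c))); first exact: expR_gt0.
move=> s s0; apply: (@le_trans _ _ (expR (s * j%:R) * expR (- (c * s ^+ 2)))).
  rewrite ler_pM2r ?expR_gt0// expRM_natr; apply: lerXn2r; rewrite ?nnegrE ?expR_ge0//.
    by lra.
  exact: expR_ge1Dx.
rewrite -expRD ler_expR ler_pdivlMr; last by lra.
by have := sqr_ge0 (2 * c * s - j%:R); nra.
Qed.

Lemma pow_expR_small j c e : 0 < c -> 0 < e ->
  exists K, forall D, (K <= D)%N -> D%:R ^+ j * expR (- (c * D%:R)) <= e.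
Proof.
move=> c0 e0; pose B := j.+1%:R ^+ j.+1 / c ^+ j.+1 : R.
have B0 : 0 < B by rewrite divr_gt0 ?exprn_gt0.
exists (Num.truncn (B / e)).+1 => D HD.
have D0 : (0 < D)%N by exact: leq_trans HD.
have DR : (0 : R) < D%:R by rewrite ltr0n.
have HB : B / e <= D%:R.
  apply: (@le_trans _ _ (Num.truncn (B / e)).+1%:R); last by rewrite ler_nat.
  have /andP[_] : (Num.truncn (B / e))%:R <= B / e < (Num.truncn (B / e)).+1%:R.
    by apply: truncn_itv; rewrite divr_ge0// ltW.
  exact: ltW.
have := @pow_expRN_le R j.+1 (c * D%:R) isT (mulr_ge0 (ltW c0) (ltW DR)).
rewrite exprMn -mulrA mulrC -ler_pdivlMr ?exprn_gt0// -/B => h.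
rewrite exprS -mulrA in h.
rewrite ler_pdivrMr// in HB.
rewrite -(ler_pM2l DR); apply: (le_trans h); by rewrite (le_trans HB).
Qed.

(** A Riemann sum of step D for (1 + |s|)^-2, bounded uniformly in Q through D / (x + D)^2 <= 1 / x
    - 1 / (x + D). *)
Lemma sum_inv_sq Q (D : R) : 0 < D ->
  isum Q (fun k => D / (1 + (absz k)%:R * D) ^+ 2) <= D + 2.
Proof.
move=> D0; rewrite /isum mul0r addr0 expr1n divr1 lerD2l.
suff : \sum_(k < Q) (D / (1 + k.+1%:R * D) ^+ 2) <= 1 - (1 + Q%:R * D)^-1.
  have -> : \sum_(k < Q) (D / (1 + `|k.+1%:Z|%N%:R * D) ^+ 2 +
      D / (1 + `|- k.+1%:Z|%N%:R * D) ^+ 2) =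
      2 * \sum_(k < Q) (D / (1 + k.+1%:R * D) ^+ 2).
    by rewrite mulr_sumr; apply: eq_bigr => i _; rewrite abszN/=; ring.
  have : 0 <= (1 + Q%:R * D)^-1 by rewrite invr_ge0 addr_ge0// mulr_ge0// ltW.
  by lra.
elim: Q => [|Q IH]; first by rewrite big_ord0 mul0r addr0 invr1 subrr.
rewrite big_ord_recr/=; apply: (le_trans (lerD IH (lexx _))).
rewrite -addrA lerD2l -(natr1 Q).
set x := 1 + Q%:R * D.
have x0 : 0 < x by rewrite /x ltr_pwDl// mulr_ge0// ltW.
have -> : 1 + (Q%:R + 1) * D = x + D by rewrite /x; ring.
have xD : 0 < x + D by lra.
have -> : - x^-1 + D / (x + D) ^+ 2 = - (x + D)^-1 - D ^+ 2 * (x * (x + D) ^+ 2)^-1.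
  by field; rewrite !gt_eqF.
by rewrite gerDl oppr_le0 mulr_ge0 ?sqr_ge0// invr_ge0 mulr_ge0 ?sqr_ge0// ltW.
Qed.

Lemma alt_sum_itv (f : nat -> R) n : (forall k, 0 <= f k.+1 <= f k) ->
  0 <= \sum_(k < n) (- 1) ^+ k * f k <= f 0%N.
Proof.
elim: n f => [|n IH] f Hf.
  by rewrite big_ord0 lexx/=; have /andP[h1 h2] := Hf 0%N; lra.
rewrite big_ord_recl expr0 mul1r.
have -> : \sum_(i < n) (- 1) ^+ lift ord0 i * f (lift ord0 i) =
    - \sum_(k < n) (- 1) ^+ k * f k.+1.
  by rewrite -sumrN; apply: eq_bigr => i _; rewrite /= /bump/= add1n exprS; ring.
have := IH (fun k => f k.+1) (fun k => Hf k.+1).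
have /andP[h1 h2] := Hf 0%N; rewrite [nat_of_ord _]/=.
by move=> /andP[h3 h4]; apply/andP; split; lra.
Qed.

Variables (T : nat) (q m : R).
Hypotheses (T0 : (0 < T)%N) (q01 : 0 < q < 1) (hm : mom T 1 q = m * Th T q).

Let y : R := 1 - q.

Let q0 : 0 < q. Proof. by case/andP: q01. Qed.
Let q00 : 0 <= q. Proof. exact: ltW. Qed.
Let y0 : 0 < y. Proof. by rewrite /y; case/andP: q01; lra. Qed.
Let y00 : 0 <= y. Proof. exact: ltW. Qed.
Let y1 : y <= 1. Proof. by rewrite /y gerBl. Qed.
Let Th0 : 0 < Th T q. Proof. exact: Th_gt0. Qed.

Lemma mean_le : m <= mom_cst R 1 * (q / y).
Proof.
have := mom_le T (ltn0Sn 0) q01; rewrite hm expr1 -/y.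
by rewrite ler_pM2r.
Qed.

Lemma mean_ge : 2 / 3 * q <= m.
Proof. by have := mom1_ge T0 q01; rewrite hm ler_pM2r. Qed.

Let m0 : 0 <= m. Proof. by have := mean_ge; have := q0; lra. Qed.

Let qy j : m ^+ j.+1 <= mom_cst R 1 ^+ j.+1 * (q / y ^+ j.+1).
Proof.
apply: (@le_trans _ _ ((mom_cst R 1 * (q / y)) ^+ j.+1)).
  apply: lerXn2r; rewrite ?nnegrE//; last exact: mean_le.
  by rewrite mulr_ge0 ?mom_cst_ge0// divr_ge0.
rewrite exprMn ler_wpM2l ?exprn_ge0 ?mom_cst_ge0// expr_div_n ler_wpM2r//.
  by rewrite invr_ge0 exprn_ge0.
by rewrite exprS ler_piMr// exprn_ile1//; case/andP: q01; lra.
Qed.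

Let dev (k : int) : R := (sq k)%:R - m.

(** Unnormalised characteristic function of k^2 - m. Centring at the mean removes the term linear in
    phi. *)
Definition psi phi : R[i] := isum T (fun k : int => (q ^+ sq k)%:C * ce (phi * ((sq k)%:R - m))).

Lemma th_psi phi : th T (q%:C * ce phi) 0 = ce (phi * m) * psi phi.
Proof.
rewrite /psi -isumZl; apply: eq_isum => k _.
rewrite /phase !mulr0 ce0 mulr1 exprMn ceX mulrCA -ceD rmorphXn/=.
by congr (_ * ce _); ring.
Qed.

Lemma Re_isum (f : int -> R[i]) : Re (isum T f) = isum T (fun k => Re (f k)).
Proof. exact: (raddf_isum (@complex.Re R : Rcomplex R -> R)). Qed.

Lemma Im_isum (f : int -> R[i]) : Im (isum T f) = isum T (fun k => Im (f k)).
Proof. exact: (raddf_isum (@complex.Im R : Rcomplex R -> R)). Qed.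

Lemma Re_realM x (z : R[i]) : Re (x%:C * z) = x * Re z.
Proof. by case: z => a b /=; rewrite mul0r subr0. Qed.

Lemma Im_realM x (z : R[i]) : Im (x%:C * z) = x * Im z.
Proof. by case: z => a b /=; rewrite mul0r addr0. Qed.

Definition dev_cst j : R := mom_cst R j + mom_cst R 1 ^+ j.

Let dev_le j (f : int -> R) : (0 < j)%N ->
  (forall k, f k <= (sq k)%:R ^+ j + m ^+ j) ->
  isum T (fun k => f k * q ^+ sq k) <= dev_cst j * (q / y ^+ j) * Th T q.
Proof.
move=> j0 Hf; rewrite mulrDl mulrDl.
apply: (@le_trans _ _ (mom T j q + m ^+ j * Th T q)).
  rewrite /mom /Th -isumZl -isumD; apply: le_isum => k _.
  by rewrite -mulrDl ler_wpM2r ?exprn_ge0.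
by rewrite lerD ?mom_le// ler_pM2r//; case: j j0 {Hf} => // j _; exact: qy.
Qed.

(** The linear part of the sines sums to 0 because m is the mean ([dev0]); [sin_sub_le] leaves the
    third absolute moment of k^2 - m. *)
Lemma Im_psi_le phi : `|Im (psi phi)| <= dev_cst 3 * (q / y ^+ 3) * `|phi| ^+ 3 * Th T q.
Proof.
have dev0 : isum T (fun k => phi * (dev k * q ^+ sq k)) = 0.
  rewrite isumZl.
  have -> : isum T (fun k => dev k * q ^+ sq k) = mom T 1 q - m * Th T q.
    rewrite /mom /Th -isumZl -isumB; apply: eq_isum => k _.
    by rewrite expr1 mulrBl.
  by rewrite hm subrr mulr0.
rewrite /psi Im_isum -[isum _ _]subr0 -dev0 -isumB.
have -> : dev_cst 3 * (q / y ^+ 3) * `|phi| ^+ 3 * Th T q =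
  `|phi| ^+ 3 * (dev_cst 3 * (q / y ^+ 3) * Th T q) by ring.
apply: (@le_trans _ _ (`|phi| ^+ 3 * isum T (fun k => `|dev k| ^+ 3 / 6 * q ^+ sq k))).
  rewrite -isumZl; apply: (@le_trans _ _ (isum T (fun k =>
    `|Im ((q ^+ sq k)%:C * ce (phi * ((sq k)%:R - m))) - phi * (dev k * q ^+ sq k)|))).
    rewrite -cn_real -isum_real; apply: (le_trans (cn_isum _ _)).
    by apply: le_isum => k _; rewrite cn_real.
  apply: le_isum => k _; rewrite Im_realM/= -/(dev k).
  have -> : q ^+ sq k * sin (phi * dev k) - phi * (dev k * q ^+ sq k) =
    q ^+ sq k * (sin (phi * dev k) - phi * dev k) by ring.
  rewrite normrM ger0_norm ?exprn_ge0//.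
  have -> : `|phi| ^+ 3 * (`|dev k| ^+ 3 / 6 * q ^+ sq k) =
    q ^+ sq k * (`|phi * dev k| ^+ 3 / 6) by rewrite normrM; ring.
  by rewrite ler_wpM2l ?exprn_ge0// sin_sub_le.
rewrite ler_wpM2l ?exprn_ge0//; apply: dev_le => // k.
have k0 : (0 : R) <= (sq k)%:R by [].
have m00 := m0.
rewrite /dev; have [h|h] := leP m (sq k)%:R.
  have : ((sq k)%:R - m) ^+ 3 <= (sq k)%:R ^+ 3 by apply: lerXn2r; rewrite ?nnegrE; lra.
  rewrite ger0_norm ?subr_ge0//.
  have : 0 <= m ^+ 3 by rewrite exprn_ge0.
  have : (0 : R) <= (sq k)%:R ^+ 3 by rewrite exprn_ge0.
  lra.
rewrite ltr0_norm ?subr_lt0// opprB.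
have : (m - (sq k)%:R) ^+ 3 <= m ^+ 3 by apply: lerXn2r; rewrite ?nnegrE; lra.
have : 0 <= m ^+ 3 by rewrite exprn_ge0.
have : (0 : R) <= (sq k)%:R ^+ 3 by rewrite exprn_ge0.
lra.
Qed.

Lemma Re_psi_ge phi : (1 - dev_cst 2 * (q / y ^+ 2) * phi ^+ 2) * Th T q <= Re (psi phi).
Proof.
rewrite mulrBl mul1r.
apply: (@le_trans _ _ (Th T q - phi ^+ 2 * isum T (fun k => dev k ^+ 2 / 2 * q ^+ sq k))).
  rewrite lerD2l lerN2.
  have -> : dev_cst 2 * (q / y ^+ 2) * phi ^+ 2 * Th T q =
    phi ^+ 2 * (dev_cst 2 * (q / y ^+ 2) * Th T q) by ring.
  rewrite ler_wpM2l ?sqr_ge0//; apply: dev_le => // k.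
  have m00 := m0; have k0 : (0 : R) <= (sq k)%:R by [].
  by rewrite /dev; nra.
rewrite -isumZl -isumB /psi Re_isum; apply: le_isum => k _.
rewrite Re_realM/= -/(dev k).
have -> : q ^+ sq k - phi ^+ 2 * (dev k ^+ 2 / 2 * q ^+ sq k) =
  q ^+ sq k * (1 - (phi * dev k) ^+ 2 / 2) by ring.
by rewrite ler_wpM2l ?exprn_ge0// cos_ge.
Qed.

Lemma cn_psi phi : cn (psi phi) = cn (th T (q%:C * ce phi) 0).
Proof. by rewrite th_psi cnM cn_ce mul1r. Qed.

Lemma cn_psi_le phi : cn (psi phi) <= Th T q.
Proof.
by rewrite cn_psi; apply: (le_trans (cn_thle _ _ _)); rewrite cnM cn_ce mulr1 cn_real ger0_norm.
Qed.

(** The argument -1/2 puts the sign (-1)^k into the series. At phi = 0 it is then alternating, hence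
    at most 1 in modulus, whereas Th >= 1 + 2 q; a nonzero phi costs |phi| times the mean of k^2. *)
Lemma th_half phi : cn (th T (q%:C * ce phi) (- 2^-1)) <=
  Th T q * (1 - 2 / 3 * q + mom_cst R 1 * (q / y) * `|phi|).
Proof.
have phE k : ce (phase k (- 2^-1 : R)) = (- 1) ^+ absz k.
  have cepi : ce (- pi) = - 1 :> R[i].
    by apply/eqP; rewrite eq_complex/= cosN sinN cospi sinpi !oppr0 !eqxx.
  have -> : phase k (- 2^-1 : R) = - pi * k%:~R by rewrite /phase; field.
  have cen n : ce (- pi * n%:R) = (- 1) ^+ n :> R[i] by rewrite mulrC -ceX cepi.
  case: k => n; first exact: cen.
  rewrite NegzE mulrNz mulrN ceN abszN/=.
  by rewrite -[n.+1%:~R]/(n.+1%:R : R) cen -exprVn invrN1.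
rewrite mulrDr.
have -> : th T (q%:C * ce phi) (- 2^-1) =
  isum T (fun k : int => (q ^+ sq k)%:C * (- 1) ^+ absz k) +
  isum T (fun k : int => (q ^+ sq k)%:C * (- 1) ^+ absz k * (ce (phi * (sq k)%:R) - 1)).
  rewrite -isumD; apply: eq_isum => k _.
  by rewrite phE exprMn ceX rmorphXn/= (mulrC phi); ring.
apply: (le_trans (cnD _ _)); apply: lerD.
  have -> : isum T (fun k : int => (q ^+ sq k)%:C * (- 1) ^+ absz k) =
    (1 - 2 * \sum_(k < T) (- 1) ^+ k * q ^+ (k.+1 ^ 2))%:C.
    transitivity (isum T (fun k : int => (q ^+ sq k * (- 1) ^+ absz k)%:C)).
      apply: eq_isum => k _; rewrite [RHS]rmorphM/=; congr (_ * _).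
      rewrite -signr_odd -[in RHS]signr_odd; case: odd; rewrite ?expr0 ?expr1//.
      by apply/eqP; rewrite eq_complex/= oppr0 !eqxx.
    rewrite isum_real; congr _%:C.
    rewrite /isum/= expr0 mulr1 -mulNr mulr_sumr; congr (_ + _).
    by apply: eq_bigr => i _; rewrite /sq/= [(- 1) ^+ i.+1]exprS; ring.
  have sb : 0 <= \sum_(k < T) (- 1) ^+ k * q ^+ (k.+1 ^ 2) <= q.
    have := @alt_sum_itv (fun k => q ^+ (k.+1 ^ 2)) T.
    rewrite expr1; apply => k; rewrite exprn_ge0//=.
    by apply: ler_wiXn2l => //; [case/andP: q01; lra|rewrite leq_sqr].
  rewrite cn_real; apply: (@le_trans _ _ 1).
    by rewrite ler_norml; case/andP: q01; lra.
  have := Th_ge12 T0 q00; case/andP: q01 => _ q1; nra.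
apply: (le_trans (cn_isum _ _)).
apply: (@le_trans _ _ (`|phi| * mom T 1 q)).
  rewrite /mom -isumZl; apply: le_isum => k _.
  rewrite !cnM cnX cnN cn1 expr1n mulr1 cn_real ger0_norm ?exprn_ge0// expr1.
  have -> : `|phi| * ((sq k)%:R * q ^+ sq k) = q ^+ sq k * `|phi * (sq k)%:R|.
    by rewrite normrM (ger0_norm (x := _%:R))//; ring.
  by rewrite ler_wpM2l ?exprn_ge0// cn_ceB1.
have -> : Th T q * (mom_cst R 1 * (q / y) * `|phi|) =
  `|phi| * (mom_cst R 1 * (q / y) * Th T q) by ring.
by rewrite ler_wpM2l// hm ler_wpM2r ?mean_le// ltW.
Qed.

End LocalLimit.

(** * Saddle-point parameters and averages over the half circle *)

Lemma isum_const (A : comNzRingType) Q (c : A) : isum Q (fun=> c) = Q.*2.+1%:R * c.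
Proof. by rewrite isum_ord sumr_const card_ord mulr_natl. Qed.

Section Admissible.
Variable R : realType.
Implicit Types (q y phi t x m s a c : R) (T H n j d Q : nat).

(** [adm_mom] is the saddle-point equation. [adm_gap] and [adm_T4] express that T is large: the
    former feeds [gap_le], the latter [th_decay]. *)
Record admissible d n T q : Prop := Admissible {
  adm_d : (0 < d)%N;
  adm_n : (0 < n <= d ^ 4)%N;
  adm_T : (0 < T)%N;
  adm_q : 0 < q < 1;
  adm_mom : mom T 1 q = n%:R / d%:R * Th T q;
  adm_gap : n%:R / d%:R < gap_cst R * T%:R ^+ 2;
  adm_T4 : 4 <= T%:R ^+ 2 * (1 - q) }.

(** The 2 (2Q + 1) equally spaced points of the circle have this spacing, and the nodes |k| <= Q are
    those with angle in (-pi/2, pi/2). Averages below are normalised by 2 (2Q + 1), the size of the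
    full grid. *)
Definition mesh Q : R := pi / Q.*2.+1%:R.

Definition node Q (k : int) : R := k%:~R * mesh Q.

Lemma mesh_gt0 Q : 0 < mesh Q.
Proof. by rewrite divr_gt0 ?pi_gt0. Qed.

Lemma mesh_half Q : (2 * Q.*2.+1%:R)^-1 = mesh Q / (2 * pi).
Proof.
have N0 : 0 < Q.*2.+1%:R :> R by rewrite ltr0n.
rewrite /mesh; move: (pi_gt0 R) N0; generalize (@pi R) (Q.*2.+1%:R : R) => p N p0 N0.
by field; rewrite !gt_eqF.
Qed.

Lemma norm_node Q k : `|node Q k| = (absz k)%:R * mesh Q.
Proof. by rewrite /node normrM (ger0_norm (ltW (mesh_gt0 Q))) natr_absz intr_norm. Qed.

Lemma node_le Q k : (absz k <= Q)%N -> `|node Q k| <= pi / 2.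
Proof.
move=> kQ; rewrite norm_node /mesh mulrCA ler_pM2l ?pi_gt0//.
rewrite ler_pdivrMr// ler_pdivlMl// -!natrM ler_nat; move: kQ; clear; lia.
Qed.

(** The reciprocal of the order of the standard deviation of |x|^2: each k^2 has variance of order q
    / (1 - q)^2, and d q is of order D. *)
Definition width (D : nat) q : R := (1 - q) / Num.sqrt D%:R.

(** A Riemann sum in s = |phi| / w of step mesh / w <= 1, compared with [sum_inv_sq]; the change of
    variable produces the factor w. *)
Lemma avg_bound Q D q (f : R -> R) (M : R) : (0 < D)%N -> q < 1 -> 0 <= M ->
  mesh Q <= width D q ->
  (forall s, 0 <= s -> f s * (1 + s) ^+ 2 <= M) ->
  (2 * Q.*2.+1%:R)^-1 * isum Q (fun k => f (`|node Q k| / width D q)) <=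
  width D q * M.
Proof.
move=> D0 q1 M0 mw Hf.
have sD : 0 < Num.sqrt D%:R :> R by rewrite sqrtr_gt0 ltr0n.
have w0 : 0 < width D q by rewrite divr_gt0//; lra.
set del := mesh Q / width D q.
have d0 : 0 < del by rewrite divr_gt0// mesh_gt0.
have d1 : del <= 1 by rewrite ler_pdivrMr// mul1r.
have QE : (2 * Q.*2.+1%:R)^-1 = del * width D q / (2 * pi) :> R.
  by rewrite mesh_half /del divfK ?gt_eqF.
have p2 := @pi_ge2 R.
rewrite QE.
have -> : del * width D q / (2 * pi) * isum Q (fun k => f (`|node Q k| / width D q)) =
  width D q * ((2 * pi)^-1 * isum Q (fun k => del * f (`|node Q k| / width D q))).
  by rewrite isumZl; ring.
rewrite ler_pM2l//.
have : isum Q (fun k => del * f (`|node Q k| / width D q)) <= M * (del + 2).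
  apply: le_trans (ler_wpM2l M0 (sum_inv_sq Q d0)).
  rewrite -isumZl; apply: le_isum => k _.
  have -> : `|node Q k| / width D q = (absz k)%:R * del by rewrite norm_node /del mulrA.
  set s := _ * del; have s0 : 0 <= s by rewrite mulr_ge0// ltW.
  have := Hf s s0; rewrite -ler_pdivlMr ?exprn_gt0//; last by lra.
  by move=> h; rewrite [leRHS]mulrCA ler_pM2l.
rewrite ler_pdivrMl; last by lra.
move=> /le_trans; apply; rewrite mulrC ler_wpM2r//; lra.
Qed.

(** Roughly 2 a w / mesh nodes satisfy |phi| <= a w, and a w / mesh of them are counted; a w <= 1
    keeps these among |k| <= Q. *)
Lemma avg_count Q D q a : (0 < D)%N -> 0 < q < 1 -> 0 < a <= 1 ->
  width D q * (a / (2 * pi)) <=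
  (2 * Q.*2.+1%:R)^-1 * isum Q (fun k => (`|node Q k| / width D q <= a)%R%:R).
Proof.
move=> D0 /andP[q0 q1] /andP[a0 a1].
have sD : 0 < Num.sqrt D%:R :> R by rewrite sqrtr_gt0 ltr0n.
have sD1 : 1 <= Num.sqrt D%:R :> R by rewrite -[leLHS]sqrtr1 ler_wsqrtr// ler1n.
have w0 : 0 < width D q by rewrite divr_gt0//; lra.
have w1 : width D q <= 1 by rewrite ler_pdivrMr// mul1r; lra.
have p2 := @pi_ge2 R.
have Q0 : 0 < Q.*2.+1%:R :> R by rewrite ltr0n.
pose x := a * width D q / mesh Q.
have x0 : 0 <= x by apply/ltW/divr_gt0; [exact: mulr_gt0|exact: mesh_gt0].
have /andP[t1 t2] := truncn_itv x0.
have HQ : (Num.truncn x <= Q)%N.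
  rewrite -ltnS -(ltr_nat R); apply: (le_lt_trans t1).
  have ms := mesh_gt0 Q; rewrite /x ltr_pdivrMr//.
  have mE : Q.*2.+1%:R * mesh Q = pi by rewrite /mesh mulrC divfK// gt_eqF.
  have aw : a * width D q <= 1 by rewrite -[leRHS]mulr1 ler_pM// ltW.
  have QE : Q.*2.+1%:R = 2 * Q.+1%:R - 1 :> R.
    by rewrite -natr1 -(natr1 Q) -muln2 natrM; ring.
  rewrite QE in mE; lra.
have h : (Num.truncn x).+1%:R <= isum Q (fun k => (`|node Q k| / width D q <= a)%R%:R : R).
  apply: (le_trans (@isum_ind_ge R Q (Num.truncn x).+1 _)); first by rewrite ltnS.
  apply: le_isum => k _; rewrite ler_nat.
  case: ltnP => // kx; rewrite ltnS in kx.
  rewrite lt0b ler_pdivrMr// norm_node -ler_pdivlMr ?mesh_gt0//.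
  by apply: le_trans t1; rewrite ler_nat.
have -> : width D q * (a / (2 * pi)) = (2 * Q.*2.+1%:R)^-1 * x.
  have ms := mesh_gt0 Q; rewrite mesh_half /x.
  have -> : mesh Q / (2 * pi) * (a * width D q / mesh Q) =
    (mesh Q / mesh Q) * (width D q * (a / (2 * pi))) by ring.
  by rewrite divff ?mul1r// gt_eqF.
by rewrite ler_pM2l ?invr_gt0 ?mulr_gt0//; apply: le_trans h; exact: ltW.
Qed.

Variables (d n T : nat) (q : R).
Hypothesis adm : admissible d n T q.

Let D := minn n d.

Let D_gt0 : (0 < D)%N.
Proof. by rewrite leq_min (adm_d adm); case/andP: (adm_n adm) => ->. Qed.

Definition dim_cst : R := 2 + 2 * mom_cst R 1.

Lemma dim_cst_ge2 : 2 <= dim_cst.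
Proof. by have := mom_cst_ge0 R 1; rewrite /dim_cst; lra. Qed.

(** With [adm_dq_le], D and d q have the same order, so that a loss of order q per coordinate adds
    up to D. For q >= 1/2 the bound is D <= d; for q < 1/2, n = d m is at most a multiple of d q by
    [mean_le]. *)
Lemma adm_D_le : D%:R <= dim_cst * (d%:R * q).
Proof.
have /andP[q0 q1] := adm_q adm.
have d0 : (0 : R) < d%:R by rewrite ltr0n (adm_d adm).
have c0 := mom_cst_ge0 R 1.
have Dd : (D%:R : R) <= d%:R by rewrite ler_nat geq_minr.
have Dn : (D%:R : R) <= n%:R by rewrite ler_nat geq_minl.
have dq0 : 0 <= d%:R * q by rewrite mulr_ge0// ltW.
have cdq : 0 <= mom_cst R 1 * (d%:R * q) by rewrite mulr_ge0.
have [qh|qh] := leP 2^-1 q.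
  have : d%:R * 2^-1 <= d%:R * q by rewrite ler_pM2l.
  by rewrite /dim_cst; lra.
have := mean_le (adm_q adm) (adm_mom adm).
rewrite ler_pdivrMr// => h.
have y2 : (1 - q)^-1 <= 2 by rewrite -[leRHS]invrK lef_pV2 ?posrE ?invr_gt0//; lra.
have : mom_cst R 1 * (q / (1 - q)) * d%:R <= mom_cst R 1 * (q * 2) * d%:R.
  by rewrite ler_pM2r// ler_wpM2l// ler_pM2l.
rewrite /dim_cst; lra.
Qed.

Lemma adm_dq_le : d%:R * q <= 3 / 2 * D%:R.
Proof.
have /andP[q0 q1] := adm_q adm.
have d0 : (0 : R) < d%:R by rewrite ltr0n (adm_d adm).
have := mean_ge (adm_T adm) (adm_q adm) (adm_mom adm).
rewrite ler_pdivlMr// => h.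
by rewrite /D; case: (leqP n d) => _; nra.
Qed.

(** n <= d^4 enters here: it gives max (1, n / d) <= D^3. *)
Lemma adm_gap_le : (1 - q)^-1 <= 4 / gap_cst R * D%:R ^+ 3.
Proof.
have d0 : (0 : R) < d%:R by rewrite ltr0n (adm_d adm).
apply: (le_trans (gap_le (adm_T adm) (adm_q adm) (adm_mom adm) (adm_gap adm))).
rewrite ler_pM2l; last by rewrite divr_gt0 ?gap_cst_gt0.
rewrite ge_max -natrX ler1n expn_gt0 D_gt0/= ler_pdivrMr// -natrM ler_nat.
have /andP[_ nd] := adm_n adm.
rewrite /D; case: (leqP n d) => h; last by rewrite mulnC -expnS.
by have /andP[n0 _] := adm_n adm; apply: leq_trans h _; rewrite leq_pmull// expn_gt0 n0.
Qed.

Definition rate : R := decay_cst R / dim_cst.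

Lemma rate_gt0 : 0 < rate.
Proof. by rewrite divr_gt0 ?decay_cst_gt0//; have := dim_cst_ge2; lra. Qed.

Lemma pow_le_expRN (b x : R) : 0 <= b -> b <= 1 - x -> b ^+ d <= expR (- (d%:R * x)).
Proof.
move=> b0 bx; rewrite mulrC -mulNr expRM_natr; apply: lerXn2r; rewrite ?nnegrE ?expR_ge0//.
by apply: (le_trans bx); exact: expR_ge1Dx.
Qed.

(** The d-th power of [th_decay], with d q turned into D. The two exponentials correspond to the two
    values of the minimum there. *)
Lemma th_pow_le phi t : `|phi| <= pi / 2 ->
  (cn (th T (q%:C * ce phi) t) / Th T q) ^+ d <=
  expR (- (rate * (`|phi| / width D q) ^+ 2)) + expR (- (rate * D%:R)).
Proof.
move=> ph; have /andP[q0 q1] := adm_q adm.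
have Th0 : 0 < Th T q by apply: Th_gt0; exact: ltW.
have h := th_decay t (adm_q adm) (adm_T4 adm) ph.
set mn := Num.min _ _ in h.
rewrite -ler_pdivrMl// mulrC in h.
apply: le_trans (pow_le_expRN _ h) _; first by rewrite divr_ge0 ?cn_ge0// ltW.
have D0 : (0 : R) < D%:R by rewrite ltr0n.
have b2 := dim_cst_ge2.
have sD : Num.sqrt D%:R ^+ 2 = D%:R :> R by rewrite sqr_sqrtr// ltW.
have k : rate * (D%:R * mn ^+ 2) <= d%:R * (decay_cst R * q * mn ^+ 2).
  have -> : d%:R * (decay_cst R * q * mn ^+ 2) = decay_cst R * (d%:R * q * mn ^+ 2) by ring.
  rewrite /rate -mulrA ler_pM2l ?decay_cst_gt0// ler_pdivrMl; last by lra.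
  by rewrite [leRHS]mulrA ler_wpM2r ?sqr_ge0// adm_D_le.
apply: (@le_trans _ _ (expR (- (rate * (D%:R * mn ^+ 2))))); first by rewrite ler_expR lerN2.
rewrite /mn; case: (leP 1 (`|phi| / (1 - q))) => _.
  by rewrite expr1n mulr1 lerDr expR_ge0.
have -> : D%:R * (`|phi| / (1 - q)) ^+ 2 = (`|phi| / width D q) ^+ 2.
  have r0 : 0 < Num.sqrt D%:R :> R by rewrite sqrtr_gt0.
  rewrite /width -{1}sD; move: r0; set r := Num.sqrt _ => r0.
  by rewrite invf_div !exprMn; ring.
by rewrite lerDl expR_ge0.
Qed.

End Admissible.

(** * Lower bound for the average at xi = 0 *)

Section LocalLimitTheorem.
Variable R : realType.
Implicit Types (q y phi t x m s a c : R) (T H n j d Q : nat).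

Lemma cn_expB d (a b : R[i]) : cn a <= 1 -> cn b <= 1 ->
  cn (a ^+ d - b ^+ d) <= d%:R * cn (a - b).
Proof.
move=> a1 b1.
have := @cn_prodB R d (fun=> a) (fun=> b) (cn (a - b)) (fun=> a1) (fun=> b1) (fun=> lexx _).
by rewrite !prodr_const card_ord.
Qed.

Lemma bernoulli x d : 0 <= x <= 1 -> 1 - d%:R * (1 - x) <= x ^+ d.
Proof.
move=> /andP[x0 x1]; elim: d => [|d IH]; first by rewrite mul0r subr0 expr0.
rewrite exprS -natr1.
have h1 : x * x ^+ d >= x ^+ d - (1 - x).
  have : x ^+ d <= 1 by exact: exprn_ile1.
  nra.
lra.
Qed.

Lemma mesh_small w : 0 < w -> exists Q0, forall Q, (Q0 <= Q)%N -> mesh R Q <= w.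
Proof.
move=> w0; exists (Num.truncn (pi / w)).+1 => Q HQ.
have pw : 0 <= pi / w by rewrite divr_ge0 ?pi_ge0// ltW.
rewrite /mesh ler_pdivrMr// -ler_pdivrMl// mulrC.
have /andP[_ h] := truncn_itv pw.
apply: (le_trans (ltW h)); rewrite ler_nat; move: HQ; clear; lia.
Qed.

Definition nth_ratio T q phi t : R[i] := th T (q%:C * ce phi) t / (Th T q)%:C.

(** The integrand at xi = 0. The second term is the contribution of xi - h, all of whose coordinates
    are -1/2. *)
Definition kernel d n T q phi : R[i] :=
  ce (- (phi * n%:R)) * (nth_ratio T q phi 0 ^+ d + (- 1) ^+ n * nth_ratio T q phi (- 2^-1) ^+ d).

Lemma cn_nth_ratio T q phi t : 0 <= q ->
  cn (nth_ratio T q phi t) = cn (th T (q%:C * ce phi) t) / Th T q.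
Proof. by move=> q0; rewrite cnM cnV cn_real ger0_norm// ltW// Th_gt0. Qed.

Lemma cn_nth_ratio_le1 T q phi t : 0 <= q -> cn (nth_ratio T q phi t) <= 1.
Proof.
move=> q0; rewrite cn_nth_ratio// ler_pdivrMr ?Th_gt0// mul1r.
by apply: (le_trans (cn_thle _ _ _)); rewrite cnM cn_ce mulr1 cn_real ger0_norm.
Qed.

Section Term.
Variables (d n T : nat) (q : R).
Hypothesis adm : admissible d n T q.
Let D := minn n d.
Let m : R := n%:R / d%:R.
Let K2 : R := 3 / 2 * dev_cst R 2.
Let K3 : R := 3 / 2 * dev_cst R 3.

Let q01 := adm_q adm.
Let q0 : 0 < q. Proof. by case/andP: q01. Qed.
Let y0 : 0 < 1 - q. Proof. by case/andP: q01; lra. Qed.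
Let d0 : (0 : R) < d%:R. Proof. by rewrite ltr0n (adm_d adm). Qed.
Let Th0 : 0 < Th T q. Proof. exact/Th_gt0/ltW. Qed.
Let D0 : (0 : R) < D%:R.
Proof. by rewrite ltr0n leq_min (adm_d adm); case/andP: (adm_n adm) => ->. Qed.
Let r0 : 0 < Num.sqrt D%:R :> R. Proof. by rewrite sqrtr_gt0. Qed.
Let rE : Num.sqrt D%:R ^+ 2 = D%:R :> R. Proof. by rewrite sqr_sqrtr// ltW. Qed.

Definition psin phi : R[i] := psi T q m phi / (Th T q)%:C.

Let phiE phi : `|phi| = `|phi| / width D q * (1 - q) / Num.sqrt D%:R.
Proof.
by rewrite -[RHS]mulrA -/(width D q) divfK// gt_eqF// divr_gt0.
Qed.

Lemma first_termE phi :
  ce (- (phi * n%:R)) * nth_ratio T q phi 0 ^+ d = psin phi ^+ d.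
Proof.
rewrite /nth_ratio (th_psi T q m) /psin -mulrA exprMn mulrA ceX -ceD.
rewrite [X in ce X](_ : _ = 0) ?ce0 ?mul1r// /m; field; exact: lt0r_neq0.
Qed.

Lemma dev_cst_ge0 j : 0 <= dev_cst R j.
Proof. by rewrite addr_ge0 ?exprn_ge0 ?mom_cst_ge0. Qed.

Lemma cn_psin_le1 phi : cn (psin phi) <= 1.
Proof.
rewrite cnM cnV cn_real ger0_norm ?(ltW Th0)// ler_pdivrMr// mul1r.
by apply: cn_psi_le.
Qed.

Lemma Im_psin_le phi : d%:R * `|Im (psin phi)| <= K3 * (`|phi| / width D q) ^+ 3 / Num.sqrt D%:R.
Proof.
have -> : Im (psin phi) = Im (psi T q m phi) / Th T q.
  by rewrite /psin mulrC -fmorphV Im_realM mulrC.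
rewrite normrM normfV (ger0_norm (ltW Th0)).
have h := Im_psi_le (adm_T adm) q01 (adm_mom adm) phi.
rewrite -ler_pdivrMr// -/m in h.
apply: (le_trans (ler_wpM2l (ltW d0) h)).
rewrite {1}(phiE phi); set s := `|phi| / width D q.
have s0 : 0 <= s by rewrite divr_ge0// ltW// divr_gt0.
have dq := adm_dq_le adm; rewrite -/D -rE in dq.
have k0 := dev_cst_ge0 3.
have -> : d%:R * (dev_cst R 3 * (q / (1 - q) ^+ 3) * (s * (1 - q) / Num.sqrt D%:R) ^+ 3) =
   dev_cst R 3 * s ^+ 3 * ((d%:R * q) / Num.sqrt D%:R ^+ 3).
  by move: y0 r0; set y := 1 - q; set r := Num.sqrt _ => y0' r0'; field; rewrite !gt_eqF.
have -> : K3 * s ^+ 3 / Num.sqrt D%:R = dev_cst R 3 * s ^+ 3 * (3 / 2 * Num.sqrt D%:R ^+ 2 / Num.sqrt D%:R ^+ 3).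
  by rewrite /K3; move: r0; set r := Num.sqrt _ => r0'; field; rewrite !gt_eqF.
apply: ler_wpM2l; first by rewrite mulr_ge0// exprn_ge0.
by apply: ler_wpM2r => //; rewrite invr_ge0 exprn_ge0// ltW.
Qed.

Lemma Re_psin_ge phi : d%:R * (1 - Re (psin phi)) <= K2 * (`|phi| / width D q) ^+ 2.
Proof.
have -> : Re (psin phi) = Re (psi T q m phi) / Th T q.
  by rewrite /psin mulrC -fmorphV Re_realM mulrC.
have h := Re_psi_ge (adm_T adm) q01 (adm_mom adm) phi.
rewrite -ler_pdivlMr// -/m in h.
have -> : K2 * (`|phi| / width D q) ^+ 2 = dev_cst R 2 * ((3 / 2 * Num.sqrt D%:R ^+ 2) / (1 - q) ^+ 2) * phi ^+ 2.
  rewrite -[in RHS](real_normK (num_real phi)) /K2 /width.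
  by move: y0 r0; set y := 1 - q; set r := Num.sqrt _ => y0' r0'; field; rewrite !gt_eqF.
have dq := adm_dq_le adm; rewrite -/D -rE in dq.
apply: (@le_trans _ _ (d%:R * (dev_cst R 2 * (q / (1 - q) ^+ 2) * phi ^+ 2))).
  by rewrite ler_pM2l//; lra.
rewrite mulrA ler_wpM2r ?sqr_ge0// mulrCA ler_wpM2l ?dev_cst_ge0//.
by rewrite mulrA ler_wpM2r// invr_ge0 exprn_ge0// ltW.
Qed.

(** psin^d is compared with the d-th power of its real part at a cost d |Im psin|, cubic in s and
    divided by sqrt D; Bernoulli's inequality bounds the real power below. The hypothesis makes the
    real part of psin nonnegative. The second bound is for moderate s, where the first may be far
    below 0. *)
Lemma Re_first_ge phi : K2 * (`|phi| / width D q) ^+ 2 <= d%:R ->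
  1 - K2 * (`|phi| / width D q) ^+ 2 - K3 * (`|phi| / width D q) ^+ 3 / Num.sqrt D%:R
    <= Re (psin phi ^+ d) /\
  - (K3 * (`|phi| / width D q) ^+ 3 / Num.sqrt D%:R) <= Re (psin phi ^+ d).
Proof.
set s := `|phi| / width D q => Ks.
have h1 := Im_psin_le phi; have h2 := Re_psin_ge phi; rewrite -/s in h1 h2.
set P := psin phi in h1 h2 *.
have P1 : cn P <= 1 by exact: cn_psin_le1.
have RP1 : Re P <= 1.
  by apply: le_trans P1; apply: le_trans (Re_le_cn _); exact: ler_norm.
have RP0 : 0 <= Re P by have := d0; nra.
have RPc : cn (Re P)%:C <= 1 by rewrite cn_real ger0_norm.
have h3 := cn_expB d P1 RPc.
have Pd : cn (P - (Re P)%:C) = `|Im P|.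
  by case: (P) => u v /=; rewrite oppr0 addr0 subrr expr0n/= add0r sqrtr_sqr.
rewrite Pd in h3.
have h4 : `|Re (P ^+ d) - Re P ^+ d| <= K3 * s ^+ 3 / Num.sqrt D%:R.
  apply: le_trans h1; apply: le_trans h3; apply: le_trans (Re_le_cn _).
  by rewrite -rmorphXn/= raddfB.
have h5 := bernoulli d (introT andP (conj RP0 RP1)).
have h6 : 0 <= Re P ^+ d by exact: exprn_ge0.
move: h4; rewrite ler_norml => /andP[h4 _].
by split; lra.
Qed.

(** The hypothesis limits the last term of [th_half] to q / 3, so the ratio is at most 1 - q / 3;
    then d q >= D / dim_cst. *)
Lemma second_term_le phi : mom_cst R 1 * (`|phi| / width D q) / Num.sqrt D%:R <= 3^-1 ->
  cn (nth_ratio T q phi (- 2^-1)) ^+ d <= expR (- (D%:R / (3 * dim_cst R))).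
Proof.
set s := `|phi| / width D q => hs.
have h := th_half (adm_T adm) q01 (adm_mom adm) phi.
rewrite -ler_pdivrMl// mulrC -cn_nth_ratio ?(ltW q0)// in h.
have qs : mom_cst R 1 * (q / (1 - q)) * `|phi| <= q / 3.
  rewrite (phiE phi) -/s.
  have -> : mom_cst R 1 * (q / (1 - q)) * (s * (1 - q) / Num.sqrt D%:R) =
    q * (mom_cst R 1 * s / Num.sqrt D%:R) * ((1 - q) / (1 - q)) by ring.
  by rewrite divff ?gt_eqF// mulr1 ler_pM2l.
have h' : cn (nth_ratio T q phi (- 2^-1)) <= 1 - q / 3 by lra.
apply: (le_trans (pow_le_expRN d (cn_ge0 _) h')).
rewrite ler_expR lerN2.
have b2 := dim_cst_ge2 R.
rewrite ler_pdivrMr; last by lra.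
have := adm_D_le adm; rewrite -/D; lra.
Qed.

Lemma kernel_ge_norm phi : `|phi| <= pi / 2 ->
  - (2 * (expR (- (rate R * (`|phi| / width D q) ^+ 2)) + expR (- (rate R * D%:R)))) <=
  Re (kernel d n T q phi).
Proof.
move=> ph.
have h t : cn (nth_ratio T q phi t) ^+ d <=
    expR (- (rate R * (`|phi| / width D q) ^+ 2)) + expR (- (rate R * D%:R)).
  by rewrite cn_nth_ratio ?(ltW q0)//; exact: th_pow_le.
have : cn (kernel d n T q phi) <= cn (nth_ratio T q phi 0) ^+ d + cn (nth_ratio T q phi (- 2^-1)) ^+ d.
  rewrite /kernel cnM cn_ce mul1r; apply: (le_trans (cnD _ _)).
  by rewrite cnM !cnX cnN cn1 expr1n mul1r.
have := Re_le_cn (kernel d n T q phi); rewrite ler_norml => /andP[k1 _].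
have := h 0; have := h (- 2^-1); lra.
Qed.

Lemma kernel_ge_main phi :
  mom_cst R 1 * (`|phi| / width D q) / Num.sqrt D%:R <= 3^-1 ->
  Re (psin phi ^+ d) - expR (- (D%:R / (3 * dim_cst R))) <= Re (kernel d n T q phi).
Proof.
move=> h; have := second_term_le h.
rewrite /kernel [ce _ * _]mulrDr first_termE raddfD/= -cnX.
set z := nth_ratio T q phi _ ^+ d => hz.
rewrite lerD2l; have := Re_le_cn (ce (- (phi * n%:R)) * ((- 1) ^+ n * z)).
rewrite cnM cn_ce mul1r cnM cnX cnN cn1 expr1n mul1r ler_norml => /andP[h1 _].
by apply: le_trans h1; rewrite lerN2.
Qed.

End Term.

(** By [half_mean0] and [half_mean_sphsum] the average is q^n / Th^d times the number of points of
    the sphere, so that its positivity also yields a nonempty sphere. The bound is one-sided: the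
    real part of the kernel is at least about 1/2 for s <= a, and for larger s it only has to be not
    too negative. *)
Lemma local_limit : exists2 c : R, 0 < c & exists K0, forall d n T q,
  admissible d n T q -> (K0 <= minn n d)%N ->
  exists Q0, forall Q, (Q0 <= Q)%N ->
  c * width (minn n d) q <=
  Re ((2 * Q.*2.+1%:R)^-1%:C * isum Q (fun k => kernel d n T q (node R Q k))).
Proof.
pose K2 : R := 3 / 2 * dev_cst R 2; pose K3 : R := 3 / 2 * dev_cst R 3.
have K20 : 0 <= K2 by rewrite mulr_ge0 ?dev_cst_ge0.
have K30 : 0 <= K3 by rewrite mulr_ge0 ?dev_cst_ge0.
(* Chosen so that K2 a^2 <= 1/4. The cubic error takes at most another 1/4, and 1/2 remains for s <=
   a. *)
pose a : R := (1 + 4 * K2)^-1.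
have a0 : 0 < a by rewrite invr_gt0; lra.
have a1 : a <= 1 by rewrite invf_le1; lra.
have aK : K2 * a ^+ 2 <= 4^-1.
  have aE : a * (1 + 4 * K2) = 1 by rewrite mulVf// gt_eqF//; lra.
  nra.
pose c := rate R; have c0 : 0 < c := rate_gt0 R.
have [G G0 HG] := powgauss_le 3 c0.
have p2 := @pi_ge2 R.
have p4 : pi < 4 :> R by have := @pihalf_lt2 R; lra.
have h16 : 16^-1 <= (2 * pi)^-1 / 2 :> R by rewrite -invfM lef_pV2 ?posrE; lra.
(* On |s| <= A the cubic and odd-part errors, and on |s| > A the Gaussian tail, are all at most
   [eta / (1 + s)^2], whose average over the grid is small against that of [ind]. *)
pose eta : R := a / 64.
have eta0 : 0 < eta by rewrite divr_gt0.
pose A : R := Num.max 1 (2 * G / eta).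
have A1 : 1 <= A by rewrite le_max lexx.
have AG : 2 * G / eta <= A by rewrite le_max lexx orbT.
pose b := dim_cst R; have b2 : 2 <= b := dim_cst_ge2 R.
pose e1 := eta / (1 + A) ^+ 2 / 2.
have e10 : 0 < e1 by rewrite !divr_gt0// exprn_gt0//; lra.
have c10 := mom_cst_ge0 R 1.
have A0 : 0 <= A by lra.
have K3A : 0 <= K3 * A ^+ 3 / e1.
  by apply: divr_ge0; [rewrite mulr_ge0// exprn_ge0|exact: ltW].
have K2A : 0 <= K2 * A ^+ 2 by rewrite mulr_ge0 ?sqr_ge0.
have cA : 0 <= mom_cst R 1 * A by rewrite mulr_ge0.
pose B : R := 1 + K2 * A ^+ 2 + 3 * mom_cst R 1 * A + K3 * A ^+ 3 / e1 + 4 * K3.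
have HB r : B <= r -> [/\ K2 * A ^+ 2 <= r, 3 * (mom_cst R 1 * A) <= r,
    K3 * A ^+ 3 / e1 <= r & 4 * K3 <= r].
  move: K2A cA K3A K30; rewrite /B -[3 * mom_cst R 1 * A]mulrA.
  by clear=> *; split; lra.
have [L1 HL1] : exists K, forall D, (K <= D)%N -> B <= Num.sqrt D%:R :> R.
  have B0 : 0 <= B by rewrite /B; lra.
  exists (Num.truncn (B ^+ 2)).+1 => D HD.
  rewrite -(ger0_norm B0) -sqrtr_sqr ler_wsqrtr//.
  have /andP[_ h] := truncn_itv (sqr_ge0 B).
  by apply: (le_trans (ltW h)); rewrite ler_nat.
have cb : 0 < (3 * b)^-1 by rewrite invr_gt0; lra.
have [L2 HL2] := pow_expR_small 0 cb e10.
have cg0 := gap_cst_gt0 R.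
have e20 : 0 < a / 64 / (4 / gap_cst R) by rewrite !divr_gt0.
(* The power 4 compensates 1 / w, which is at most a multiple of D^4. *)
have [L3 HL3] := pow_expR_small 4 c0 e20.
exists (a / 64); first by rewrite divr_gt0.
exists (maxn 1 (maxn L1 (maxn L2 L3))) => d n T q adm.
set D := minn n d; rewrite !geq_max => /and4P[D1 DL1 DL2 DL3].
have /andP[q0 q1] := adm_q adm.
have DR : (1 : R) <= D%:R by rewrite ler1n.
have r1 : 1 <= Num.sqrt D%:R :> R by rewrite -[leLHS]sqrtr1 ler_wsqrtr.
have rD : Num.sqrt D%:R ^+ 2 = D%:R :> R by rewrite sqr_sqrtr//; lra.
have w0 : 0 < width D q by rewrite divr_gt0//; lra.
have [Q0 HQ0] := mesh_small w0.
exists Q0 => Q /HQ0 mw.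
have [Br1 Br2 Br3 Br4] := HB _ (HL1 D DL1).
have E2 : expR (- (D%:R / (3 * b))) <= e1.
  by have := HL2 D DL2; rewrite expr0 mul1r mulrC.
have E3 : expR (- (c * D%:R)) <= width D q * (a / 64).
  have := HL3 D DL3 => h.
  have gp := adm_gap_le adm; rewrite -/D in gp.
  have E0 := expR_ge0 (- (c * D%:R)).
  rewrite ler_pdivlMr in h; last by rewrite divr_gt0.
  apply: (@le_trans _ _ (width D q * (width D q)^-1 * expR (- (c * D%:R)))).
    by rewrite divff ?mul1r// gt_eqF.
  rewrite -mulrA ler_pM2l//; apply: le_trans h.
  rewrite [leRHS]mulrAC ler_wpM2r// invf_div mulrC.
  have -> : D%:R ^+ 4 * (4 / gap_cst R) = 4 / gap_cst R * D%:R ^+ 3 * D%:R :> R by ring.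
  apply: ler_pM; rewrite ?invr_ge0 ?sqrtr_ge0//; first by lra.
  by rewrite -[leRHS]rD expr2 ler_peMl ?sqrtr_ge0.
pose ind s : R := (s <= a)%R%:R.
have ind1 x : (x <= a)%R -> ind x = 1 by rewrite /ind => ->.
have ind0 x : (a < x)%R -> ind x = 0 by rewrite /ind ltNge => /negbTE ->.
have term k : (absz k <= Q)%N ->
  2^-1 * ind (`|node R Q k| / width D q) -
    eta / (1 + `|node R Q k| / width D q) ^+ 2 - 2 * expR (- (c * D%:R)) <=
  Re (kernel d n T q (node R Q k)).
  move=> kQ; set phi := node R Q k; set s := `|phi| / width D q.
  have s0 : 0 <= s by rewrite divr_ge0// ltW.
  have E0 := expR_ge0 (- (c * D%:R)).
  have es0 : 0 <= eta / (1 + s) ^+ 2 by rewrite divr_ge0 ?sqr_ge0// ltW.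
  have [sA|sA] := leP s A; last first.
    have sa : (a < s)%R by apply: le_lt_trans sA; exact: le_trans A1.
    have h := kernel_ge_norm adm (node_le R kQ); rewrite -/phi -/D -/s -/c in h.
    rewrite (ind0 _ sa) mulr0 sub0r; apply: le_trans h.
    have s10 : 0 < 1 + s by exact: ltr_pwDl.
    have : 2 * expR (- (c * s ^+ 2)) <= eta / (1 + s) ^+ 2; last by clear; lra.
    rewrite ler_pdivlMr ?exprn_gt0//.
    have hG := HG s s0.
    rewrite ler_pdivrMr// in AG.
    have E1 := expR_ge0 (- (c * s ^+ 2)).
    set X := expR _ in hG E1 *.
    have X2 : 0 <= (1 + s) ^+ 2 * X by rewrite mulr_ge0 ?sqr_ge0.
    have : A * ((1 + s) ^+ 2 * X) <= (1 + s) ^+ 3 * X.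
      by rewrite (exprS _ 2) -[leRHS]mulrA ler_wpM2r// (le_trans (ltW sA))// lerDr.
    move=> h1; have h2 : A * (2 * ((1 + s) ^+ 2 * X)) <= A * eta by move: AG hG h1; clear; lra.
    rewrite (ler_pM2l (lt_le_trans ltr01 A1)) in h2; apply: le_trans h2.
    by rewrite -mulrA [X * _]mulrC.
  have sA2 : s ^+ 2 <= A ^+ 2 by apply: lerXn2r; rewrite ?nnegrE.
  have sA3 : s ^+ 3 <= A ^+ 3 by apply: lerXn2r; rewrite ?nnegrE.
  have r0 : 0 < Num.sqrt D%:R :> R by exact: lt_le_trans r1.
  have Dd : (D%:R : R) <= d%:R by rewrite ler_nat geq_minr.
  have p1 : K2 * s ^+ 2 <= d%:R.
    apply: le_trans Dd; rewrite -rD; apply: (@le_trans _ _ (K2 * A ^+ 2)); first by rewrite ler_wpM2l.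
    apply: (le_trans Br1).
    by rewrite expr2 ler_peMl// ltW.
  have p3 : mom_cst R 1 * s / Num.sqrt D%:R <= 3^-1.
    rewrite ler_pdivrMr//.
    have : mom_cst R 1 * s <= mom_cst R 1 * A by rewrite ler_wpM2l.
    by move: Br2; clear; lra.
  have [f1 f2] := Re_first_ge adm p1; rewrite -/D -/s -/K2 -/K3 in f1 f2.
  have f3 := kernel_ge_main adm p3; rewrite -/D -/b in f3.
  have g3 : K3 * s ^+ 3 / Num.sqrt D%:R <= e1.
    rewrite ler_pdivrMr//; apply: (@le_trans _ _ (K3 * A ^+ 3)); first by rewrite ler_wpM2l.
    by rewrite [leRHS]mulrC -ler_pdivrMr.
  have ee : e1 + e1 <= eta / (1 + s) ^+ 2.
    have s10 : 0 < 1 + s by exact: ltr_pwDl.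
    have A10 : 0 < 1 + A by exact: ltr_pwDl.
    rewrite /e1 -splitr ler_pM2l// lef_pV2 ?posrE ?exprn_gt0//.
    by apply: lerXn2r; rewrite ?nnegrE ?(ltW s10) ?(ltW A10)// lerD2l.
  have [sa|sa] := lerP s a; rewrite ?(ind1 _ sa) ?(ind0 _ sa); last first.
    by move: f2 f3 g3 ee E0 E2; clear; lra.
  have K2s : K2 * s ^+ 2 <= 4^-1.
    by apply: le_trans aK; rewrite ler_wpM2l//; apply: lerXn2r; rewrite ?nnegrE ?(ltW a0).
  have g4 : K3 * s ^+ 3 / Num.sqrt D%:R <= 4^-1.
    rewrite ler_pdivrMr//; apply: (@le_trans _ _ (K3 * 1)); last by move: Br4; clear; lra.
    by rewrite ler_wpM2l// exprn_ile1// (le_trans sa).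
  by move: f1 f3 K2s g4 g3 ee E0 E2; clear; lra.
rewrite Re_realM Re_isum.
set N := (2 * Q.*2.+1%:R)^-1.
have N0 : 0 < N by rewrite invr_gt0 mulr_gt0.
apply: (@le_trans _ _ (N * isum Q (fun k => 2^-1 * ind (`|node R Q k| / width D q) -
    eta / (1 + `|node R Q k| / width D q) ^+ 2 - 2 * expR (- (c * D%:R))))); last first.
  by rewrite ler_pM2l//; exact: le_isum.
rewrite !isumB isumZl isum_const !mulrBr.
have c1 := @avg_count R Q D q a D1 (adm_q adm) (introT andP (conj a0 a1)); rewrite -/N in c1.
have c2 := @avg_bound R Q D q (fun s => eta / (1 + s) ^+ 2) eta D1 q1 (ltW eta0) mw; rewrite -/N in c2.
have c2' : N * isum Q (fun k => eta / (1 + `|node R Q k| / width D q) ^+ 2) <= width D q * eta.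
  by apply: c2 => s s0; rewrite divfK// gt_eqF// exprn_gt0//; lra.
have c3 : N * (Q.*2.+1%:R * (2 * expR (- (c * D%:R)))) = expR (- (c * D%:R)).
  by rewrite /N; have : (Q.*2.+1%:R : R) != 0 by []; move: (Q.*2.+1%:R : R) => z z0; field.
have c4 : width D q * (a / 16) <= width D q * (a / (2 * pi)) / 2.
  by rewrite -[leRHS]mulrA ler_pM2l// -[leRHS]mulrA ler_pM2l.
have c1' : width D q * (a / (2 * pi)) <=
    N * isum Q (fun k => ind (`|node R Q k| / width D q)) by [].
rewrite c3 [N * (2^-1 * _)]mulrCA.
have fin (w u v z E x : R) : 0 <= w * x -> w * z <= u -> v <= w * (x / 64) ->
  w * (x / 16) <= w * z / 2 -> E <= w * (x / 64) -> x / 64 * w <= 2^-1 * u - v - E.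
  by clear; lra.
exact: fin (ltW (mulr_gt0 w0 a0)) c1' c2' c4 E3.
Qed.

End LocalLimitTheorem.

(** * The sphere sum as a filtered product of theta series *)

Lemma isum_exch (V : zmodType) (I : finType) T (F : int -> I -> V) :
  isum T (fun k => \sum_i F k i) = \sum_i isum T (F^~ i).
Proof.
rewrite /isum [in RHS]big_split/=; congr (_ + _).
by rewrite exchange_big/=; apply: eq_bigr => k _; rewrite big_split.
Qed.

Section SphereFilter.
Variable R : realType.
Implicit Types (q phi t : R) (z : R[i]) (T n d Q : nat).

Lemma ce_pi_nat n : ce (pi * n%:R : R) = (- 1) ^+ n.
Proof.
rewrite mulrC -ceX; congr (_ ^+ _).
by apply/eqP; rewrite eq_complex/= cospi sinpi oppr0 !eqxx.
Qed.

(** A shift by one multiplies the geometric sum by [ce b], while its two boundary terms cancel by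
    periodicity. *)
Lemma isum_ce_geom Q (b : R) : ce b != 1 -> ce (Q.*2.+1%:R * b) = 1 ->
  isum Q (fun k : int => ce (k%:~R * b)) = 0.
Proof.
move=> b1 bQ; have := isum_shift1 Q (fun k : int => ce (k%:~R * b)).
rewrite (eq_isum (g := fun k : int => ce b * ce (k%:~R * b))); last first.
  by move=> k _; rewrite -ceD rmorphD/=; congr ce; ring.
rewrite isumZl; set S := isum _ _ => h.
have : (ce b - 1) * S = 0.
  have -> : (ce b - 1) * S = ce (Q.+1%:~R * b) - ce ((- Q%:Z)%:~R * b).
    by rewrite mulrBl mul1r h; ring.
  apply/eqP; rewrite subr_eq0; apply/eqP.
  rewrite -[RHS]mulr1 -bQ -ceD; congr ce.
  by rewrite -muln2 -natr1 natrM mulrNz -[Q.+1%:~R]/(Q.+1%:R : R) -(natr1 Q) -[Q%:~R]/(Q%:R : R); ring.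
by move=> /eqP; rewrite mulf_eq0 subr_eq0 (negbTE b1) => /eqP.
Qed.

(** For N - n even the half circle is a whole number of periods, so the geometric sum vanishes
    unless N = n; for N - n odd the sign factor is 0. The bounds on N and n exclude aliasing. *)
Lemma filter_orth Q (N n : nat) :
  (N < 2 * Q.*2.+1)%N -> (n < 2 * Q.*2.+1)%N ->
  isum Q (fun k => ce (node R Q k * (N%:R - n%:R)) * (1 + (- 1) ^+ n * (- 1) ^+ N)) =
  (if N == n then 2 * Q.*2.+1%:R else 0).
Proof.
move=> HN Hn; rewrite isumZr.
have Q0 : (0 : R) < Q.*2.+1%:R by rewrite ltr0n.
case: eqP => [->|/eqP Nn].
  rewrite (eq_isum (g := fun=> 1)); last by move=> k _; rewrite subrr mulr0 ce0.
  rewrite isum_const mulr1 -exprD addnn -signr_odd odd_double expr0 mulrC.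
  by congr (_ * _); rewrite -[RHS]natr1.
have [oN|oN] := boolP (odd N == odd n); last first.
  rewrite [X in _ * X](_ : _ = 0) ?mulr0// -[(- 1) ^+ n]signr_odd -[(- 1) ^+ N]signr_odd.
  by move: oN; do 2!case: odd => //=; rewrite ?expr0 ?expr1 ?mulr1 ?mul1r ?subrr.
rewrite [X in X * _](_ : _ = 0) ?mul0r//.
rewrite (eq_isum (g := fun k : int => ce (k%:~R * (mesh R Q * (N%:R - n%:R))))); last first.
  by move=> k _; rewrite /node -mulrA.
have meshE : Q.*2.+1%:R * mesh R Q = pi by rewrite /mesh mulrC divfK// gt_eqF.
wlog lt_nN : n N Hn HN oN Nn / (n < N)%N.
  move=> H; have [nN|Nn'] := ltnP n N; first exact: H.
  have lt : (N < n)%N by rewrite ltn_neqAle Nn.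
  rewrite -(H N n)//; [|by rewrite eq_sym|by rewrite eq_sym].
  rewrite -isumN; apply: eq_isum => k _; congr ce.
  by rewrite mulrNz; ring.
have ev : odd (N - n) = false by rewrite oddB ?(ltnW lt_nN)//; move/eqP: oN => ->; rewrite addbb.
have NnE : N%:R - n%:R = (N - n)%N%:R :> R by rewrite natrB// ltnW.
apply: isum_ce_geom; rewrite NnE.
  apply: ce_neq1; rewrite mulr_gt0 ?mesh_gt0 ?ltr0n ?subn_gt0//=.
  rewrite -meshE mulrC mulrA ltr_pM2r ?mesh_gt0// -natrM ltr_nat.
  by move: HN; clear; lia.
rewrite mulrA meshE -(odd_double_half (N - n)) ev add0n -muln2 natrM.
by rewrite mulrA mulrC mulrA ce_2pi_nat.
Qed.

Variable d : nat.
Implicit Types (xi : 'rV[R]_d) (x : 'rV[int]_d).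

Definition genf T z xi : R[i] := \prod_(j < d) th T z (xi 0 j).

Definition boxpt T (f : {ffun 'I_d -> 'I_T.*2.+1}) : 'rV[int]_d :=
  \row_j ((f j : nat)%:Z - T%:Z).

Definition nsq x : nat := (\sum_(j < d) sq (x 0%R j))%N.

Lemma nsqE x : normsq x = (nsq x)%:Z.
Proof.
rewrite /normsq /nsq (big_morph Posz PoszD (erefl _)); apply: eq_bigr => i _.
by rewrite /sq -abszX gez0_abs// sqr_ge0.
Qed.

Lemma expi2piE x xi : expi2pi x xi = \prod_(j < d) ce (phase (x 0 j) (xi 0 j)).
Proof.
rewrite -ce_sum /expi2pi /ce /dotp -mulr_sumr.
by [].
Qed.

Lemma genfE T z xi : genf T z xi =
  \sum_(f : {ffun 'I_d -> 'I_T.*2.+1}) z ^+ nsq (boxpt f) * expi2pi (boxpt f) xi.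
Proof.
rewrite /genf; under eq_bigr do rewrite /th isum_ord.
rewrite bigA_distr_bigA; apply: eq_bigr => f _.
rewrite expi2piE /nsq expr_sum -big_split; apply: eq_bigr => j _ /=.
by rewrite mxE.
Qed.

(** k and k^2 have the same parity, so the shift by h acts on the generating function like z -> -z,
    that is, like passing to the opposite half of the circle. *)
Lemma expi2pi_half x xi : expi2pi x (xi - halfv R d) = (- 1) ^+ nsq x * expi2pi x xi.
Proof.
rewrite !expi2piE /nsq expr_sum -big_split; apply: eq_bigr => j _ /=.
rewrite !mxE /phase mulrBr mulrBr ceD mulrC; congr (_ * _).
have -> : 2 * pi * ((x 0 j)%:~R * 2^-1) = pi * (x 0 j)%:~R :> R by field.
rewrite -signr_odd /sq oddX/= signr_odd.
case: (x 0 j) => k; first by rewrite ceN -[k%:~R]/(k%:R : R) ce_pi_nat -exprVn invrN1.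
by rewrite NegzE mulrNz mulrN opprK -[k.+1%:~R]/(k.+1%:R : R) ce_pi_nat abszN.
Qed.

Lemma genf_half T z xi : genf T z (xi - halfv R d) =
  \sum_(f : {ffun 'I_d -> 'I_T.*2.+1})
    (- 1) ^+ nsq (boxpt f) * (z ^+ nsq (boxpt f) * expi2pi (boxpt f) xi).
Proof. by rewrite genfE; apply: eq_bigr => f _; rewrite expi2pi_half mulrCA. Qed.

Lemma boxpt_inj T : injective (@boxpt T).
Proof.
move=> f g /rowP fg; apply/ffunP => j; apply: val_inj => /=.
by have := fg j; rewrite !mxE => /addIr [].
Qed.

Definition sphsum n xi : R[i] := \sum_(x \in @sphere d n) expi2pi x xi.

Lemma sphsumE T n xi : (n <= T)%N ->
  sphsum n xi = \sum_(f : {ffun 'I_d -> 'I_T.*2.+1} | nsq (boxpt f) == n) expi2pi (boxpt f) xi.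
Proof.
move=> nT; rewrite /sphsum fsbig_finite; last exact: finite_sphere.
rewrite -[RHS]big_filter -(big_map (@boxpt T) xpredT (fun x => expi2pi x xi)).
apply: perm_big; apply: uniq_perm.
- exact: fset_uniq.
- by rewrite map_inj_uniq ?filter_uniq ?index_enum_uniq//; exact: boxpt_inj.
move=> x; rewrite in_fset_set ?mem_setE; last exact: finite_sphere.
apply/idP/mapP => [|[f]]; last first.
  rewrite mem_filter mem_index_enum andbT => /eqP fn ->; apply/mem_set; rewrite /sphere/= nsqE fn//.
move=> /set_mem; rewrite /sphere/= nsqE => -[xn].
have xb j : (absz (x 0%R j) <= T)%N.
  apply: leq_trans nT; rewrite -xn /nsq (bigD1 j)//= /sq.
  by apply: leq_trans (leq_addr _ _); rewrite -mulnn; case: (absz _) => // k; rewrite leq_pmulr.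
exists [ffun j => inord (absz (x 0 j + T%:Z))].
  rewrite mem_filter mem_index_enum andbT; apply/eqP; rewrite -xn; congr nsq.
  apply/rowP => j; rewrite mxE ffunE; have := xb j.
  by move: (x 0 j) => z zT; rewrite inordK; move: zT; clear; lia.
apply/rowP => j; rewrite mxE ffunE; have := xb j.
by move: (x 0 j) => z zT; rewrite inordK; move: zT; clear; lia.
Qed.

Lemma expi2pi0 x : expi2pi x (0 : 'rV[R]_d) = 1.
Proof.
by rewrite expi2piE big1// => j _; rewrite mxE /phase !mulr0 ce0.
Qed.

Lemma sphere_meanE n xi : sphere_mean n xi = sphsum n xi / sphsum n 0.
Proof.
rewrite /sphere_mean mulrC; congr (_ / _).
rewrite /sphsum fsbig_finite; last exact: finite_sphere.
rewrite (eq_bigr (fun=> 1)) => [|x _]; last exact: expi2pi0.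
by rewrite big_const_seq count_predT iter_addr_0.
Qed.

(* On z = q e^(i phi) with phi in (-pi/2, pi/2), half of the circle, the terms |x|^2 = N with N - n
   even are separated; those with N - n odd cancel against the shift by h. *)
Lemma sphere_filter T Q n q xi : (n <= T)%N -> (n <= d * T ^ 2)%N ->
  (d * T ^ 2 < 2 * Q.*2.+1)%N ->
  (2 * Q.*2.+1%:R)^-1 * isum Q (fun k => ce (- (node R Q k * n%:R)) *
    (genf T (q%:C * ce (node R Q k)) xi +
     (- 1) ^+ n * genf T (q%:C * ce (node R Q k)) (xi - halfv R d))) =
  (q ^+ n)%:C * sphsum n xi.
Proof.
move=> nT ndT HQ.
have nle (f : {ffun 'I_d -> 'I_T.*2.+1}) : (nsq (boxpt f) <= d * T ^ 2)%N.
  rewrite -[d in (d * _)%N]card_ord -sum_nat_const; apply: leq_sum => j _.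
  rewrite mxE /sq leq_sqr; have := ltn_ord (f j); lia.
rewrite (eq_isum (g := fun k => \sum_(f : {ffun 'I_d -> 'I_T.*2.+1})
  ((q ^+ nsq (boxpt f))%:C * expi2pi (boxpt f) xi) *
  (ce (node R Q k * ((nsq (boxpt f))%:R - n%:R)) * (1 + (- 1) ^+ n * (- 1) ^+ nsq (boxpt f))))); last first.
  move=> k _; rewrite genf_half genfE !mulr_sumr -big_split/= mulr_sumr; apply: eq_bigr => f _.
  rewrite exprMn ceX mulrBr ceD rmorphXn/= (mulrC (node R Q k) (nsq _)%:R).
  move: (expi2pi _ _) (ce (_ * node R Q k)) (ce (- _)) ((- 1) ^+ n) ((- 1) ^+ nsq _) (_%:C ^+ _).
  by move=> E a b c e z; ring.
rewrite isum_exch.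
rewrite (eq_bigr (fun f => if nsq (boxpt f) == n then
    ((q ^+ n)%:C * expi2pi (boxpt f) xi) * (2 * Q.*2.+1%:R) else 0)); last first.
  move=> f _; rewrite isumZl filter_orth; first by case: eqP => [->|]; rewrite ?mulr0.
  - exact: leq_ltn_trans (nle f) HQ.
  - exact: leq_ltn_trans ndT HQ.
rewrite -big_mkcond/= -mulr_suml mulrC mulfK; last first.
  by rewrite mulf_neq0 ?pnatr_eq0.
by rewrite -mulr_sumr (sphsumE xi nT).
Qed.

End SphereFilter.

(** * Unordered sums as limits along an exhaustion *)

Section UnorderedSums.
Local Open Scope classical_set_scope.
Variables (K : numFieldType) (I : choiceType).

(** A finite set A containing B T differs from it by a subset of some B T' minus B T0, on which W
    sums to at most e / 2. Thus convergence along the sequence B controls the limit along all finite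
    sets. *)
Lemma sum_exhaust (f W : I -> K) (B : nat -> {fset I}) (v : K) :
  (forall T x, x \in B T -> x \in B T.+1) -> (forall x, exists T, x \in B T) ->
  (forall x, `|f x| <= W x) ->
  (forall e : K, 0 < e -> exists T0, forall T, (T0 <= T)%N ->
     \sum_(x <- B T) W x - \sum_(x <- B T0) W x <= e) ->
  (fun T => \sum_(x <- B T) f x : K^o) @ \oo --> (v : K^o) ->
  sum (f : I -> K^o) = v.
Proof.
move=> Bmon Bex fW Wc Bf.
have BS T T' : (T <= T')%N -> (B T `<=` B T')%fset.
  move=> /subnK <-; elim: (T' - T)%N => [|k IH]; first by rewrite add0n fsubset_refl.
  by apply: (fsubset_trans IH); apply/fsubsetP => x; rewrite addSn; exact: Bmon.
have Bcov (A : {fset I}) : exists T, (A `<=` B T)%fset.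
  elim/finSet_rect: A => A IH; have [->|[x xA]] := fset_0Vmem A.
    by exists 0%N; rewrite fsub0set.
  have [T AT] := IH (A `\ x)%fset (fproperD1 xA).
  have [T' xT'] := Bex x.
  exists (maxn T T'); apply/fsubsetP => z zA.
  have [->|zx] := eqVneq z x.
    by apply: (fsubsetP (BS T' _ (leq_maxr _ _))).
  apply: (fsubsetP (BS T _ (leq_maxl _ _))); apply: (fsubsetP AT).
  by rewrite !inE zx.
have W0 x : 0 <= W x by exact: le_trans (fW x).
have split (g : I -> K) (X Y : {fset I}) : (X `<=` Y)%fset ->
    \sum_(x <- Y) g x = \sum_(x <- X) g x + \sum_(x <- (Y `\` X)%fset) g x.
  move=> XY; rewrite (big_fsetID _ (fun x => x \in X) Y)/=.
  congr (_ + _); apply: eq_fbigl => x; rewrite !inE/=.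
    by apply/andP/idP => [[]//|xX]; rewrite (fsubsetP XY).
  by rewrite andbC.
have PF : ProperFilter (@totally I) by exact: totally_filter.
rewrite /sum; apply: norm_cvg_lim.
apply/(@cvgrPdist_le K K^o) => e e0.
have e2 : 0 < e / 2 by rewrite divr_gt0.
have [T0 HT0] := Wc _ e2.
move/cvgrPdist_le: Bf => /(_ _ e2) [T1 _ HT1].
pose T := maxn T0 T1.
exists (B T) => // A /= BA.
rewrite /partial_sum -(big_seq_fsetE _ _ xpredT).
rewrite -[v](subrK (\sum_(x <- B T) f x)) -addrA [leRHS]splitr.
apply: (le_trans (ler_normD _ _)); apply: lerD; first by apply: HT1; exact: leq_maxr.
rewrite (split _ _ _ BA) opprD addrA subrr add0r normrN.
have [T2 AT2] := Bcov A.
have T02 : (T0 <= maxn T0 T2)%N by exact: leq_maxl.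
have sub : (A `\` B T `<=` B (maxn T0 T2) `\` B T0)%fset.
  apply/fsubsetP => x; rewrite !inE => /andP[xT xA].
  rewrite (fsubsetP (BS _ _ (leq_maxr T0 T2)) _ (fsubsetP AT2 _ xA)) andbT.
  by apply: contra xT; apply: (fsubsetP (BS _ _ (leq_maxl T0 T1))).
apply: (@le_trans _ _ (\sum_(x <- (B (maxn T0 T2) `\` B T0)%fset) W x)).
  apply: (le_trans (ler_norm_sum _ _ _)); rewrite (split _ _ _ sub).
  apply: (@le_trans _ _ (\sum_(x <- (A `\` B T)%fset) W x)).
    by apply: ler_sum => x _; exact: fW.
  by rewrite lerDl sumr_ge0.
by have := HT0 _ T02; rewrite (split W _ _ (BS _ _ T02)) addrAC subrr add0r.
Qed.

End UnorderedSums.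

Lemma mem_fset_seq (I : choiceType) (s : seq I) x : (x \in [fset x in s]%fset) = (x \in s).
Proof. by rewrite inE. Qed.

Lemma sum_fset_seq (V : zmodType) (I : choiceType) (s : seq I) (F : I -> V) :
  uniq s -> \sum_(x <- [fset x in s]%fset) F x = \sum_(x <- s) F x.
Proof.
move=> us; apply: perm_big; apply: uniq_perm => // x.
exact: mem_fset_seq.
Qed.

(** * Exhaustion of Z and Z^d by boxes *)

Section Boxes.
Variable V : zmodType.

Definition ibox T : {fset int} :=
  [fset k in [seq k%:Z - T%:Z | k <- index_iota 0 T.*2.+1]]%fset.

Lemma sum_ibox T (F : int -> V) : \sum_(k <- ibox T) F k = isum T F.
Proof.
rewrite sum_fset_seq ?map_inj_uniq ?iota_uniq//; last by move=> a b /addIr [].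
by rewrite big_map big_mkord isum_ord.
Qed.

Lemma mem_ibox T (k : int) : (k \in ibox T) = (absz k <= T)%N.
Proof.
rewrite mem_fset_seq; apply/mapP/idP => [[j]|kT].
  by rewrite mem_index_iota => jT ->; lia.
exists (absz (k + T%:Z)); first by rewrite mem_index_iota; lia.
lia.
Qed.

Variable d : nat.

Definition vbox T : {fset 'rV[int]_d} :=
  [fset x in [seq boxpt f | f : {ffun 'I_d -> 'I_T.*2.+1}]]%fset.

Lemma sum_vbox T (F : 'rV[int]_d -> V) :
  \sum_(x <- vbox T) F x = \sum_(f : {ffun 'I_d -> 'I_T.*2.+1}) F (boxpt f).
Proof.
rewrite sum_fset_seq; first by rewrite big_image.
by rewrite map_inj_uniq ?enum_uniq//; exact: boxpt_inj.
Qed.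

Lemma mem_vbox T (x : 'rV[int]_d) : (x \in vbox T) = [forall j, (absz (x ord0 j) <= T)%N].
Proof.
rewrite mem_fset_seq; apply/codomP/forallP => [[f ->] j|xT].
  by rewrite mxE; move: (ltn_ord (f j)); move: (nat_of_ord (f j)) => z; clear; lia.
exists [ffun j => inord (absz (x ord0 j + T%:Z))].
apply/rowP => j; rewrite mxE ffunE; have := xT j.
by move: (x _ j) => z zT; rewrite inordK; move: zT; clear; lia.
Qed.

End Boxes.

(** * The Fourier transform of a Gaussian as a product over the coordinates *)

Section GaussianTransform.
Local Open Scope classical_set_scope.
Variable R : realType.
Implicit Types (r t e : R) (T d : nat).

Lemma real_complex_cvg (u : nat -> R) (l : R) :
  u @ \oo --> l -> (fun T => (u T)%:C : R[i]^o) @ \oo --> (l%:C : R[i]^o).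
Proof.
move/cvgrPdist_le => h; apply/cvgrPdist_le => e; rewrite ltcE/= => /andP[/eqP e0 e1].
apply: filterS (h _ e1) => T hT.
by rewrite normE -rmorphB cn_real lecE/= e0 eqxx.
Qed.

Section Rho.
Variable r : R.
Hypothesis r01 : 0 < r < 1.

Let r0 : 0 <= r. Proof. by case/andP: r01 => /ltW. Qed.

Lemma Th_nondecreasing : {homo (fun T => Th T r) : m n / (m <= n)%N >-> m <= n}.
Proof.
move=> m n /subnK <-; elim: (n - m)%N => // k IH; apply: (le_trans IH).
by rewrite addSn /Th isumS lerDl addr_ge0 ?exprn_ge0.
Qed.

Lemma Th_bounded : exists M, forall T, Th T r <= M.
Proof.
have /andP[r0' r1] := r01.
have y01 : 0 < 1 - r <= 1 by lra.
have [H [H0 _ H2]] := floor_invsqrt y01.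
by exists (9 * H%:R) => T; apply: Th_le9 => //; rewrite r0.
Qed.

Lemma Th_cvg : cvgn (fun T => Th T r).
Proof.
apply: nondecreasing_is_cvgn; first exact: Th_nondecreasing.
by have [M HM] := Th_bounded; exists M => _ [T _ <-].
Qed.

Lemma cvg_cauchy (u : nat -> R) : {homo u : m n / (m <= n)%N >-> m <= n} -> cvgn u ->
  forall e, 0 < e -> exists T0, forall T, (T0 <= T)%N -> u T - u T0 <= e.
Proof.
move=> um uc e e0; have /cvgrPdist_le /(_ _ e0) [T0 _ HT0] := uc.
exists T0 => T TT0; have := HT0 T0 (leqnn _); rewrite /= ler_norml => /andP[_ h].
by have := nondecreasing_cvgn_le um uc T; lra.
Qed.

Lemma exprz_sq (k : int) : r ^ (k ^+ 2) = r ^+ sq k.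
Proof.
have -> : k ^+ 2 = (sq k)%:Z; last by [].
by rewrite /sq -abszX gez0_abs// sqr_ge0.
Qed.

Lemma ThetaE : Theta r = limn (fun T => Th T r).
Proof.
rewrite /Theta; apply: (@sum_exhaust _ _ _ (fun k => r ^+ sq k) ibox).
- by move=> T x; rewrite !mem_ibox; lia.
- by move=> x; exists (absz x); rewrite mem_ibox.
- by move=> x; rewrite exprz_sq ger0_norm// exprn_ge0.
- move=> e e0; have [T0 HT0] := cvg_cauchy Th_nondecreasing Th_cvg e0.
  by exists T0 => T /HT0; rewrite !sum_ibox.
- have -> : (fun T => \sum_(x <- ibox T) r ^ (x ^+ 2)) = (fun T => Th T r).
    by apply/funext => T; rewrite sum_ibox; apply: eq_isum => k _; exact: exprz_sq.
  exact: Th_cvg.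
Qed.

Lemma Theta_ge1 : 1 <= Theta r.
Proof.
rewrite ThetaE; apply: (le_trans (Th_ge1 0 r0)).
exact: nondecreasing_cvgn_le Th_nondecreasing Th_cvg 0%N.
Qed.

Definition cth T t : R := isum T (fun k => r ^+ sq k * cos (phase k t)).

Lemma th_cth T t : th T r%:C t = (cth T t)%:C.
Proof.
apply/eqP; rewrite eq_complex/= /th Re_isum Im_isum; apply/andP; split; apply/eqP.
  by apply: eq_isum => k _; rewrite -rmorphXn Re_realM.
(* The imaginary part is a symmetric sum of sines, odd in k. *)
set S := isum _ _; suff : S = - S by move/eqP; rewrite -subr_eq0 opprK -mulr2n mulrn_eq0 => /eqP.
rewrite {1}/S -isumN -[RHS]sub0r.
have z : isum T (fun _ : int => 0 : R) = 0 by rewrite isum_const mulr0.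
rewrite -[in RHS]z -isumB; apply: eq_isum => k _.
rewrite -!rmorphXn !Im_realM /sq abszN sub0r -mulrN; congr (_ * _) => /=.
by rewrite -sinN /phase mulrNz; congr sin; ring.
Qed.

(** Adding [Th] makes every term nonnegative, so that monotone convergence applies. *)
Lemma cth_cvg t : cvgn (fun T => cth T t).
Proof.
have -> : (fun T => cth T t) = (fun T => (cth T t + Th T r) - Th T r).
  by apply/funext => T; rewrite addrK.
apply: is_cvgB; last exact: Th_cvg.
have ge0 k : 0 <= r ^+ sq k * cos (phase k t) + r ^+ sq k.
  by rewrite -{2}[r ^+ _]mulr1 -mulrDr mulr_ge0 ?exprn_ge0//; have := cos_geN1 (phase k t); lra.
apply: nondecreasing_is_cvgn.
  move=> m n /subnK <-; elim: (n - m)%N => // k IH; apply: (le_trans IH).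
  by rewrite addSn /Th /cth -!isumD isumS lerDl addr_ge0.
have [M HM] := Th_bounded; exists (2 * M) => _ [T _ <-].
rewrite mulr_natl mulr2n lerD// (le_trans _ (HM T))//; apply: le_isum => k _.
by rewrite ler_piMr ?exprn_ge0// cos_le1.
Qed.

(** The Fourier transform of the one-dimensional Gaussian. *)
Definition rho t : R := limn (fun T => cth T t / Th T r).

Lemma rho_cvg t : (fun T => cth T t / Th T r) @ \oo --> rho t.
Proof.
apply: (is_cvgM (cth_cvg (t := t))); apply: is_cvgV; last exact: Th_cvg.
by rewrite -ThetaE gt_eqF// (lt_le_trans ltr01 Theta_ge1).
Qed.

(** By [genfE] a sum over a box factors into one-dimensional sums. This serves twice: for the
    transform, and at xi = 0 for the majorant required by [sum_exhaust]. *)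
Lemma fourier_gaussE d (xi : 'rV[R]_d) :
  fourier_gauss r xi = (\prod_(j < d) rho (xi 0 j))%:C.
Proof.
have T0 : 0 < Theta r by exact: lt_le_trans ltr01 Theta_ge1.
have gE (x : 'rV[int]_d) : gauss r x = Theta r ^- d * r ^+ nsq x.
  by rewrite /gauss nsqE.
have g0 (x : 'rV[int]_d) : 0 <= gauss r x.
  by rewrite gE mulr_ge0 ?exprn_ge0// invr_ge0 exprn_ge0// ltW.
have sumW T : \sum_(x <- vbox d T) (gauss r x)%:C = (Theta r ^- d * Th T r ^+ d)%:C.
  rewrite sum_vbox -rmorph_sum/= (eq_bigr (fun f => Theta r ^- d * r ^+ nsq (boxpt f))) => [|f _].
    rewrite -mulr_sumr; congr (_ * _)%:C.
    have := genfE T r%:C (0 : 'rV[R]_d).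
    rewrite /genf (eq_bigr (fun=> (Th T r)%:C)); last by move=> j _; rewrite mxE th0.
    rewrite prodr_const card_ord (eq_bigr (fun f => (r ^+ nsq (boxpt f))%:C)); last first.
      by move=> f _; rewrite expi2pi0 mulr1 rmorphXn.
    by rewrite -rmorphXn -rmorph_sum/= => /complexI <-.
  exact: gE.
have cvX n : (fun T => Th T r ^+ n) @ \oo --> Theta r ^+ n.
  elim: n => [|n IH]; first by under eq_fun do rewrite expr0; rewrite expr0; exact: cvg_cst.
  under eq_fun do rewrite exprS; rewrite exprS; apply: cvgM => //.
  by rewrite ThetaE; exact: Th_cvg.
rewrite /fourier_gauss /fourier.
apply: (@sum_exhaust _ _ _ (fun x => (gauss r x)%:C) (vbox d)).
- move=> T x; rewrite !mem_vbox => /forallP h; apply/forallP => j.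
  by have := h j; lia.
- move=> x; exists (\max_j absz (x ord0 j))%N; rewrite mem_vbox; apply/forallP => j.
  exact: leq_bigmax.
- move=> x; rewrite normE cnM cn_real ger0_norm// expi2piE cn_prod.
  by rewrite big1 ?mulr1// => j _; rewrite cn_ce.
- move=> e; rewrite ltcE/= => /andP[/eqP e0 e1].
  have um : {homo (fun T => Theta r ^- d * Th T r ^+ d) : m n / (m <= n)%N >-> m <= n}.
    move=> m n mn; rewrite ler_wpM2l ?invr_ge0 ?exprn_ge0 ?(ltW T0)//.
    by apply: lerXn2r; rewrite ?nnegrE ?(ltW (Th_gt0 _ r0))//; exact: Th_nondecreasing.
  have uc : cvgn (fun T => Theta r ^- d * Th T r ^+ d).
    apply: is_cvgM; first exact: is_cvg_cst.
    by apply/cvg_ex; exists (Theta r ^+ d); exact: cvX.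
  have [N HN] := cvg_cauchy um uc e1; exists N => T /HN h.
  by rewrite !sumW -rmorphB lecE/= e0 eqxx.
have -> : (fun T => \sum_(x <- vbox d T) (gauss r x)%:C * expi2pi x xi) =
    (fun T => (Theta r ^- d * Th T r ^+ d * \prod_(j < d) (cth T (xi 0 j) / Th T r))%:C).
  apply/funext => T; rewrite sum_vbox.
  rewrite big_split/= prodr_const card_ord exprVn -mulrA [Th _ _ ^+ d * _]mulrC divfK; last first.
    by rewrite expf_neq0// gt_eqF// Th_gt0.
  rewrite rmorphM/= rmorph_prod/=.
  rewrite -(eq_bigr _ (fun j _ => th_cth T (xi 0 j))) -/(genf T r%:C xi) genfE mulr_sumr.
  by apply: eq_bigr => f _; rewrite gE rmorphM/= rmorphXn/= mulrA.
apply: real_complex_cvg; rewrite -[X in _ --> X]mul1r; apply: cvgM.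
  have -> : 1 = Theta r ^- d * Theta r ^+ d :> R by rewrite mulVf// expf_neq0// gt_eqF.
  apply: cvgM; first exact: cvg_cst.
  exact: cvX.
by apply: cvg_big => [|j _]; [exact: mul_continuous|exact: rho_cvg].
Qed.

End Rho.
End GaussianTransform.

(** * A finite form of the Jacobi triple product *)

Section FiniteJacobi.
Variable R : realType.
Implicit Types (w z : R[i]) (t : R) (M k : nat) (j : int).

(* [jc M w k] is the Gaussian binomial (2M choose M+k)_w divided by (2M choose M)_w, and
   [jacobi_step] is the induction step of the finite Jacobi triple product. *)
Definition jc M w k : R[i] := \prod_(i < k) ((1 - w ^+ (M - i)) / (1 - w ^+ (M.+1 + i))).

(** The Gaussian binomial (2M choose M)_w, as the product of its successive quotients [jratio]. *)
Definition jnorm M w : R[i] :=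
  \prod_(i < M) ((1 - w ^+ (2 * i).+1) * (1 - w ^+ (2 * i).+2) / (1 - w ^+ i.+1) ^+ 2).

(** Dividing by the central binomial makes the coefficients tend to 1, so that the sum approaches
    the theta series as M grows. *)
Definition jacobi M z t : R[i] :=
  isum M (fun j => jc M (z ^+ 2) (absz j) * z ^+ sq j * ce (phase j t)).

(** Each factor is (1 + x e^(2 pi i t)) (1 + x e^(-2 pi i t)) with x = z^(2m+1), multiplied out. *)
Definition jprod M z t : R[i] :=
  \prod_(m < M) (1 + z ^+ (2 * m).+1 * (ce (2 * pi * t) + ce (- (2 * pi * t))) + z ^+ (2 * m).+1 ^+ 2).

Lemma jcS M w k : jc M w k.+1 = jc M w k * ((1 - w ^+ (M - k)) / (1 - w ^+ (M.+1 + k))).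
Proof. by rewrite /jc big_ord_recr. Qed.

Lemma jc0 M w : jc M w 0 = 1.
Proof. by rewrite /jc big_ord0. Qed.

Lemma jc_gt M w k : (M < k)%N -> jc M w k = 0.
Proof.
move=> Mk; rewrite /jc (bigD1 (Ordinal Mk))//= subnn expr0 subrr mul0r mul0r//.
Qed.

Lemma sub1X_neq0 w n : cn w < 1 -> 1 - w ^+ n.+1 != 0.
Proof.
move=> w1; rewrite subr_eq0; apply/eqP => h.
have := cnX w n.+1; rewrite -h cn1 => h1.
have : cn w ^+ n.+1 < 1 by rewrite exprn_ilt1 ?cn_ge0.
by rewrite -h1 ltxx.
Qed.

(** The field identity of [jc_step], with p = w^(M-k-1), b = w^(M+1+k) and c = 1 - w^(M+1); J, D1,
    D2 are the coefficients of index k, k+1, k+2 in row M, and J' is that of index k+1 in row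
    M+1. *)
Lemma jacobi_alg (p b w c D1 J D2 J' : R[i]) :
  1 - p * w != 0 -> 1 - b != 0 -> 1 - b * w != 0 -> c != 0 ->
  D1 = J * ((1 - p * w) / (1 - b)) -> D2 = D1 * ((1 - p) / (1 - b * w)) ->
  J' * ((1 - p * w) * (1 - b * w)) = D1 * c ^+ 2 ->
  (1 + p * b * w) * D1 + p * w * J + b * w * D2 =
  (1 - p * b * w) * (1 - p * b * w ^+ 2) / c ^+ 2 * J'.
Proof.
move=> n1 n2 n3 n4 e1 e2 e3.
have -> : J' = D1 * c ^+ 2 / ((1 - p * w) * (1 - b * w)).
  by rewrite -e3 mulfK// mulf_neq0.
by rewrite e2 e1; field; rewrite n4 n1 n2 n3.
Qed.

Section Step.
Variables (w : R[i]) (M : nat).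
Hypothesis w1 : cn w < 1.

Let nz n : 1 - w ^+ n.+1 != 0. Proof. exact: sub1X_neq0. Qed.

Lemma jc_ratio k : (k <= M)%N ->
  jc M.+1 w k * ((1 - w ^+ (M.+1 - k)) * (1 - w ^+ (M.+1 + k))) =
  jc M w k * (1 - w ^+ M.+1) ^+ 2.
Proof.
elim: k => [|k IH] kM; first by rewrite !jc0 subn0 addn0 expr2.
have := IH (ltnW kM); rewrite !jcS => IHk.
have -> : (M.+1 - k.+1 = M - k)%N by lia.
have n1 := nz (M + k); have n2 := nz (M.+1 + k).
rewrite !addSn addnS in n1 n2 IHk *.
set J' := jc M.+1 w k in IHk *; set J := jc M w k in IHk *.
have -> : J' * ((1 - w ^+ (M.+1 - k)) / (1 - w ^+ (M + k).+2)) *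
    ((1 - w ^+ (M - k)) * (1 - w ^+ (M + k).+2)) =
    J' * ((1 - w ^+ (M.+1 - k)) * (1 - w ^+ (M + k).+1)) * (1 - w ^+ (M - k)) / (1 - w ^+ (M + k).+1).
  by field; rewrite n1 n2.
by rewrite IHk; field.
Qed.

Definition jratio : R[i] :=
  (1 - w ^+ (2 * M).+1) * (1 - w ^+ (2 * M).+2) / (1 - w ^+ M.+1) ^+ 2.

Lemma jc_step0 : 1 + w ^+ (2 * M).+1 + w ^+ M.+1 * jc M w 1 + w ^+ M.+1 * jc M w 1 = jratio.
Proof.
rewrite jcS jc0 mul1r subn0 addn0 /jratio.
have := nz M; rewrite !exprS mul2n -addnn exprD; set u := w ^+ M => n1.
by field.
Qed.

(** Compares the coefficients of index k + 1 on both sides of [jacobi_step]. The case k = M is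
    apart: row M has run out, and [jc_ratio] does not reach index M + 1. *)
Lemma jc_step k : (k <= M)%N ->
  (1 + w ^+ (2 * M).+1) * jc M w k.+1 + w ^+ (M - k) * jc M w k +
    w ^+ (M.+2 + k) * jc M w k.+2 = jratio * jc M.+1 w k.+1.
Proof.
rewrite leq_eqVlt => /predU1P[->|kM].
  rewrite (jc_gt _ (ltnSn M)) (jc_gt _ (ltnW (ltnSn M.+1))) !mulr0 add0r addr0 subnn expr0 mul1r.
  have := jc_ratio (leqnn M); rewrite jcS subSnn expr1 addSn addnn -mul2n.
  have n0 := nz 0; rewrite expr1 in n0.
  have n1 := nz M; have n2 := nz (2 * M); have n3 := nz (2 * M).+1.
  rewrite /jratio; have -> : (M.+2 + M = (2 * M).+2)%N by lia.
  set J' := jc M.+1 w M; set J := jc M w M => h.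
  have -> : J = J' * ((1 - w) * (1 - w ^+ (2 * M).+1)) / (1 - w ^+ M.+1) ^+ 2.
    by rewrite h mulfK// expf_neq0.
  by field; rewrite n1 n3.
have e : (M - k = (M - k.+1).+1)%N by lia.
pose p := w ^+ (M - k.+1); pose b := w ^+ (M.+1 + k).
have pw : w ^+ (M - k) = p * w by rewrite e exprSr.
have bw : w ^+ (M.+2 + k) = b * w by rewrite addSn exprSr.
have pb : w ^+ (2 * M).+1 = p * b * w.
  by rewrite -exprD -exprSr; congr (_ ^+ _); lia.
have pb2 : w ^+ (2 * M).+2 = p * b * w ^+ 2 by rewrite exprSr pb expr2 mulrA.
rewrite /jratio pb2 pb pw bw; apply: (jacobi_alg (c := 1 - w ^+ M.+1)).
- by rewrite -pw e; exact: nz.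
- exact: nz.
- by rewrite -bw; exact: nz.
- exact: nz.
- by rewrite jcS pw.
- by rewrite [LHS]jcS [(M.+1 + k.+1)%N]addnS -addSn bw.
by have := jc_ratio kM; rewrite subSS pw [(M.+1 + k.+1)%N]addnS -addSn bw.
Qed.

End Step.
Lemma jratio_nz w M : cn w < 1 -> jratio w M != 0.
Proof. by move=> w1; rewrite !mulf_neq0 ?invr_eq0 ?expf_neq0 ?sub1X_neq0. Qed.

Lemma jnormS M w : jnorm M.+1 w = jnorm M w * jratio w M.
Proof. by rewrite /jnorm big_ord_recr. Qed.

Lemma jnorm_nz M w : cn w < 1 -> jnorm M w != 0.
Proof.
move=> w1; elim: M => [|M IH]; first by rewrite /jnorm big_ord0 oner_neq0.
by rewrite jnormS mulf_neq0 ?jratio_nz.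
Qed.

Lemma cn_sqr_lt1 z : cn z < 1 -> cn (z ^+ 2) < 1.
Proof. by move=> z1; rewrite cnX exprn_ilt1 ?cn_ge0. Qed.

Lemma jacobi_step M z t : cn z < 1 ->
  jacobi M z t * (1 + z ^+ (2 * M).+1 * (ce (2 * pi * t) + ce (- (2 * pi * t))) +
                  z ^+ (2 * M).+1 ^+ 2) =
  jratio (z ^+ 2) M * jacobi M.+1 z t.
Proof.
move=> z1; set w := z ^+ 2; set x := z ^+ (2 * M).+1; set E := ce _; set E' := ce (- _).
have w1 : cn w < 1 by exact: cn_sqr_lt1.
pose a j := jc M w (absz j) * z ^+ sq j.
pose e j := ce (phase j t).
have a0 j : (M < absz j)%N -> a j = 0 by move=> h; rewrite /a jc_gt// mul0r.
have eS j : e (j + 1) = e j * E.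
  by rewrite /e /E -ceD /phase rmorphD/=; congr ce; ring.
have eP j : e (j - 1) = e j * E'.
  by rewrite /e /E' -ceD /phase rmorphB/=; congr ce; ring.
have J1 : jacobi M z t = isum M.+1 (fun j => a j * e j).
  by rewrite isumS !a0 ?abszN ?mul0r ?addr0//=.
have JE : jacobi M z t * E = isum M.+1 (fun j => a (j - 1) * e j).
  rewrite J1 -isumZr.
  rewrite -(@isum_shiftN _ M.+1 M 1 (fun j => a j * e j * E)) ?addn1//.
    by apply: eq_isum => j _; rewrite -mulrA -eS subrK.
  by move=> j /a0 ->; rewrite !mul0r.
have JE' : jacobi M z t * E' = isum M.+1 (fun j => a (j + 1) * e j).
  rewrite J1 -isumZr.
  rewrite -(@isum_shift _ M.+1 M 1 (fun j => a j * e j * E')) ?addn1//.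
    by apply: eq_isum => j _; rewrite -mulrA -eP addrK.
  by move=> j /a0 ->; rewrite !mul0r.
have -> : jacobi M z t * (1 + x * (E + E') + x ^+ 2) =
  jacobi M z t * (1 + x ^+ 2) + (jacobi M z t * E) * x + (jacobi M z t * E') * x by ring.
rewrite JE JE' J1 -!isumZr -isumZl -!isumD; apply: eq_isum => j jM.
have x2 : x ^+ 2 = w ^+ (2 * M).+1 by rewrite /x /w -!exprM mulnC.
have aN i : a (- i) = a i by rewrite /a /sq abszN.
suff : a j * (1 + x ^+ 2) + a (j - 1) * x + a (j + 1) * x =
    jratio w M * (jc M.+1 w (absz j) * z ^+ sq j).
  by rewrite -/(e j) => h; rewrite [RHS]mulrA -h; ring.
wlog [k jk] : j jM / exists k : nat, j = k%:Z.
  move=> H; case: j jM => k jM; first by apply: H => //; exists k.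
  have := H k.+1%:Z jM (ex_intro _ _ erefl).
  rewrite NegzE aN /sq abszN => <-.
  have -> : - k.+1%:Z - 1 = - (k.+1%:Z + 1) :> int by lia.
  have -> : - k.+1%:Z + 1 = - (k.+1%:Z - 1) :> int by lia.
  by rewrite !aN; ring.
rewrite {j}jk in jM *; case: k jM => [|k] jM.
  rewrite sub0r aN add0r /a /sq/= !jc0 expr0 expr1 !mul1r !mulr1 -jc_step0// x2.
  have -> : jc M w 1 * z * x = w ^+ M.+1 * jc M w 1.
    have -> : w ^+ M.+1 = z * x by rewrite /w /x -exprM -exprS; congr (_ ^+ _); lia.
    by ring.
  by [].
have -> : k.+1%:Z - 1 = k%:Z :> int by lia.
have -> : k.+1%:Z + 1 = k.+2%:Z :> int by lia.
rewrite /a /sq/= mulrA -jc_step// x2.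
have e1 : z ^+ (k ^ 2) * x = z ^+ (k.+1 ^ 2) * w ^+ (M - k).
  rewrite /w /x -exprM -!exprD; congr (_ ^+ _).
  by move: jM; rewrite /= ltnS => jM; rewrite -!mulnn; nia.
have e2 : z ^+ (k.+2 ^ 2) * x = z ^+ (k.+1 ^ 2) * w ^+ (M.+2 + k).
  by rewrite /w /x -exprM -!exprD; congr (_ ^+ _); rewrite -!mulnn; nia.
rewrite -[jc M w k * _ * x]mulrA e1 -[jc M w k.+2 * _ * x]mulrA [X in _ + _ * X]e2; ring.
Qed.

Lemma jacobi_jprod M z t : cn z < 1 -> jnorm M (z ^+ 2) * jacobi M z t = jprod M z t.
Proof.
move=> z1; elim: M => [|M IH].
  rewrite /jnorm /jprod !big_ord0 mul1r /jacobi isum0 jc0 expr0 !mul1r.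
  by rewrite /phase mul0r mulr0 ce0.
rewrite /jprod big_ord_recr/= -/(jprod M z t) -IH jnormS -mulrA -jacobi_step//.
by rewrite mulrA.
Qed.

Definition sinsq t : R := (1 - cos (2 * pi * t)) / 2.

Lemma sinsq_itv t : 0 <= sinsq t <= 1.
Proof.
have := cos_geN1 (2 * pi * t); have := cos_le1 (2 * pi * t).
by rewrite /sinsq => *; apply/andP; split; lra.
Qed.

(* With x = z^(2m+1), (1 + 2 x cos(2 pi t) + x^2) / (1 + x)^2 = 1 - sin^2(pi t) bump. *)
Definition bump z m : R[i] := 4 * z ^+ (2 * m).+1 / (1 + z ^+ (2 * m).+1) ^+ 2.

Definition hprod M z t : R[i] := \prod_(m < M) (1 - (sinsq t)%:C * bump z m).

Lemma add1X_neq0 z n : cn z < 1 -> 1 + z ^+ n.+1 != 0.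
Proof.
move=> z1; have := cn_lb 1 (z ^+ n.+1).
rewrite cn1 cnX -cn_gt0 => h; apply: lt_le_trans h.
by rewrite subr_gt0 exprn_ilt1 ?cn_ge0.
Qed.

Lemma jprod_hprod M z t : cn z < 1 -> jprod M z t = hprod M z t * jprod M z 0.
Proof.
move=> z1; rewrite /jprod /hprod -big_split; apply: eq_bigr => m _ /=.
rewrite mulr0 oppr0 ce0.
have -> : ce (2 * pi * t) + ce (- (2 * pi * t)) = 2 - 4 * (sinsq t)%:C.
  apply/eqP; rewrite eq_complex/= /sinsq cosN sinN.
  by apply/andP; split; apply/eqP; rewrite /=; [field|ring].
rewrite /bump; have := add1X_neq0 (2 * m) z1; set x := z ^+ _ => nx.
by field.
Qed.

(** [jnorm] does not depend on t and cancels: this is the factorisation th(z, t) = th(z, 0) G(z, t)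
    at finite level. *)
Lemma jacobi_hprod M z t : cn z < 1 -> jacobi M z t = hprod M z t * jacobi M z 0.
Proof.
move=> z1; apply: (mulfI (jnorm_nz M (cn_sqr_lt1 z1))).
by rewrite jacobi_jprod// mulrCA jacobi_jprod// jprod_hprod.
Qed.

End FiniteJacobi.

(** * From the finite identity to the theta series *)

Lemma isum_widen (V : zmodType) T M (f : int -> V) : (T <= M)%N ->
  (forall j : int, (T < absz j)%N -> f j = 0) -> isum M f = isum T f.
Proof.
move=> /subnKC <- Hf; elim: (M - T)%N => [|k IH]; first by rewrite addn0.
rewrite addnS isumS IH !Hf ?addr0 ?abszN//=; last by rewrite ltnS leq_addr.
by rewrite ltnS leq_addr.
Qed.

Section JacobiLimit.
Variable R : realType.
Implicit Types (w z : R[i]) (t s e : R) (M k T : nat) (j : int).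

Lemma geom_le s k : 0 <= s < 1 -> \sum_(i < k) s ^+ i <= (1 - s)^-1.
Proof.
move=> /andP[s0 s1]; have y0 : 0 < 1 - s by lra.
rewrite -[leRHS]mul1r ler_pdivlMr//.
suff -> : (\sum_(i < k) s ^+ i) * (1 - s) = 1 - s ^+ k.
  by rewrite gerBl exprn_ge0.
elim: k => [|k IH]; first by rewrite big_ord0 mul0r expr0 subrr.
by rewrite big_ord_recr/= mulrDl IH exprSr; ring.
Qed.

(** Numerators are at most exp (s^(k-i-1)) and inverse denominators at most exp (s^i / (1 - s));
    both exponents have geometric sums, hence a bound free of M and k. *)
Lemma jc_bound s : 0 <= s < 1 -> exists2 B : R, 0 <= B &
  forall M k w, cn w <= s -> cn (jc M w k) <= B.
Proof.
move=> s01; have /andP[s0 s1] := s01; have y0 : 0 < 1 - s by lra.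
exists (expR ((1 - s)^-1 + (1 - s)^-1 ^+ 2)); first exact: expR_ge0.
move=> M k w ws.
have [kM|Mk] := leqP k M; last by rewrite jc_gt// cn0 expR_ge0.
have wX n : cn (w ^+ n) <= s ^+ n.
  by rewrite cnX; apply: lerXn2r; rewrite ?nnegrE ?cn_ge0.
rewrite /jc cn_prod.
apply: (@le_trans _ _ (\prod_(i < k) expR (s ^+ (k - i.+1) + s ^+ i / (1 - s)))); last first.
  rewrite -expR_sum ler_expR big_split/= lerD//.
    rewrite (reindex_inj rev_ord_inj)/=.
    rewrite (eq_bigr (fun i : 'I_k => s ^+ i)); first exact: geom_le.
    by move=> i _; congr (_ ^+ _); have := ltn_ord i; lia.
  by rewrite -mulr_suml expr2 ler_pM2r ?invr_gt0//; exact: geom_le.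
apply: ler_prod => i _; rewrite cn_ge0/= cnM cnV expRD.
have iM : (k - i.+1 <= M - i)%N by have := ltn_ord i; lia.
have b1 : s ^+ (M.+1 + i) <= s by rewrite -[leRHS]expr1; apply: ler_wiXn2l => //; exact: ltW.
have b2 : s ^+ (M.+1 + i) <= s ^+ i by apply: ler_wiXn2l => //; [exact: ltW|lia].
have d1 : 1 - s ^+ (M.+1 + i) <= cn (1 - w ^+ (M.+1 + i)).
  by have := cn_lb 1 (- w ^+ (M.+1 + i)); rewrite cn1 cnN; have := wX (M.+1 + i)%N; lra.
apply: ler_pM; rewrite ?invr_ge0 ?cn_ge0//.
  apply: le_trans (expR_ge1Dx _); apply: (le_trans (cnB _ _)); rewrite cn1 lerD2l.
  by apply: (le_trans (wX _)); apply: ler_wiXn2l => //; exact: ltW.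
apply: le_trans (expR_ge1Dx _); apply: (@le_trans _ _ (1 - s ^+ (M.+1 + i))^-1).
  by rewrite lef_pV2 ?posrE//; lra.
rewrite -[leLHS]mul1r ler_pdivrMr; last by lra.
set b := s ^+ _ in b1 b2 *; have b0 : 0 <= b by exact: exprn_ge0.
have : 0 <= s ^+ i / (1 - s) by rewrite divr_ge0 ?exprn_ge0// ltW.
have : b <= s ^+ i / (1 - s) * (1 - b).
  rewrite mulrAC ler_pdivlMr//; apply: ler_pM => //; lra.
lra.
Qed.

Lemma prod_near1 k (f : 'I_k -> R[i]) e : (forall i, cn (f i - 1) <= e) ->
  cn (\prod_i f i - 1) <= (1 + e) ^+ k - 1.
Proof.
elim: k f => [|k IH] f Hf; first by rewrite big_ord0 subrr cn0 expr0 subrr.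
rewrite big_ord_recl; set P := \prod_(_ < k) _.
have hP : cn (P - 1) <= (1 + e) ^+ k - 1 by apply: IH => i.
have e0 : 0 <= e by exact: le_trans (cn_ge0 _) (Hf ord0).
have -> : f ord0 * P - 1 = (f ord0 - 1) * (P - 1) + (f ord0 - 1) + (P - 1) by ring.
apply: (le_trans (cnD _ _)); apply: (le_trans (lerD (cnD _ _) (lexx _))).
rewrite cnM exprS.
have : cn (f ord0 - 1) * cn (P - 1) <= e * ((1 + e) ^+ k - 1).
  by apply: ler_pM; rewrite ?cn_ge0.
have := Hf ord0; lra.
Qed.

Lemma jc_near s T e : 0 <= s < 1 -> 0 < e -> exists M0, forall M k w,
  (M0 <= M)%N -> (k <= T)%N -> cn w <= s -> cn (jc M w k - 1) <= e.
Proof.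
move=> s01 e0; have /andP[s0 s1] := s01; have y0 : 0 < 1 - s by lra.
pose x := Num.min 2^-1 (e / 2).
have x0 : 0 < x by rewrite lt_min; apply/andP; split; lra.
have x2 : x <= 2^-1 by rewrite ge_min lexx.
have xe : x <= e / 2 by rewrite ge_min lexx orbT.
pose d := x / T.+1%:R; have d0 : 0 < d by rewrite divr_gt0.
have f0 : 0 < d * (1 - s) / 2 by rewrite !divr_gt0 ?mulr_gt0.
have [K HK] := pow_expR_small 0 y0 f0.
exists (T + K)%N => M k w MT kT ws.
have wX n : cn (w ^+ n) <= s ^+ n.
  by rewrite cnX; apply: lerXn2r; rewrite ?nnegrE ?cn_ge0.
have sX n : (K <= n)%N -> s ^+ n <= d * (1 - s) / 2.
  move=> Kn; apply: (le_trans (exprn_le_expR _ s0)).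
  by have := HK n Kn; rewrite expr0 mul1r.
have fac (i : 'I_k) : cn ((1 - w ^+ (M - i)) / (1 - w ^+ (M.+1 + i)) - 1) <= d.
  have iT : (i < T)%N by exact: leq_trans (ltn_ord i) kT.
  have b1 : s ^+ (M.+1 + i) <= s by rewrite -[leRHS]expr1; apply: ler_wiXn2l => //; exact: ltW.
  have d1 : 1 - s <= cn (1 - w ^+ (M.+1 + i)).
    by have := cn_lb 1 (- w ^+ (M.+1 + i)); rewrite cn1 cnN; have := wX (M.+1 + i)%N; lra.
  have nz : 1 - w ^+ (M.+1 + i) != 0 by rewrite -cn_gt0; lra.
  have -> : (1 - w ^+ (M - i)) / (1 - w ^+ (M.+1 + i)) - 1 =
     (w ^+ (M.+1 + i) - w ^+ (M - i)) / (1 - w ^+ (M.+1 + i)).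
    by move: nz; set a := w ^+ (M.+1 + i) => nz; field.
  rewrite cnM cnV ler_pdivrMr; last by rewrite cn_gt0.
  apply: (le_trans (cnB _ _)); apply: (@le_trans _ _ (d * (1 - s))); last by rewrite ler_pM2l.
  have h1 := sX (M.+1 + i)%N ltac:(move: MT; clear; lia).
  have h2 := sX (M - i)%N ltac:(move: MT iT; clear; lia).
  by have := wX (M.+1 + i)%N; have := wX (M - i)%N; lra.
apply: (le_trans (prod_near1 fac)).
have dk : (1 + d) ^+ k <= expR x.
  apply: (@le_trans _ _ (expR d ^+ k)).
    by apply: lerXn2r; rewrite ?nnegrE ?expR_ge0 ?expR_ge1Dx//; lra.
  rewrite -expRM_natl ler_expR /d mulrA ler_pdivrMr// mulrC ler_pM2l//.
  by rewrite ler_nat; move: kT; clear; lia.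
have ex : expR x <= 1 + 2 * x.
  have := expR_ge1Dx (- x); rewrite expRN => h.
  have ep := expR_gt0 x.
  have yx : 0 < 1 - x by move: x2; clear; lra.
  rewrite -(ler_pM2r yx); apply: (@le_trans _ _ 1).
    by rewrite mulrC -ler_pdivlMr// mul1r.
  by move: x0 x2; clear; nra.
move: dk ex xe; clear; lra.
Qed.

(** Dominated convergence: for |j| <= T the coefficients are near 1 by [jc_near], and for T < |j| <=
    M they are bounded by [jc_bound] against the tail of [Th]. M0 may depend on T, but neither T0
    nor M0 on z or t. *)
Lemma jacobi_th r e : 0 < r < 1 -> 0 < e -> exists T0, forall T, (T0 <= T)%N ->
  exists M0, forall M z t, (M0 <= M)%N -> cn z <= r -> cn (jacobi M z t - th T z t) <= e.
Proof.
move=> r01 e0; have /andP[r0 r1] := r01.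
have s01 : 0 <= r ^+ 2 < 1 by rewrite exprn_ge0 ?(ltW r0)//= exprn_ilt1// ltW.
have [B B0 HB] := jc_bound s01.
have [N [N0 HN]] : exists N : R, 0 < N /\ forall T, Th T r <= N.
  have [N HN] := Th_bounded r01; exists N; split => //.
  by apply: lt_le_trans (HN 0%N); exact: Th_gt0 (ltW r0).
have e1 : 0 < e / (2 * (B + 1)) by rewrite divr_gt0//; lra.
have e2 : 0 < e / (2 * N) by rewrite divr_gt0// mulr_gt0.
have [T0 HT0] := cvg_cauchy (Th_nondecreasing r01) (Th_cvg r01) e1.
exists T0 => T TT0.
have [M0 HM0] := jc_near T s01 e2.
exists (maxn M0 T) => M z t; rewrite geq_max => /andP[MM0 TM] zr.
pose ind (j : int) : bool := (absz j <= T)%N.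
have w2 : cn (z ^+ 2) <= r ^+ 2.
  by rewrite cnX; apply: lerXn2r; rewrite ?nnegrE ?cn_ge0// ltW.
have ind0 j : (T < absz j)%N -> ind j = false by rewrite /ind ltnNge => /negbTE.
have thM : th T z t = isum M (fun j => (ind j)%:R * (z ^+ sq j * ce (phase j t))).
  rewrite (isum_widen TM) => [|j /ind0 ->]; last by rewrite mul0r.
  by apply: eq_isum => j jT; rewrite /ind jT mul1r.
have ThM : Th T r = isum M (fun j => (ind j)%:R * r ^+ sq j).
  rewrite (isum_widen TM) => [|j /ind0 ->]; last by rewrite mul0r.
  by apply: eq_isum => j jT; rewrite /ind jT mul1r.
have HTM := HT0 M (leq_trans TT0 TM).
have HTT := Th_nondecreasing r01 TT0; rewrite /= in HTT.
apply: (@le_trans _ _ (e / (2 * N) * Th T r + B * (Th M r - Th T r))); last first.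
  have h1 : e / (2 * N) * Th T r <= e / 2.
    apply: (@le_trans _ _ (e / (2 * N) * N)); first by rewrite ler_pM2l.
    by rewrite le_eqVlt; apply/orP; left; apply/eqP; field; rewrite gt_eqF.
  have h2 : B * (Th M r - Th T r) <= e / 2.
    apply: (@le_trans _ _ ((B + 1) * (e / (2 * (B + 1))))).
      by apply: ler_pM => //; rewrite ?subr_ge0 ?(Th_nondecreasing r01 TM)//; lra.
    by rewrite le_eqVlt; apply/orP; left; apply/eqP; field; rewrite gt_eqF//; lra.
  lra.
rewrite thM /jacobi -isumB; apply: (le_trans (cn_isum _ _)).
rewrite ThM /Th mulrBr -!isumZl addrCA -isumB -isumD; apply: le_isum => j _.
have -> : jc M (z ^+ 2) (absz j) * z ^+ sq j * ce (phase j t) -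
    (ind j)%:R * (z ^+ sq j * ce (phase j t)) =
    (jc M (z ^+ 2) (absz j) - (ind j)%:R) * z ^+ sq j * ce (phase j t) by ring.
rewrite !cnM cn_ce mulr1 cnX.
have zq : cn z ^+ sq j <= r ^+ sq j by apply: lerXn2r; rewrite ?nnegrE ?cn_ge0// ltW.
have rq : 0 <= r ^+ sq j by rewrite exprn_ge0// ltW.
apply: (@le_trans _ _ (cn (jc M (z ^+ 2) (absz j) - (ind j)%:R) * r ^+ sq j)).
  by rewrite ler_wpM2l ?cn_ge0.
rewrite /ind; case: leqP => jT.
  by rewrite mul1r [leRHS]addrC subrK ler_wpM2r//; exact: HM0.
by rewrite !mul0r !mulr0 !subr0 addr0 ler_wpM2r// HB.
Qed.

Lemma th_hprod r e : 0 < r < 1 -> 0 < e -> exists T0, forall T, (T0 <= T)%N ->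
  exists M0, forall M z t, (M0 <= M)%N -> cn z <= r -> cn (hprod M z t) <= 1 ->
  cn (th T z t - th T z 0 * hprod M z t) <= e.
Proof.
move=> r01 e0; have /andP[r0 r1] := r01.
have [T0 HT0] := jacobi_th r01 (divr_gt0 e0 (ltr0n R 2)).
exists T0 => T /HT0[M0 HM0]; exists M0 => M z t MM0 zr h1.
have z1 : cn z < 1 by exact: le_lt_trans r1.
have -> : th T z t - th T z 0 * hprod M z t =
   (th T z t - jacobi M z t) + hprod M z t * (jacobi M z 0 - th T z 0).
  by rewrite (jacobi_hprod M t z1); ring.
apply: (le_trans (cnD _ _)); rewrite [leRHS]splitr lerD//.
  by rewrite cnBC; exact: HM0.
by rewrite cnM -[leRHS]mul1r; apply: ler_pM; rewrite ?cn_ge0//; exact: HM0.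
Qed.

End JacobiLimit.

(** * The quotient product has modulus at most 1 on a disc around q *)

Section ProductBound.
Variable R : realType.
Implicit Types (q s t : R) (u z : R[i]) (M m : nat).

(* Radius, relative to 1 - q, of the disc on which [hprod] stays of modulus at most 1; 32 * 21
   comes from [factor_bound]. *)
Definition rad_inv : R := 32 * 21 * 10.
Definition rad : R := rad_inv^-1.

Lemma rad_gt0 : 0 < rad.
Proof. by rewrite invr_gt0 /rad_inv !mulr_gt0. Qed.

Lemma rad_mul : 32 * 21 * rad = 10^-1.
Proof. by rewrite /rad /rad_inv invfM mulrA divff ?mul1r// mulf_neq0. Qed.

Lemma rad_small : rad <= 100^-1.
Proof. by have := rad_mul; have := rad_gt0; lra. Qed.

Lemma real_bump t : (4 * t / (1 + t) ^+ 2)%:C = 4 * t%:C / (1 + t)%:C ^+ 2 :> R[i].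
Proof.
rewrite (rmorphM (real_complex R) (4 * t)) (rmorphM (real_complex R) 4).
by rewrite fmorphV rmorphXn (rmorph_nat (real_complex R)).
Qed.

Section Factor.
Variables (q : R) (u : R[i]).
Hypothesis q01 : 0 < q < 1.
Hypothesis uq : cn u <= rad * (1 - q).

Let a := cn u.
Let r := 1 + a.

Lemma rad_facts : [/\ 0 <= a, a <= rad, 1 <= r & q * r ^+ 3 <= 1].
Proof.
have /andP[q0 q1] := q01; have a0 : 0 <= a by exact: cn_ge0.
have c0 := rad_gt0; have c1 := rad_small.
have ac : a <= rad by apply: (le_trans uq); rewrite ler_piMr; lra.
split => //; first by rewrite lerDl.
have h : r ^+ 3 <= 1 + 7 * a.
  have a1 : a <= 1 by lra.
  rewrite /r; nra.
apply: (@le_trans _ _ (q * (1 + 7 * a))); first by rewrite ler_pM2l.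
have : q * a <= a by rewrite ler_piMl// ltW.
have := uq; rewrite -/a; nra.
Qed.

(** Since 0 <= s <= 1, |1 - s y|^2 <= 1 - s (2 Re y - |y|^2). At u = 0, y is a real y0 in [x0, 1].
    With D = |y - y0| one has Re y >= y0 - D and |y|^2 <= y0 + 19 D, which gives 21 = 2 + 19; and D
    <= 32 x0 eta. *)
Lemma factor_bound m s : 0 <= s <= 1 ->
  cn (1 - s%:C * (4 * (q%:C * (1 + u)) ^+ m / (1 + (q%:C * (1 + u)) ^+ m) ^+ 2)) ^+ 2 <=
  1 - s * (q ^+ m - 32 * 21 * (q ^+ m * (r ^+ m - 1))).
Proof.
move=> /andP[s0 s1].
have /andP[q0 q1] := q01; have [a0 ac r1 qr] := rad_facts.
set x0 := q ^+ m; set x := (_ * _) ^+ m; set eta := r ^+ m - 1.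
have x00 : 0 <= x0 by rewrite exprn_ge0// ltW.
have x01 : x0 <= 1 by rewrite exprn_ile1// ltW.
have rm1 : 1 <= r ^+ m by exact: exprn_ege1.
have eta0 : 0 <= eta by rewrite subr_ge0.
have dx : cn (x - x0%:C) <= x0 * eta.
  have -> : x - x0%:C = x0%:C * ((1 + u) ^+ m - 1).
    by rewrite /x /x0 exprMn rmorphXn/=; ring.
  rewrite cnM cn_real ger0_norm// ler_wpM2l//.
  have := @prod_near1 R m (fun=> 1 + u) a.
  by rewrite !prodr_const card_ord addrAC subrr add0r; apply.
have xle : cn x <= x0 * r ^+ m.
  have := cnD (x - x0%:C) x0%:C; rewrite subrK cn_real ger0_norm// => h.
  by apply: (le_trans h); rewrite /eta in dx *; lra.
have x1 : x0 * r ^+ m <= 1.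
  rewrite -exprMn exprn_ile1//; first by rewrite mulr_ge0//; lra.
  apply: le_trans qr; rewrite ler_pM2l// -[leLHS]expr1 ler_weXn2l//.
have cx1 : cn x <= 1 by exact: le_trans x1.
(* Either eta <= 1/2 and x is close to x0 >= 0, or r^m >= 3/2 and q r^3 <= 1 forces |x| <= r^(-2m)
   <= 4/9. *)
have half : 2^-1 <= cn (1 + x).
  have [he|he] := leP eta 2^-1.
    have -> : 1 + x = (1 + x0%:C) + (x - x0%:C) by ring.
    apply: le_trans (cn_lb _ _).
    have -> : 1 + x0%:C = (1 + x0)%:C by rewrite rmorphD.
    rewrite cn_real ger0_norm; last by lra.
    have : x0 * eta <= x0 * 2^-1 by rewrite ler_wpM2l.
    lra.
  have rm : 3 / 2 <= r ^+ m by rewrite /eta in he; lra.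
  have h : x0 * r ^+ m * (r ^+ m) ^+ 2 <= 1.
    have -> : x0 * r ^+ m * (r ^+ m) ^+ 2 = (q * r ^+ 3) ^+ m.
      by rewrite exprMn -/x0 [(r ^+ 3) ^+ m]exprAC; ring.
    by rewrite exprn_ile1// mulr_ge0 ?exprn_ge0//; lra.
  have p0 : 0 <= x0 * r ^+ m by rewrite mulr_ge0//; lra.
  have p2 : 9 / 4 <= (r ^+ m) ^+ 2 by nra.
  have : x0 * r ^+ m * (9 / 4) <= 1 by apply: le_trans h; rewrite ler_wpM2l.
  by have := cn_lb 1 x; rewrite cn1; lra.
pose y := 4 * x / (1 + x) ^+ 2; pose y0 := 4 * x0 / (1 + x0) ^+ 2.
have nx : 1 + x != 0 by rewrite -cn_gt0; lra.
have nx0 : (1 + x0)%:C != 0 :> R[i].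
  by rewrite -cn_gt0 cn_real normr_gt0; apply: lt0r_neq0; lra.
have sqx : 4^-1 <= cn (1 + x) ^+ 2 by nra.
have y00 : x0 <= y0.
  rewrite /y0 ler_pdivlMr ?exprn_gt0//; last by lra.
  by rewrite mulrC ler_wpM2r//; nra.
have y01 : y0 <= 1.
  rewrite /y0 ler_pdivrMr ?exprn_gt0//; [|lra].
  by have := sqr_ge0 (1 - x0); nra.
have cny : cn y <= 16.
  rewrite /y cnM cnV cnX ler_pdivrMr; last by lra.
  rewrite cnM cn_nat; lra.
pose D := cn (y - y0%:C).
have D0 : 0 <= D by exact: cn_ge0.
have D17 : D <= 17.
  by apply: (le_trans (cnB _ _)); rewrite cn_real ger0_norm; lra.
have Dle : D <= 32 * (x0 * eta).
  have -> : D = cn (4 * (x - x0%:C) * (1 - x * x0%:C)) / (cn (1 + x) ^+ 2 * (1 + x0) ^+ 2).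
    have c10 : cn ((1 + x0)%:C : R[i]) = 1 + x0 by rewrite cn_real ger0_norm; lra.
    rewrite -{1}c10 -!cnX -cnM -cnV -cnM /D /y /y0; congr cn.
    rewrite real_bump.
    have e1 : (1 + x0)%:C = 1 + x0%:C :> R[i] by rewrite rmorphD.
    move: nx0; rewrite e1; move: (x0%:C) => X nX.
    by field; rewrite nx nX.
  have xx : cn (1 - x * x0%:C) <= 2.
    apply: (le_trans (cnB _ _)); rewrite cn1 cnM cn_real ger0_norm//.
    have : cn x * x0 <= 1 * 1 by apply: ler_pM; rewrite ?cn_ge0.
    lra.
  have dd : 4^-1 <= cn (1 + x) ^+ 2 * (1 + x0) ^+ 2.
    by rewrite -[leLHS]mulr1; apply: ler_pM => //; nra.
  rewrite ler_pdivrMr; last by lra.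
  rewrite !cnM cn_nat.
  apply: (@le_trans _ _ (4 * (x0 * eta) * 2)).
    apply: ler_pM; rewrite ?mulr_ge0 ?cn_ge0//.
    by rewrite ler_pM2l.
  have : 0 <= x0 * eta by rewrite mulr_ge0.
  by move: dd; move: (cn (1 + x) ^+ 2 * _) (x0 * eta) => v w; nra.
have ReY : y0 - D <= Re y.
  have := Re_le_cn (y - y0%:C); rewrite -/D ler_norml raddfB/= => /andP[h _]; lra.
have cY : cn y <= y0 + D.
  have := cnD (y - y0%:C) y0%:C; rewrite subrK cn_real ger0_norm; last by lra.
  by rewrite -/D; lra.
have cYs : cn y ^+ 2 <= y0 + 19 * D.
  apply: (@le_trans _ _ ((y0 + D) ^+ 2)).
    by apply: lerXn2r; rewrite ?nnegrE ?cn_ge0//; lra.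
  nra.
have main : x0 - 32 * 21 * (x0 * eta) <= 2 * Re y - cn y ^+ 2 by lra.
have -> : cn (1 - s%:C * y) ^+ 2 = 1 - 2 * s * Re y + s ^+ 2 * cn y ^+ 2.
  rewrite !cn_sqr; case: (y) => b c /=; ring.
have : s * (x0 - 32 * 21 * (x0 * eta)) <= s * (2 * Re y - cn y ^+ 2) by rewrite ler_wpM2l.
have : s ^+ 2 * cn y ^+ 2 <= s * cn y ^+ 2.
  by rewrite ler_wpM2r ?sqr_ge0// expr2 ler_piMl.
lra.
Qed.

End Factor.

Lemma geom_odd q M : \sum_(i < M) q ^+ (2 * i).+1 = q * \sum_(i < M) (q ^+ 2) ^+ i.
Proof. by rewrite mulr_sumr; apply: eq_bigr => i _; rewrite exprS exprM. Qed.

Lemma geom_sqE q M : 0 < q < 1 ->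
  \sum_(i < M) (q ^+ 2) ^+ i = (1 - (q ^+ 2) ^+ M) / (1 - q ^+ 2).
Proof.
move=> /andP[q0 q1]; have y0 : 0 < 1 - q ^+ 2 by nra.
apply: (mulIf (x := 1 - q ^+ 2)); first by rewrite gt_eqF.
rewrite divfK ?gt_eqF//; elim: M => [|M IH]; first by rewrite big_ord0 mul0r expr0 subrr.
by rewrite big_ord_recr/= mulrDl IH (exprSr _ M); ring.
Qed.

(* Each factor may exceed 1 in modulus; only the sum over m of the exponents in [factor_bound]
   has a sign. *)
Lemma hprod_le1 q : 0 < q < 1 -> exists M0, forall M u t, (M0 <= M)%N ->
  cn u <= rad * (1 - q) -> cn (hprod M (q%:C * (1 + u)) t) <= 1.
Proof.
move=> q01; have /andP[q0 q1] := q01.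
have Y0 : 0 < 1 - q ^+ 2 by nra.
have e0 : 0 < ((32 * 21 + 1) * 2)^-1 :> R by rewrite invr_gt0 !mulr_gt0// addr_gt0 ?mulr_gt0.
have [M0 HM0] := pow_expR_small 0 Y0 e0.
exists M0 => M u t MM0 uq.
have /andP[s0 s1] := sinsq_itv t; set s := sinsq t in s0 s1 *.
have [a0 ac r1 qr] := rad_facts q01 uq.
set a := cn u in a0 ac r1 qr *; set r := 1 + a in r1 qr *.
have c0 := rad_gt0; have cK := rad_mul; have c1 := rad_small.
pose g (i : 'I_M) := q ^+ (2 * i).+1 - 32 * 21 * (q ^+ (2 * i).+1 * (r ^+ (2 * i).+1 - 1)).
have H2 : cn (hprod M (q%:C * (1 + u)) t) ^+ 2 <= expR (- (s * \sum_i g i)).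
  rewrite /hprod cn_prod -prodrXl mulr_sumr -sumrN expR_sum.
  apply: ler_prod => i _; rewrite sqr_ge0/=; apply: le_trans (expR_ge1Dx _).
  by apply: factor_bound => //; rewrite s0.
suff g0 : 0 <= \sum_i g i.
  have : cn (hprod M (q%:C * (1 + u)) t) ^+ 2 <= 1.
    by apply: (le_trans H2); rewrite expR_le1 oppr_le0 mulr_ge0.
  by rewrite expr_le1 ?cn_ge0.
have -> : \sum_i g i = (32 * 21 + 1) * \sum_(i < M) q ^+ (2 * i).+1 -
     32 * 21 * \sum_(i < M) (q * r) ^+ (2 * i).+1.
  rewrite !mulr_sumr -sumrB; apply: eq_bigr => i _.
  by rewrite /g exprMn; ring.
rewrite !geom_odd geom_sqE//.
have aY : a <= rad * (1 - q ^+ 2).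
  by apply: (le_trans uq); rewrite ler_pM2l//; nra.
have qr2 : 1 - (q * r) ^+ 2 >= (1 - q ^+ 2) * (1 - 3 * rad).
  have r2 : r ^+ 2 <= 1 + 3 * a by rewrite /r; nra.
  have : q ^+ 2 * r ^+ 2 <= q ^+ 2 * (1 + 3 * a) by rewrite ler_wpM2l ?sqr_ge0.
  have : q ^+ 2 * a <= a by rewrite ler_piMl//; nra.
  rewrite exprMn; move: aY; move: (q ^+ 2) (r ^+ 2) (a) rad; clear=> Q r' a' c *; lra.
have Z0 : 0 < (1 - q ^+ 2) * (1 - 3 * rad) by rewrite mulr_gt0//; lra.
have Z1 : 0 < 1 - (q * r) ^+ 2 by lra.
have qr0 : 0 <= q * r by rewrite mulr_ge0//; lra.
have gl : \sum_(i < M) ((q * r) ^+ 2) ^+ i <= (1 - (q * r) ^+ 2)^-1.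
  by apply: geom_le; rewrite sqr_ge0/=; lra.
have qM : (32 * 21 + 1) * (q ^+ 2) ^+ M <= 2^-1.
  have h := exprn_le_expR M (sqr_ge0 q).
  have := HM0 M MM0; rewrite expr0 mul1r => h2.
  have h3 := le_trans h h2.
  rewrite -[leLHS]mulrC -ler_pdivlMr; last by rewrite addr_gt0 ?mulr_gt0.
  by rewrite -invfM [2 * _]mulrC.
rewrite subr_ge0.
apply: (@le_trans _ _ (32 * 21 * (q * r * (1 - (q * r) ^+ 2)^-1))).
  by rewrite ler_pM2l ?mulr_gt0// ler_wpM2l.
apply: (@le_trans _ _ (32 * 21 * (q * r * ((1 - q ^+ 2) * (1 - 3 * rad))^-1))).
  by rewrite ler_pM2l ?mulr_gt0// ler_wpM2l// lef_pV2.
rewrite invfM.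
have -> : 32 * 21 * (q * r * ((1 - q ^+ 2)^-1 / (1 - 3 * rad))) =
  q / (1 - q ^+ 2) * (32 * 21 * r / (1 - 3 * rad)) by ring.
have -> : (32 * 21 + 1) * (q * ((1 - (q ^+ 2) ^+ M) / (1 - q ^+ 2))) =
  q / (1 - q ^+ 2) * ((32 * 21 + 1) * (1 - (q ^+ 2) ^+ M)) by ring.
rewrite ler_pM2l ?divr_gt0// ler_pdivrMr; last by lra.
(* The surplus 1 in 32 * 21 + 1 is split in halves: one pays for the perturbation, as 32 * 21 * rad
   = 1/10, the other for the truncation at M, by [qM]. *)
apply: (@le_trans _ _ ((32 * 21 + 2^-1) * (1 - 3 * rad))).
  have : r <= 1 + rad by rewrite /r lerD2l.
  by move: cK c1; clear; lra.
rewrite ler_pM2r; last by lra.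
by move: qM; clear; lra.
Qed.

End ProductBound.

(** * Uniform approximation by polynomials on a disc, and Taylor remainders *)

Section PolynomialApproximation.
Variable R : realType.
Implicit Types (f g : R[i] -> R[i]) (p : {poly R[i]}) (u : R[i]) (e rho : R).

(** The form in which analyticity is used. It is stable under sums, products and the inverse of 1 +
    f with |f| <= s < 1, which covers [hprod], and it reduces Cauchy's estimates to polynomials. *)
Definition papprox rho f := forall e, 0 < e ->
  exists p, forall u, cn u <= rho -> cn (f u - p.[u]) <= e.

Variable rho : R.
Hypothesis rho0 : 0 < rho.

Lemma papprox_poly p : papprox rho (fun u => p.[u]).
Proof. by move=> e e0; exists p => u _; rewrite subrr cn0 ltW. Qed.

Lemma papprox_cst c : papprox rho (fun=> c).
Proof.
by move=> e e0; exists c%:P => u _; rewrite hornerC subrr cn0 ltW.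
Qed.

Lemma eq_papprox f g : (forall u, cn u <= rho -> f u = g u) -> papprox rho f -> papprox rho g.
Proof.
move=> fg hf e /hf[p hp]; exists p => u ur; rewrite -fg//; exact: hp.
Qed.

Lemma horner_bound p : exists2 B : R, 0 <= B & forall u, cn u <= rho -> cn p.[u] <= B.
Proof.
exists (\sum_(i < size p) cn p`_i * rho ^+ i).
  by apply: sumr_ge0 => i _; rewrite mulr_ge0 ?cn_ge0 ?exprn_ge0// ltW.
move=> u ur; rewrite horner_coef; apply: (le_trans (cn_sum _ _ _)).
apply: ler_sum => i _; rewrite cnM cnX ler_wpM2l ?cn_ge0//.
by apply: lerXn2r; rewrite ?nnegrE ?cn_ge0// ltW.
Qed.

Lemma papprox_bound f : papprox rho f ->
  exists2 B : R, 0 < B & forall u, cn u <= rho -> cn (f u) <= B.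
Proof.
move=> /(_ 1 ltr01)[p hp]; have [B B0 HB] := horner_bound p.
exists (B + 1) => [|u ur]; first by lra.
have := cnD (f u - p.[u]) p.[u]; rewrite subrK.
have := hp u ur; have := HB u ur; lra.
Qed.

Lemma papproxD f g : papprox rho f -> papprox rho g -> papprox rho (fun u => f u + g u).
Proof.
move=> hf hg e e0; have e2 : 0 < e / 2 by lra.
have [p hp] := hf _ e2; have [r hr] := hg _ e2.
exists (p + r) => u ur; rewrite hornerD.
have -> : f u + g u - (p.[u] + r.[u]) = (f u - p.[u]) + (g u - r.[u]) by ring.
by apply: (le_trans (cnD _ _)); rewrite [leRHS]splitr lerD ?hp ?hr.
Qed.

Lemma papproxM f g : papprox rho f -> papprox rho g -> papprox rho (fun u => f u * g u).
Proof.
move=> hf hg e e0.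
have [A A0 HA] := papprox_bound hf; have [B B0 HB] := papprox_bound hg.
have e1 : 0 < Num.min 1 (e / (2 * B)).
  by rewrite lt_min ltr01 divr_gt0// mulr_gt0.
have e2 : 0 < e / (2 * (A + 1)) by rewrite divr_gt0//; lra.
have [p hp] := hf _ e1; have [r hr] := hg _ e2.
exists (p * r) => u ur; rewrite hornerM.
have -> : f u * g u - p.[u] * r.[u] = (f u - p.[u]) * g u + p.[u] * (g u - r.[u]) by ring.
apply: (le_trans (cnD _ _)); rewrite !cnM.
have := hp u ur; rewrite le_min => /andP[p1 p2].
have pb : cn p.[u] <= A + 1.
  have := cnD (p.[u] - f u) (f u); rewrite subrK cnBC.
  by have := HA u ur; move: p1; clear; lra.
have h1 : cn (f u - p.[u]) * cn (g u) <= e / (2 * B) * B.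
  by apply: ler_pM; rewrite ?cn_ge0//; exact: HB.
have h2 : cn p.[u] * cn (g u - r.[u]) <= (A + 1) * (e / (2 * (A + 1))).
  by apply: ler_pM; rewrite ?cn_ge0//; exact: hr.
have E1 : e / (2 * B) * B = e / 2 by field; rewrite gt_eqF.
have E2 : (A + 1) * (e / (2 * (A + 1))) = e / 2 by field; rewrite gt_eqF//; lra.
by move: h1 h2; rewrite E1 E2; clear; lra.
Qed.

Lemma papproxX f n : papprox rho f -> papprox rho (fun u => f u ^+ n).
Proof.
move=> hf; elim: n => [|n IH].
  by apply: (@eq_papprox (fun=> 1)) => [u _|]; [rewrite expr0|exact: papprox_cst].
apply: (@eq_papprox (fun u => f u * f u ^+ n)) => [u _|]; first by rewrite exprS.
exact: papproxM.
Qed.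

Lemma papprox_sum n (F : nat -> R[i] -> R[i]) : (forall i, papprox rho (F i)) ->
  papprox rho (fun u => \sum_(i < n) F i u).
Proof.
move=> hF; elim: n => [|n IH].
  by apply: (@eq_papprox (fun=> 0)) => [u _|]; [rewrite big_ord0|exact: papprox_cst].
apply: (@eq_papprox (fun u => \sum_(i < n) F i u + F n u)) => [u _|].
  by rewrite big_ord_recr.
exact: papproxD.
Qed.

Lemma papprox_prod (I : Type) (r : seq I) (F : I -> R[i] -> R[i]) :
  (forall i, papprox rho (F i)) -> papprox rho (fun u => \prod_(i <- r) F i u).
Proof.
move=> hF; elim: r => [|x r IH].
  by apply: (@eq_papprox (fun=> 1)) => [u _|]; [rewrite big_nil|exact: papprox_cst].
apply: (@eq_papprox (fun u => F x u * \prod_(i <- r) F i u)) => [u _|].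
  by rewrite big_cons.
exact: papproxM.
Qed.

Lemma papprox_geom f s : 0 <= s < 1 -> (forall u, cn u <= rho -> cn (f u) <= s) ->
  papprox rho f -> papprox rho (fun u => (1 + f u)^-1).
Proof.
move=> /andP[s0 s1] hs hf e e0; have y0 : 0 < 1 - s by lra.
have e2 : 0 < e / 2 by lra.
have [K HK] := pow_expR_small 0 y0 (mulr_gt0 e2 y0).
have sK : s ^+ K <= e / 2 * (1 - s).
  apply: (le_trans (exprn_le_expR K s0)).
  by have := HK K (leqnn K); rewrite expr0 mul1r.
have hS : papprox rho (fun u => \sum_(i < K) (- f u) ^+ i).
  apply: (@papprox_sum K (fun i u => (- f u) ^+ i)) => i; apply: papproxX.
  apply: (@eq_papprox (fun u => - 1 * f u)) => [u _|]; first by rewrite mulN1r.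
  by apply: papproxM => //; exact: papprox_cst.
have [p hp] := hS _ e2; exists p => u ur.
have nz : 1 + f u != 0.
  by rewrite -cn_gt0; have := cn_lb 1 (f u); rewrite cn1; have := hs u ur; lra.
apply: (le_trans (cn_triB _ (\sum_(i < K) (- f u) ^+ i) _)).
rewrite [leRHS]splitr lerD//; last exact: hp.
have -> : (1 + f u)^-1 - \sum_(i < K) (- f u) ^+ i = (- f u) ^+ K / (1 + f u).
  have : (\sum_(i < K) (- f u) ^+ i) * (1 + f u) = 1 - (- f u) ^+ K.
    elim: K {HK sK hS p hp} => [|K IH]; first by rewrite big_ord0 mul0r expr0 subrr.
    by rewrite big_ord_recr/= mulrDl IH (exprSr _ K); ring.
  move=> h; apply: (mulIf nz); rewrite mulrBl h mulVf// divfK//; ring.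
rewrite cnM cnV cnX cnN ler_pdivrMr ?cn_gt0//.
apply: (@le_trans _ _ (s ^+ K)).
  by apply: lerXn2r; rewrite ?nnegrE ?cn_ge0// hs.
apply: (le_trans sK); rewrite ler_pM2l//.
by have := cn_lb 1 (f u); rewrite cn1; have := hs u ur; lra.
Qed.

Lemma hprod_papprox M q t : 0 < q < 1 -> rho <= (1 - q) / 2 ->
  papprox rho (fun u => hprod M (q%:C * (1 + u)) t).
Proof.
move=> /andP[q0 q1] hrho; have r0 := rho0.
rewrite /hprod; apply: (@papprox_prod 'I_M (index_enum 'I_M) (fun (m : 'I_M) u => 1 - (sinsq t)%:C * bump (q%:C * (1 + u)) m)) => m.
apply: papproxD; first exact: papprox_cst.
have hz : papprox rho (fun u => (q%:C * (1 + u)) ^+ (2 * m).+1).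
  apply: papproxX; apply: papproxM; first exact: papprox_cst.
  apply: papproxD; first exact: papprox_cst.
  by apply: (@eq_papprox (fun u => 'X.[u])) => [u _|]; [rewrite hornerX|exact: papprox_poly].
pose s := q * (1 + rho).
have s0 : 0 <= s by rewrite mulr_ge0//; lra.
have s1 : s < 1.
  have : q * rho <= q * ((1 - q) / 2) by rewrite ler_pM2l.
  by rewrite /s; nra.
have zs u : cn u <= rho -> cn ((q%:C * (1 + u)) ^+ (2 * m).+1) <= s.
  move=> ur; rewrite cnX; apply: (@le_trans _ _ (s ^+ (2 * m).+1)).
    apply: lerXn2r; rewrite ?nnegrE ?cn_ge0// cnM cn_real gtr0_norm//.
    rewrite ler_pM2l//; apply: (le_trans (cnD _ _)); rewrite cn1; lra.
  by rewrite -[leRHS]expr1; apply: ler_wiXn2l => //; exact: ltW.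
have hi : papprox rho (fun u => (1 + (q%:C * (1 + u)) ^+ (2 * m).+1)^-1).
  by apply: (@papprox_geom _ s) => //; rewrite s0.
apply: (@eq_papprox (fun u => (- ((sinsq t)%:C * 4)) *
   ((q%:C * (1 + u)) ^+ (2 * m).+1 * (1 + (q%:C * (1 + u)) ^+ (2 * m).+1)^-1 ^+ 2))).
  by move=> u _; rewrite /bump exprVn; ring.
apply: papproxM; first exact: papprox_cst.
by apply: papproxM => //; exact: papproxX.
Qed.

(* Cauchy's estimate, averaging over the N-th roots of unity, N > size p + k. *)
Lemma cauchy_est p B k : (forall u, cn u <= rho -> cn p.[u] <= B) -> cn p`_k * rho ^+ k <= B.
Proof.
move=> HB; pose Q := (size p + k)%N; pose N : nat := Q.*2.+1.
have N0 : (0 : R) < N%:R by rewrite ltr0n.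
pose b : R := 2 * pi / N%:R.
have bN : N%:R * b = 2 * pi by rewrite /b mulrC divfK// gt_eqF.
have b0 : 0 < b by rewrite divr_gt0// mulr_gt0// pi_gt0.
have orth (i : nat) : (i <= Q)%N ->
    isum Q (fun j : int => ce (j%:~R * (b * (i%:R - k%:R)))) = if i == k then N%:R else 0.
  have kQ : (k <= Q)%N by rewrite leq_addl.
  move=> iQ; case: eqP => [->|/eqP ik].
    by rewrite (eq_isum (g := fun=> 1)) ?isum_const ?mulr1// => j _; rewrite subrr !mulr0 ce0.
  have h (a c : nat) : (c < a)%N -> (a <= Q)%N ->
      isum Q (fun j : int => ce (j%:~R * (b * (a%:R - c%:R)))) = 0.
    move=> ca aQ; rewrite -natrB ?(ltnW ca)//; apply: isum_ce_geom.
      apply: ce_neq1; rewrite mulr_gt0 ?ltr0n ?subn_gt0//= -bN [N%:R * b]mulrC ltr_pM2l//.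
      by rewrite ltr_nat /N; move: aQ ca; clear; lia.
    by rewrite -/N mulrA bN ce_2pi_nat.
  have [lt|lt|e] := ltngtP i k; last by rewrite e eqxx in ik.
    rewrite -[RHS](h k i lt kQ) -isumN; apply: eq_isum => j _; congr ce.
    by rewrite mulrNz; ring.
  exact: h.
have fe : isum Q (fun j : int => p.[rho%:C * ce (j%:~R * b)] * ce (- (j%:~R * b * k%:R))) =
    N%:R * (p`_k * (rho ^+ k)%:C).
  rewrite (eq_isum (g := fun j : int => \sum_(i < size p)
     (p`_i * (rho ^+ i)%:C) * ce (j%:~R * (b * (i%:R - k%:R))))); last first.
    move=> j _; rewrite horner_coef mulr_suml; apply: eq_bigr => i _.
    have -> : (rho ^+ i)%:C = rho%:C ^+ i by rewrite rmorphXn.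
    have -> : ce (j%:~R * (b * (i%:R - k%:R))) = ce (i%:R * (j%:~R * b)) * ce (- (j%:~R * b * k%:R)).
      by rewrite -ceD; congr ce; ring.
    by rewrite exprMn ceX !mulrA.
  rewrite isum_exch (eq_bigr (fun i : 'I_(size p) => if i == k :> nat then
     N%:R * (p`_k * (rho ^+ k)%:C) else 0)); last first.
    move=> i _; rewrite isumZl orth; last by rewrite /Q (leq_trans (ltnW (ltn_ord i)))// leq_addr.
    by case: eqP => [->|_]; rewrite ?mulr0// mulrC.
  rewrite -big_mkcond/=; have [kp|pk] := ltnP k (size p).
    by rewrite (big_pred1 (Ordinal kp)).
  by rewrite nth_default// mul0r mulr0 big1// => i; case: ifP.
have : cn (N%:R * (p`_k * (rho ^+ k)%:C)) <= N%:R * B.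
  rewrite -fe -[N%:R * B](isum_const Q (B : R)); apply: (le_trans (cn_isum _ _)).
  apply: le_isum => j _; rewrite cnM cn_ce mulr1; apply: HB.
  by rewrite cnM cn_ce mulr1 cn_real gtr0_norm.
by rewrite !cnM cn_nat cn_real ger0_norm ?exprn_ge0 ?(ltW rho0)// ler_pM2l.
Qed.

(** Taylor remainder of order L: the coefficients are at most B rho^(-i), and |u| <= rho / 2 makes
    the geometric series at most 2. *)
Lemma drop_poly_bound p B L u : (forall u, cn u <= rho -> cn p.[u] <= B) ->
  2 * cn u <= rho -> cn (p.[u] - (take_poly L p).[u]) <= 2 * B * (cn u / rho) ^+ L.
Proof.
move=> HB ur; have B0 : 0 <= B by apply: le_trans (cn_ge0 _) (HB 0 _); rewrite cn0 ltW.
have -> : p.[u] - (take_poly L p).[u] = (drop_poly L p).[u] * u ^+ L.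
  by apply/eqP; rewrite subr_eq addrC -hornerXn -hornerM -hornerD poly_take_drop.
pose x := cn u / rho; have x0 : 0 <= x by rewrite divr_ge0 ?cn_ge0// ltW.
have x2 : x <= 2^-1 by rewrite ler_pdivrMr//; move: ur; clear; lra.
have h : cn (drop_poly L p).[u] <= 2 * B / rho ^+ L.
  rewrite horner_coef; apply: (le_trans (cn_sum _ _ _)).
  apply: (@le_trans _ _ (\sum_(i < size (drop_poly L p)) B / rho ^+ L * x ^+ i)).
    apply: ler_sum => i _; rewrite coef_drop_poly cnM cnX.
    have := cauchy_est (i + L) HB; rewrite exprD mulrA -ler_pdivlMr ?exprn_gt0// => c1.
    rewrite -ler_pdivlMr ?exprn_gt0// in c1.
    have -> : B / rho ^+ L * x ^+ i = B / rho ^+ L / rho ^+ i * cn u ^+ i.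
      by rewrite /x expr_div_n; ring.
    by rewrite ler_wpM2r ?exprn_ge0 ?cn_ge0.
  rewrite -mulr_sumr; apply: (@le_trans _ _ (B / rho ^+ L * (1 - x)^-1)).
    rewrite ler_wpM2l ?divr_ge0 ?exprn_ge0 ?(ltW rho0)//; apply: geom_le; lra.
  rewrite mulrC mulrA ler_wpM2r ?invr_ge0 ?exprn_ge0 ?(ltW rho0)//.
  rewrite ler_wpM2r//; rewrite -[leRHS]invrK lef_pV2 ?posrE ?invr_gt0//; lra.
rewrite cnM cnX expr_div_n.
have -> : 2 * B * (cn u ^+ L / rho ^+ L) = 2 * B / rho ^+ L * cn u ^+ L by ring.
by rewrite ler_wpM2r ?exprn_ge0 ?cn_ge0.
Qed.

End PolynomialApproximation.

(** * Lagrange interpolation at equally spaced real nodes *)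

Section Interpolation.
Variable R : realType.
Implicit Types (f : R[i] -> R[i]) (p : {poly R[i]}) (u : R[i]) (e rho : R).
Variables (L : nat) (w : R).
Hypothesis w0 : 0 < w.

(* Negative real nodes: q (1 + inode) is then again a parameter in (0, 1). *)
Definition inode (nu : 'I_L) : R[i] := (- (nu%:R * w))%:C.

Definition lag (nu : 'I_L) : {poly R[i]} :=
  \prod_(mu < L | mu != nu) ((inode nu - inode mu)^-1 *: ('X - (inode mu)%:P)).

Lemma inode_inj : injective inode.
Proof.
move=> a b /complexI/oppr_inj/(mulIf (lt0r_neq0 w0))/eqP.
by rewrite eqr_nat => /eqP/val_inj.
Qed.

Lemma lag_node nu mu : (lag nu).[inode mu] = (nu == mu)%:R.
Proof.
rewrite /lag horner_prod; case: eqP => [<-|/eqP nm].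
  rewrite big1// => k kn; rewrite hornerZ hornerXsubC mulVf// subr_eq0.
  by apply: contra kn => /eqP/inode_inj ->.
by rewrite (bigD1 mu) 1?eq_sym//= hornerZ hornerXsubC subrr mulr0 mul0r.
Qed.

Lemma size_lag nu : (size (lag nu) <= L)%N.
Proof.
apply: (leq_trans (size_poly_prod_leq _ _)).
have h : (\sum_(i < L | i != nu) size ((inode nu - inode i)^-1 *: ('X - (inode i)%:P)) <=
    \sum_(i < L | i != nu) 2)%N.
  by apply: leq_sum => i _; apply: (leq_trans (size_scale_leq _ _)); rewrite size_XsubC.
have c : (#|[pred i : 'I_L | i != nu]| = L.-1)%N.
  have := cardC1 nu; rewrite card_ord => <-; apply: eq_card => i; by rewrite !inE.
rewrite sum_nat_const in h.
have L0 : (0 < L)%N by exact: leq_ltn_trans (ltn_ord nu).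
rewrite -[#|_|]/(#|[pred i : 'I_L | i != nu]|) c in h *.
apply: (@leq_trans ((L.-1 * 2).+1 - L.-1)%N); first by rewrite leq_sub2r.
by move: L0; clear; lia.
Qed.

(** The difference of both sides has size at most L and L distinct roots. *)
Lemma lagrange_exact p u : (size p <= L)%N -> p.[u] = \sum_nu (lag nu).[u] * p.[inode nu].
Proof.
move=> sp; pose r := p - \sum_nu p.[inode nu] *: lag nu.
suff r0 : r = 0.
  have : r.[u] = 0 by rewrite r0 horner0.
  rewrite /r hornerD hornerN horner_sum => /eqP; rewrite subr_eq0 => /eqP ->.
  by apply: eq_bigr => nu _; rewrite hornerZ mulrC.
apply/eqP; apply: contraT => rn.
have sr : (size r <= L)%N.
  apply: (leq_trans (size_polyD _ _)); rewrite geq_max sp size_polyN/=.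
  apply: (leq_trans (size_sum _ _ _)); apply/bigmax_leqP => nu _.
  exact: leq_trans (size_scale_leq _ _) (size_lag nu).
have := max_poly_roots (rs := [seq inode nu | nu : 'I_L]) rn.
rewrite size_image card_ord ltnNge sr => h; apply: h.
  apply/allP => z /mapP[mu _ ->]; apply/rootP.
  rewrite /r hornerD hornerN horner_sum (bigD1 mu)//= hornerZ lag_node eqxx mulr1.
  rewrite big1 ?addr0 ?subrr// => nu nm; rewrite hornerZ lag_node (negbTE nm) mulr0//.
by rewrite map_inj_uniq ?enum_uniq//; exact: inode_inj.
Qed.

Lemma cn_inode nu : cn (inode nu) = nu%:R * w.
Proof. by rewrite cn_real normrN ger0_norm// mulr_ge0// ltW. Qed.

(** The nodes are w-separated and within L w of 0, so that each of at most L factors is bounded by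
    (|u| + L w) / w. *)
Lemma lag_bound nu u : cn (lag nu).[u] <= (L%:R * (1 + cn u / w)) ^+ L.
Proof.
have L1 : (1 : R) <= L%:R.
  by rewrite ler1n; exact: leq_ltn_trans (ltn_ord nu).
have s0 : 0 <= cn u / w by rewrite divr_ge0 ?cn_ge0// ltW.
set b := L%:R * _; have b1 : 1 <= b by rewrite /b; nra.
rewrite /lag horner_prod cn_prod.
apply: (@le_trans _ _ (\prod_(mu < L | mu != nu) b)).
  apply: ler_prod => mu mn; rewrite cn_ge0/= hornerZ hornerXsubC cnM cnV.
  have d : w <= cn (inode nu - inode mu).
    rewrite /inode -rmorphB cn_real -opprD normrN -mulrBl normrM (ger0_norm (ltW w0)).
    rewrite ler_peMl ?(ltW w0)//.
    have [lt|lt|/val_inj e] := ltngtP mu nu; last by rewrite e eqxx in mn.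
      by rewrite -natrB ?(ltnW lt)// ger0_norm// ler1n subn_gt0.
    by rewrite distrC -natrB ?(ltnW lt)// ger0_norm// ler1n subn_gt0.
  rewrite mulrC ler_pdivrMr; last exact: lt_le_trans d.
  apply: (le_trans (cnB _ _)); rewrite cn_inode.
  apply: (@le_trans _ _ (b * w)); last by rewrite ler_wpM2l//; lra.
  have -> : b * w = L%:R * w + L%:R * cn u by rewrite /b; field; rewrite gt_eqF.
  rewrite addrC; apply: lerD; first by rewrite ler_pM2r// ler_nat ltnW.
  by rewrite ler_peMl ?cn_ge0.
rewrite prodr_const; apply: ler_weXn2l => //.
by apply: (leq_trans (max_card _)); rewrite card_ord.
Qed.

Definition interp_cst : R := 4 * (1 + L%:R * (L%:R ^+ L * L%:R ^+ L)).

(** f is replaced by a polynomial up to an arbitrary e, and this one by its Taylor polynomial of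
    degree less than L, which interpolation reproduces. Two Taylor remainders are left, at u and,
    weighted by [lag], at the nodes. The polynomial depends on e but the bound does not, so e can be
    removed. *)
Lemma interp_bound rho f u : 0 < rho -> papprox rho f ->
  (forall v, cn v <= rho -> cn (f v) <= 1) ->
  2 * (L%:R * w) <= rho -> 2 * cn u <= rho ->
  cn (f u - \sum_nu (lag nu).[u] * f (inode nu)) <=
    interp_cst * (w / rho) ^+ L * (1 + cn u / w) ^+ L.
Proof.
move=> rho0 hf f1 Lw ur.
have cu := cn_ge0 u.
set s := cn u / w; have s0 : 0 <= s by rewrite divr_ge0// ltW.
have nr nu : 2 * cn (inode nu) <= rho.
  apply: le_trans Lw; rewrite cn_inode ler_pM2l// ler_pM2r// ler_nat ltnW//.
have ur' : cn u <= rho by lra.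
have nr' nu : cn (inode nu) <= rho by have := nr nu; have := cn_ge0 (inode nu); lra.
pose A := \sum_(nu < L) cn (lag nu).[u].
have A0 : 0 <= A by apply: sumr_ge0 => nu _; exact: cn_ge0.
apply/ler_addgt0Pr => e e0.
have e1 : 0 < Num.min 1 (e / (1 + A)) by rewrite lt_min ltr01 divr_gt0//; lra.
have [p hp] := hf _ e1.
have pB v : cn v <= rho -> cn p.[v] <= 2.
  move=> vr; have := cnD (p.[v] - f v) (f v); rewrite subrK cnBC.
  have := hp v vr; rewrite le_min => /andP[h _]; have := f1 v vr; move: h; clear; lra.
have pe v : cn v <= rho -> cn (f v - p.[v]) <= e / (1 + A).
  by move=> /(hp v); rewrite le_min => /andP[].
pose g := take_poly L p.
have dg v : 2 * cn v <= rho -> cn (p.[v] - g.[v]) <= 4 * (cn v / rho) ^+ L.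
  move=> vr; have := drop_poly_bound rho0 L pB vr.
  by have -> : 2 * 2 = 4 :> R by ring.
have ge : g.[u] = \sum_nu (lag nu).[u] * g.[inode nu].
  by apply: lagrange_exact; exact: size_take_poly.
have ef : \sum_nu (lag nu).[u] * (f (inode nu) - p.[inode nu]) +
    \sum_nu (lag nu).[u] * (p.[inode nu] - g.[inode nu]) =
    \sum_nu (lag nu).[u] * f (inode nu) - g.[u].
  by rewrite ge -sumrB -big_split; apply: eq_bigr => nu _ /=; ring.
have -> : f u - \sum_nu (lag nu).[u] * f (inode nu) =
   (f u - p.[u]) + (p.[u] - g.[u]) -
   (\sum_nu (lag nu).[u] * (f (inode nu) - p.[inode nu]) +
    \sum_nu (lag nu).[u] * (p.[inode nu] - g.[inode nu])) by rewrite ef; ring.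
have h1 : cn (\sum_nu (lag nu).[u] * (f (inode nu) - p.[inode nu])) <= A * (e / (1 + A)).
  rewrite mulr_suml; apply: (le_trans (cn_sum _ _ _)); apply: ler_sum => nu _.
  by rewrite cnM ler_wpM2l ?cn_ge0// pe.
have h2 : cn (\sum_nu (lag nu).[u] * (p.[inode nu] - g.[inode nu])) <=
    4 * (L%:R * (L%:R ^+ L * L%:R ^+ L)) * (w / rho) ^+ L * (1 + s) ^+ L.
  apply: (le_trans (cn_sum _ _ _)).
  apply: (@le_trans _ _ (\sum_(nu < L) (L%:R * (1 + s)) ^+ L * (4 * (L%:R * w / rho) ^+ L))).
    apply: ler_sum => nu _; rewrite cnM; apply: ler_pM; rewrite ?cn_ge0//.
      exact: lag_bound.
    apply: (le_trans (dg _ (nr nu))); rewrite ler_pM2l//.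
    apply: lerXn2r; rewrite ?nnegrE ?divr_ge0 ?mulr_ge0 ?cn_ge0 ?(ltW rho0) ?(ltW w0)//.
    by rewrite ler_pM2r ?invr_gt0// cn_inode ler_pM2r// ler_nat ltnW.
  rewrite sumr_const card_ord -mulr_natl -!mulrA !exprMn le_eqVlt.
  by apply/orP; left; apply/eqP; ring.
have h3 : cn (f u - p.[u]) <= e / (1 + A) := pe u ur'.
have h4 : cn (p.[u] - g.[u]) <= 4 * (w / rho) ^+ L * (1 + s) ^+ L.
  apply: (le_trans (dg u ur)); rewrite -mulrA ler_pM2l// -exprMn.
  apply: lerXn2r; rewrite ?nnegrE; first by rewrite divr_ge0 ?cn_ge0 ?(ltW rho0).
    by rewrite mulr_ge0 ?divr_ge0 ?(ltW rho0) ?(ltW w0) ?addr_ge0.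
  have -> : cn u / rho = w / rho * s by rewrite /s; field; rewrite !gt_eqF.
  by rewrite ler_wpM2l ?divr_ge0 ?(ltW rho0) ?(ltW w0)// lerDr.
have eA : e / (1 + A) + A * (e / (1 + A)) = e by field; rewrite gt_eqF//; lra.
apply: (le_trans (cnB _ _)); apply: (le_trans (lerD (cnD _ _) (cnD _ _))).
rewrite /interp_cst -eA; move: h1 h2 h3 h4.
move: ((w / rho) ^+ L) ((1 + s) ^+ L) (L%:R * (L%:R ^+ L * L%:R ^+ L)) (A * (e / (1 + A))) (e / (1 + A)) => X Y Z a b.
clear; lra.
Qed.

End Interpolation.

(** * Normalised averages over the half circle *)

Definition avg (K : fieldType) Q (F : int -> K) : K := (2 * Q.*2.+1%:R)^-1 * isum Q F.

Section Average.
Variable R : realType.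
Implicit Types (F G : int -> R[i]) (f g : int -> R).

Lemma avg_coef_gt0 Q : 0 < (2 * Q.*2.+1%:R)^-1 :> R.
Proof. by rewrite invr_gt0 mulr_gt0. Qed.

Lemma cn_avg Q F : cn (avg Q F) <= avg Q (fun k => cn (F k)).
Proof.
rewrite /avg cnM cnV cnM !cn_nat ler_wpM2l ?(ltW (avg_coef_gt0 Q))//; exact: cn_isum.
Qed.

Lemma le_avg Q f g : (forall k, (absz k <= Q)%N -> f k <= g k) -> avg Q f <= avg Q g.
Proof. by move=> fg; rewrite /avg ler_wpM2l ?(ltW (avg_coef_gt0 Q))//; exact: le_isum. Qed.

Lemma avgD Q f g : avg Q (fun k => f k + g k) = avg Q f + avg Q g.
Proof. by rewrite /avg isumD mulrDr. Qed.

Lemma avgZl Q (c : R) f : avg Q (fun k => c * f k) = c * avg Q f.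
Proof. by rewrite /avg isumZl mulrCA. Qed.

Lemma avg_cst_le Q c : 0 <= c -> avg Q (fun=> c : R) <= c.
Proof.
move=> c0; rewrite /avg isum_const mulrA.
have N0 : (Q.*2.+1%:R : R) != 0 by rewrite pnatr_eq0.
have -> : (2 * Q.*2.+1%:R)^-1 * Q.*2.+1%:R = 2^-1 :> R by field.
by move: c0; clear; lra.
Qed.

End Average.

(** * Limits of the finite products at real points *)

Section Limit.
Variable R : realType.

Lemma uniform_rank (I : finType) (P : I -> nat -> Prop) :
  (forall j, exists M0, forall M, (M0 <= M)%N -> P j M) ->
  exists M0, forall M, (M0 <= M)%N -> forall j, P j M.
Proof.
move=> /choice[M0 H]; exists (\max_j M0 j)%N => M hM j; apply: H.
by apply: leq_trans hM; exact: leq_bigmax.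
Qed.

(** Identifies the interpolated function at a real node with a Gaussian transform: at one large T,
    both sides are close to th(q, t) / th(q, 0). *)
Lemma hprod_rho (q t e : R) : 0 < q < 1 -> 0 < e -> exists M0, forall M, (M0 <= M)%N ->
  cn ((rho q t)%:C - hprod M q%:C t) <= e.
Proof.
move=> q01 e0; have /andP[q0 q1] := q01; have e2 : 0 < e / 2 by lra.
have [M1 hM1] := hprod_le1 q01.
have [T0 hT0] := th_hprod q01 e2.
have := @rho_cvg _ _ q01 t => /cvgrPdist_le/(_ _ e2)[T1 _ hT1].
pose T := maxn T0 T1.
have [M2 hM2] := hT0 T (leq_maxl _ _).
exists (maxn M1 M2) => M; rewrite geq_max => /andP[MM1 MM2].
have cq : cn (q%:C : R[i]) <= q by rewrite cn_real gtr0_norm.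
have h1 : cn (hprod M q%:C t) <= 1.
  have := hM1 M 0 t MM1; rewrite addr0 mulr1 cn0; apply.
  by rewrite mulr_ge0 ?(ltW (rad_gt0 R))// subr_ge0 ltW.
have := hM2 M q%:C t MM2 cq h1.
have P0 : 0 < Th T q by apply: Th_gt0; exact: ltW.
rewrite th0 th_cth.
have hr : `|rho q t - cth q T t / Th T q| <= e / 2 by apply: hT1; exact: leq_maxr.
have -> : (rho q t)%:C - hprod M q%:C t =
    (rho q t - cth q T t / Th T q)%:C +
    ((cth q T t)%:C - (Th T q)%:C * hprod M q%:C t) / (Th T q)%:C.
  have T0' : (Th T q)%:C != 0 :> R[i] by rewrite (inj_eq (@complexI R)) gt_eqF.
  by rewrite rmorphB fmorph_div; field.
move=> h2; apply: (le_trans (cnD _ _)); rewrite cn_real cnM cnV cn_real (gtr0_norm P0).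
rewrite [leRHS]splitr; apply: lerD => //.
rewrite ler_pdivrMr//; apply: (le_trans h2).
by rewrite ler_peMr ?(ltW e2)//; apply: Th_ge1; exact: ltW.
Qed.

Lemma prod_hprod_rho d (q e : R) (xi : 'rV[R]_d) : 0 < q < 1 -> 0 < e ->
  exists M0, forall M, (M0 <= M)%N ->
  cn ((\prod_j rho q (xi 0 j))%:C - \prod_j hprod M q%:C (xi 0 j)) <= e.
Proof.
move=> q01 e0; have /andP[q0 q1] := q01.
have [M1 hM1] := hprod_le1 q01.
have e1 : 0 < e / d.+1%:R by rewrite divr_gt0.
have [M2 hM2] := uniform_rank (fun j : 'I_d => hprod_rho (xi 0 j) q01 e1).
exists (maxn M1 M2) => M; rewrite geq_max => /andP[MM1 MM2].
have r1 t : `|rho q t| <= 1.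
  have P0 T : 0 < Th T q by apply: Th_gt0; exact: ltW.
  have b T : `|cth q T t / Th T q| <= 1.
    rewrite normrM normfV (gtr0_norm (P0 T)) ler_pdivrMr// mul1r -cn_real -th_cth.
    by have := cn_thle T q%:C t; rewrite cn_real gtr0_norm.
  have /cvg_norm := @rho_cvg _ _ q01 t => h.
  by rewrite -(cvg_lim _ h)//; apply: limr_le; [exact: cvgP h|exact: nearW].
rewrite rmorph_prod/=; apply: (le_trans (cn_prodB (e := e / d.+1%:R) _ _ _)).
- by move=> j; rewrite cn_real.
- move=> j; have := hM1 M 0 (xi 0 j) MM1; rewrite addr0 mulr1 cn0; apply.
  by rewrite mulr_ge0 ?(ltW (rad_gt0 R))// subr_ge0 ltW.
- by move=> j; exact: hM2.
- by rewrite mulrCA ler_piMr ?(ltW e0)// ler_pdivrMr// mul1r ler_nat.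
Qed.

End Limit.

(** * Approximation of the half-circle average by Gaussian transforms *)

Section HalfMean.
Variables (R : realType) (d n T : nat) (q : R) (Q : nat) (xi : 'rV[R]_d).

Definition ratio_prod (k : int) : R[i] := \prod_j nth_ratio T q (node R Q k) (xi 0 j).

Definition half_mean : R[i] :=
  avg Q (fun k : int => ce (- (node R Q k * n%:R)) * ratio_prod k).

End HalfMean.

Section MajorArc.
Variable R : realType.
Variables (d n T L : nat) (q : R).
Hypothesis adm : admissible d n T q.
Let D := minn n d.
Hypothesis D_large : 2 * L%:R <= rad R * Num.sqrt D%:R.

Let q01 := adm_q adm.
Let q0 : 0 < q. Proof. by case/andP: q01. Qed.
Let y0 : 0 < 1 - q. Proof. by case/andP: q01 => _ h; rewrite subr_gt0. Qed.
Let Th0 : 0 < Th T q. Proof. exact/Th_gt0/ltW. Qed.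
Let D1 : (0 < D)%N.
Proof. by rewrite leq_min (adm_d adm) andbT; have /andP[] := adm_n adm. Qed.
Let D0 : (0 : R) < D%:R. Proof. by rewrite ltr0n. Qed.
Let r0 : 0 < Num.sqrt D%:R :> R. Proof. by rewrite sqrtr_gt0. Qed.
Let rE : Num.sqrt D%:R ^+ 2 = D%:R :> R. Proof. by rewrite sqr_sqrtr// ltW. Qed.
Let rad0 := rad_gt0 R.
Let w : R := width D q.
Let w0 : 0 < w. Proof. exact: divr_gt0. Qed.
Let rr : R := rad R * (1 - q).
Let rr0 : 0 < rr. Proof. exact: mulr_gt0. Qed.

Let w_rr : w / rr = (rad R * Num.sqrt D%:R)^-1.
Proof.
by rewrite /w /width /rr; field; rewrite !gt_eqF.
Qed.

Let Lw_rr : 2 * (L%:R * w) <= rr.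
Proof.
rewrite mulrA -ler_pdivlMr//; apply: (le_trans D_large).
by rewrite -[rr / w]invf_div w_rr invrK.
Qed.

Definition gridpt (nu : 'I_L) : R := q * (1 - nu%:R * width D q).

Lemma gridptE nu : (gridpt nu)%:C = q%:C * (1 + inode w nu).
Proof. by rewrite /gridpt /inode rmorphM rmorphB rmorph1 rmorphN. Qed.

Lemma gridpt_itv nu : 0 < gridpt nu < 1.
Proof.
have nL : nu%:R * w <= L%:R * w by rewrite ler_pM2r// ler_nat ltnW.
have n0 : 0 <= nu%:R * w by rewrite mulr_ge0// ltW.
have rr1 : rr <= 1.
  by rewrite /rr mulr_ile1 ?(ltW rad0) ?(ltW y0)//; [have := rad_small R|]; move: q0; lra.
have := Lw_rr; rewrite /gridpt -/w => h.
have b1 : 0 < 1 - nu%:R * w by move: nL h rr1; lra.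
rewrite mulr_gt0//=; apply: (@le_lt_trans _ _ q).
  by rewrite ler_piMr ?(ltW q0)//; move: n0; lra.
by case/andP: q01.
Qed.

Definition dev Q k : R[i] := ce (node R Q k) - 1.
Definition major Q k : bool := 2 * `|node R Q k| <= rad R * (1 - q).

(** All that multiplies the value at node nu in the interpolant. It is free of [xi], so its average
    [wcoef] is the coefficient of a Gaussian transform, up to normalisation. It is set to 0 off the
    major arc, where the interpolation is not controlled. *)
Definition wgt Q (nu : 'I_L) k : R[i] := if major Q k then
  ce (- (node R Q k * n%:R)) * nth_ratio T q (node R Q k) 0 ^+ d * (lag (width D q) nu).[dev Q k]
  else 0.

Definition wcoef Q nu : R[i] := avg Q (wgt Q nu).

(** The growth (1 + s)^L of the Lagrange basis against the Gaussian decay. The 2 comes from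
    [major_ratio]: on the major arc s^2 <= D, so the first exponential of [th_pow_le] dominates the
    second. *)
Definition gprof (s : R) : R := 2 * ((1 + s) ^+ L * expR (- (rate R * s ^+ 2))).

Let s_ Q k : R := `|node R Q k| / w.

Let s_ge0 Q k : 0 <= s_ Q k. Proof. by rewrite divr_ge0// ltW. Qed.

Let gprof_ge0 (s : R) : 0 <= s -> 0 <= gprof s.
Proof.
move=> s0; rewrite mulr_ge0// mulr_ge0 ?expR_ge0// exprn_ge0// addr_ge0//.
Qed.

Lemma major_ratio Q k : (absz k <= Q)%N -> major Q k ->
  cn (nth_ratio T q (node R Q k) 0) ^+ d <= 2 * expR (- (rate R * s_ Q k ^+ 2)).
Proof.
move=> kQ mk; rewrite cn_nth_ratio ?(ltW q0)//.
apply: (le_trans (th_pow_le adm 0 (node_le R kQ))); rewrite -/D -/w -/(s_ Q k).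
rewrite mulr_natl mulr2n lerD2l ler_expR lerN2 ler_pM2l ?rate_gt0// -rE.
apply: lerXn2r; rewrite ?nnegrE ?s_ge0 ?(ltW r0)//.
rewrite /s_ ler_pdivrMr// /w /width mulrCA mulfV ?gt_eqF// mulr1.
move: mk; rewrite /major; have := rad_small R.
have : rad R * (1 - q) <= 1 * (1 - q).
  by rewrite ler_pM2r//; have := rad_small R; lra.
have := normr_ge0 (node R Q k); move: y0; lra.
Qed.

Let cn_dev Q k : cn (dev Q k) / w <= s_ Q k.
Proof. by rewrite ler_pM2r ?invr_gt0//; exact: cn_ceB1. Qed.

Let pow_dev Q k : (1 + cn (dev Q k) / w) ^+ L <= (1 + s_ Q k) ^+ L.
Proof.
apply: lerXn2r; rewrite ?nnegrE; [|by apply: addr_ge0 => //; exact: s_ge0|by rewrite lerD2l cn_dev].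
by rewrite addr_ge0// divr_ge0 ?cn_ge0 ?(ltW w0).
Qed.

Lemma lag_dev Q (nu : 'I_L) k : cn (lag w nu).[dev Q k] <= L%:R ^+ L * (1 + s_ Q k) ^+ L.
Proof.
apply: (le_trans (lag_bound w0 nu _)); rewrite exprMn ler_wpM2l ?exprn_ge0//; exact: pow_dev.
Qed.

Lemma wgt_bound Q nu k : (absz k <= Q)%N -> cn (wgt Q nu k) <= L%:R ^+ L * gprof (s_ Q k).
Proof.
move=> kQ; rewrite /wgt; case: ifPn => mk; last first.
  by rewrite cn0 mulr_ge0 ?exprn_ge0// gprof_ge0.
rewrite !cnM cn_ce mul1r cnX /gprof.
have -> : L%:R ^+ L * (2 * ((1 + s_ Q k) ^+ L * expR (- (rate R * s_ Q k ^+ 2)))) =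
  (2 * expR (- (rate R * s_ Q k ^+ 2))) * (L%:R ^+ L * (1 + s_ Q k) ^+ L) by ring.
by apply: ler_pM; rewrite ?exprn_ge0 ?cn_ge0 ?major_ratio//; exact: lag_dev.
Qed.

Lemma wcoef_bound Q nu (G : R) : 0 <= G -> (forall s : R, 0 <= s -> gprof s * (1 + s) ^+ 2 <= G) ->
  mesh R Q <= w -> cn (wcoef Q nu) <= L%:R ^+ L * (w * G).
Proof.
move=> G0 hG mw; apply: (le_trans (cn_avg _ _)).
apply: (le_trans (le_avg (fun k => @wgt_bound Q nu k))).
rewrite avgZl ler_wpM2l ?exprn_ge0//.
by apply: (avg_bound (D := D)) => //; case/andP: q01.
Qed.

Variables (eps : R) (xi : 'rV[R]_d).
Hypothesis eps0 : 0 <= eps.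
Hypothesis th_eps : exists M0, forall M z t, (M0 <= M)%N -> cn z <= q ->
  cn (hprod M z t) <= 1 -> cn (th T z t - th T z 0 * hprod M z t) <= eps.

(** On the minor arcs s exceeds rad sqrt D / 2. *)
Definition minor_rate : R := rate R * (rad R ^+ 2 / 4).

Let prat Q k : R[i] := ratio_prod T q Q xi k.
Let limF nu : R[i] := fourier_gauss (gridpt nu) xi.

(** [th_pow_le] bounds the d-th power of each of the d factors by the same B, so the d-th power of
    their product is at most B^d. *)
Lemma minor_bound Q k : (absz k <= Q)%N -> ~~ major Q k ->
  cn (prat Q k) <= 2 * expR (- (minor_rate * D%:R)).
Proof.
move=> kQ; rewrite /major -ltNge => mk.
set B := 2 * _; have B0 : 0 < B by rewrite mulr_gt0 ?expR_gt0.
have dn := adm_d adm.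
have rB j : cn (nth_ratio T q (node R Q k) (xi 0 j)) ^+ d <= B.
  rewrite cn_nth_ratio ?(ltW q0)//.
  apply: (le_trans (th_pow_le adm (xi 0 j) (node_le R kQ))); rewrite -/D -/w -/(s_ Q k).
  rewrite /B mulr_natl mulr2n /minor_rate -mulrA; apply: lerD; rewrite ler_expR lerN2 ler_pM2l ?rate_gt0//.
    have -> : rad R ^+ 2 / 4 * D%:R = (rad R * Num.sqrt D%:R / 2) ^+ 2.
      by rewrite expr_div_n exprMn rE; field.
    apply: lerXn2r; rewrite ?nnegrE ?s_ge0 ?divr_ge0 ?mulr_ge0 ?(ltW r0) ?(ltW rad0)//.
    rewrite /s_ ler_pdivlMr// /w /width.
    have -> : rad R * Num.sqrt D%:R / 2 * ((1 - q) / Num.sqrt D%:R) = rad R * (1 - q) / 2.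
      by field; rewrite gt_eqF.
    by move: mk; lra.
  have a1 : rad R ^+ 2 <= 1.
    by rewrite exprn_ile1 ?(ltW rad0)//; have := rad_small R; lra.
  by rewrite ler_piMl ?(ltW D0)//; move: a1; lra.
rewrite -(ler_pXn2r dn) ?nnegrE ?cn_ge0 ?(ltW B0)// /prat cn_prod -prodrXl.
apply: (@le_trans _ _ (\prod_(j < d) B)); last by rewrite prodr_const card_ord.
by apply: ler_prod => j _; rewrite exprn_ge0 ?cn_ge0//=.
Qed.

Let interp_ge0 : 0 <= interp_cst R L * (w / rr) ^+ L.
Proof.
have h : 0 <= w / rr by apply: divr_ge0; exact: ltW.
by rewrite mulr_ge0 ?exprn_ge0// /interp_cst mulr_ge0// addr_ge0.
Qed.

(** Three replacements: theta quotients by finite products ([eps] for each of d factors), their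
    product by its interpolant, and the values at the nodes by Gaussian transforms ([eta]). The last
    two carry the d-th power of the ratio at t = 0, hence [gprof]. *)
Lemma major_bound eta : 0 < eta -> forall Q k, (absz k <= Q)%N -> major Q k ->
  cn (prat Q k - nth_ratio T q (node R Q k) 0 ^+ d *
        \sum_(nu < L) (lag w nu).[dev Q k] * limF nu) <=
  d%:R * eps + (interp_cst R L * (w / rr) ^+ L + L%:R * L%:R ^+ L * eta) * gprof (s_ Q k).
Proof.
move=> eta0 Q k kQ mk.
have [M1 hM1] := th_eps; have [M2 hM2] := hprod_le1 q01.
have [M3 hM3] := uniform_rank (fun nu : 'I_L => prod_hprod_rho xi (gridpt_itv nu) eta0).
pose M := maxn M1 (maxn M2 M3).
have m1 : (M1 <= M)%N by exact: leq_maxl.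
have m2 : (M2 <= M)%N by rewrite !leq_max leqnn orbT.
have m3 : (M3 <= M)%N by rewrite !leq_max leqnn !orbT.
pose f u := \prod_j hprod M (q%:C * (1 + u)) (xi 0 j) : R[i].
have hle u t : cn u <= rr -> cn (hprod M (q%:C * (1 + u)) t) <= 1 by exact: hM2.
have f1 u : cn u <= rr -> cn (f u) <= 1.
  by move=> ur; apply: cn_prod_le1 => j _; exact: hle.
have fa : papprox rr f.
  apply: papprox_prod => // j; apply: hprod_papprox => //.
  by rewrite /rr; have := rad_small R; have := y0; nra.
have zE : q%:C * ce (node R Q k) = q%:C * (1 + dev Q k) by rewrite /dev addrC subrK.
have uk : 2 * cn (dev Q k) <= rr.
  by apply: le_trans mk; rewrite ler_pM2l//; exact: cn_ceB1.
have uk' : cn (dev Q k) <= rr by have := cn_ge0 (dev Q k); move: uk; lra.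
set chi := nth_ratio T q (node R Q k) 0.
have chi1 : cn chi <= 1 by exact: cn_nth_ratio_le1 (ltW q0).
have h1 : cn (prat Q k - chi ^+ d * f (dev Q k)) <= d%:R * eps.
  have -> : chi ^+ d * f (dev Q k) = \prod_j (chi * hprod M (q%:C * (1 + dev Q k)) (xi 0 j)).
    by rewrite big_split/= prodr_const card_ord.
  apply: cn_prodB => j; first exact: cn_nth_ratio_le1 (ltW q0).
    by rewrite cnM mulr_ile1 ?cn_ge0 ?hle.
  have T1 : 1 <= Th T q by apply: Th_ge1; exact: ltW.
  have := hM1 M (q%:C * (1 + dev Q k)) (xi 0 j) m1.
  rewrite -zE cnM cn_ce mulr1 cn_real (gtr0_norm q0) lexx => /(_ isT).
  rewrite zE => /(_ (hle _ _ uk')) h.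
  have -> : nth_ratio T q (node R Q k) (xi 0 j) - chi * hprod M (q%:C * (1 + dev Q k)) (xi 0 j) =
     (th T (q%:C * (1 + dev Q k)) (xi 0 j) - th T (q%:C * (1 + dev Q k)) 0 *
       hprod M (q%:C * (1 + dev Q k)) (xi 0 j)) / (Th T q)%:C.
    by rewrite /chi /nth_ratio zE; ring.
  rewrite cnM cnV cn_real (gtr0_norm Th0) ler_pdivrMr//; apply: (le_trans h).
  by rewrite ler_peMr.
have h2 : cn (f (dev Q k) - \sum_(nu < L) (lag w nu).[dev Q k] * f (inode w nu)) <=
    interp_cst R L * (w / rr) ^+ L * (1 + s_ Q k) ^+ L.
  apply: (le_trans (interp_bound w0 rr0 fa f1 Lw_rr uk)).
  by rewrite ler_wpM2l ?pow_dev// interp_ge0.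
have h3 : cn (\sum_(nu < L) (lag w nu).[dev Q k] * f (inode w nu) -
              \sum_(nu < L) (lag w nu).[dev Q k] * limF nu) <= L%:R * L%:R ^+ L * eta * (1 + s_ Q k) ^+ L.
  rewrite -sumrB; apply: (le_trans (cn_sum _ _ _)).
  apply: (@le_trans _ _ (\sum_(nu < L) L%:R ^+ L * (1 + s_ Q k) ^+ L * eta)).
    apply: ler_sum => nu _; rewrite -mulrBr cnM; apply: ler_pM; rewrite ?cn_ge0 ?lag_dev//.
    by rewrite cnBC /f /limF fourier_gaussE ?gridpt_itv// -gridptE; exact: hM3.
  rewrite sumr_const card_ord -mulr_natl le_eqVlt; apply/orP; left; apply/eqP; ring.
have E (a c b s1 s2 : R[i]) : a - c * s2 = (a - c * b) + c * ((b - s1) + (s1 - s2)) by ring.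
rewrite (E _ _ (f (dev Q k)) (\sum_(nu < L) (lag w nu).[dev Q k] * f (inode w nu))).
apply: (le_trans (cnD _ _)); apply: lerD => //; rewrite cnM cnX.
set X := interp_cst R L * _ in h2 *; set Y := L%:R * _ * _ in h3 *.
have -> : (X + Y) * gprof (s_ Q k) = (2 * expR (- (rate R * s_ Q k ^+ 2))) *
   (X * (1 + s_ Q k) ^+ L + Y * (1 + s_ Q k) ^+ L) by rewrite /gprof; ring.
apply: ler_pM; rewrite ?exprn_ge0 ?cn_ge0 ?major_ratio//.
by apply: (le_trans (cnD _ _)); exact: lerD.
Qed.

(** Averaging [gprof] gives the factor w. The error [eta] at the nodes is arbitrary, while the
    coefficients do not depend on it, so it disappears from the bound. *)
Lemma half_approx Q (G : R) : 0 <= G -> (forall s : R, 0 <= s -> gprof s * (1 + s) ^+ 2 <= G) ->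
  mesh R Q <= w ->
  cn (half_mean n T q Q xi - \sum_nu wcoef Q nu * fourier_gauss (gridpt nu) xi) <=
  d%:R * eps + 2 * expR (- (minor_rate * D%:R)) +
    w * G * interp_cst R L * (rad R * Num.sqrt D%:R) ^- L.
Proof.
move=> G0 hG mw; rewrite /half_mean; apply/ler_addgt0Pr => eta' eta'0.
pose A : R := L%:R * L%:R ^+ L * (w * G) + 1.
have A0 : 0 < A by rewrite ltr_wpDl// !mulr_ge0// ?exprn_ge0// ltW.
pose eta := eta' / A; have eta0 : 0 < eta by rewrite divr_gt0.
have -> : avg Q (fun k => ce (- (node R Q k * n%:R)) * ratio_prod T q Q xi k) - \sum_nu wcoef Q nu * limF nu =
  avg Q (fun k => ce (- (node R Q k * n%:R)) * prat Q k - \sum_nu wgt Q nu k * limF nu).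
  rewrite /avg isumB mulrBr isum_exch mulr_sumr; congr (_ - _).
  by apply: eq_bigr => nu _; rewrite isumZr mulrA.
apply: (le_trans (cn_avg _ _)).
set X := interp_cst R L * (w / rr) ^+ L; set Y := L%:R * L%:R ^+ L * eta.
have X0 : 0 <= X by exact: interp_ge0.
have Y0 : 0 <= Y by apply: mulr_ge0; [rewrite mulr_ge0 ?exprn_ge0|exact: ltW].
pose c : R := d%:R * eps + 2 * expR (- (minor_rate * D%:R)).
have c0 : 0 <= c by rewrite addr_ge0 ?mulr_ge0 ?expR_ge0.
apply: (@le_trans _ _ (avg Q (fun k => c + (X + Y) * gprof (s_ Q k)))).
  apply: le_avg => k kQ.
  have g0 : 0 <= (X + Y) * gprof (s_ Q k) by rewrite mulr_ge0 ?addr_ge0 ?gprof_ge0.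
  have e0 : 0 <= d%:R * eps by rewrite mulr_ge0.
  have x0 : 0 <= 2 * expR (- (minor_rate * D%:R)) by rewrite mulr_ge0 ?expR_ge0.
  case: (boolP (major Q k)) => mk; last first.
    rewrite big1; last by move=> nu _; rewrite /wgt (negbTE mk) mul0r.
    rewrite subr0 cnM cn_ce mul1r; apply: (le_trans (minor_bound kQ mk)).
    by rewrite /c; move: g0 e0; lra.
  rewrite (eq_bigr (fun nu => ce (- (node R Q k * n%:R)) * (nth_ratio T q (node R Q k) 0 ^+ d *
    ((lag w nu).[dev Q k] * limF nu)))); last by move=> nu _; rewrite /wgt mk -!mulrA.
  rewrite -mulr_sumr -mulr_sumr -mulrBr cnM cn_ce mul1r.
  apply: (le_trans (major_bound eta0 kQ mk)); rewrite -/X -/Y.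
  by rewrite /c; move: x0; lra.
rewrite avgD avgZl -addrA; apply: lerD; first exact: avg_cst_le.
apply: (@le_trans _ _ ((X + Y) * (w * G))).
  rewrite ler_wpM2l ?addr_ge0//.
  by apply: (avg_bound (D := D)) => //; case/andP: q01.
have -> : w * G * interp_cst R L * (rad R * Num.sqrt D%:R) ^- L = X * (w * G).
  by rewrite /X w_rr exprVn; ring.
rewrite mulrDl lerD2l.
have -> : Y * (w * G) = (A - 1) * (eta' / A) by rewrite /Y /A /eta; ring.
rewrite mulrA ler_pdivrMr// mulrC ler_pM2l//; move: A0; lra.
Qed.

End MajorArc.

(** * Choice of the parameters and conclusion *)

Section Assembly.
Variable R : realType.

Lemma sphsum_le d n : exists2 a : R, 0 <= a &
  @sphsum R d n 0 = a%:C /\ forall xi : 'rV[R]_d, cn (sphsum n xi) <= a.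
Proof.
exists (\sum_(f : {ffun 'I_d -> 'I_n.*2.+1} | nsq (boxpt f) == n) 1); first exact: sumr_ge0.
split=> [|xi]; rewrite (@sphsumE _ _ n)//.
  by rewrite rmorph_sum/=; apply: eq_bigr => f _; rewrite expi2pi0.
apply: (le_trans (cn_sum _ _ _)); apply: ler_sum => f _.
by rewrite expi2piE; apply: cn_prod_le1 => j _; rewrite cn_ce.
Qed.

Lemma cn_sphere_mean d n (xi : 'rV[R]_d) : cn (sphere_mean n xi) <= 1.
Proof.
have [a a0 [aE h]] := @sphsum_le d n; rewrite sphere_meanE aE cnM cnV cn_real ger0_norm//.
(* For an empty sphere the mean is 0, as 0^-1 = 0. *)
by move: a0; rewrite le_eqVlt => /predU1P[<-|a1]; [rewrite invr0 mulr0|rewrite ler_pdivrMr// mul1r].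
Qed.

(** The point q depends on T, whereas the rank of [th_hprod] depends on a bound for q. [gap_le]
    breaks the circle: it yields q <= r with r computed from n / d before T is chosen. *)
Lemma params_exist d n (e : R) : (0 < d)%N -> (0 < n <= d ^ 4)%N -> 0 < e ->
  exists T q, [/\ admissible d n T q, (n <= T)%N &
    exists M0, forall M z t, (M0 <= M)%N -> cn z <= q ->
      cn (hprod M z t) <= 1 -> cn (th T z t - th T z 0 * hprod M z t) <= e].
Proof.
move=> d0 nd e0; have /andP[n0 n4] := nd.
pose m : R := n%:R / d%:R.
have m0 : 0 < m by rewrite divr_gt0 ?ltr0n.
have g0 := gap_cst_gt0 R.
pose Y : R := 4 / gap_cst R * Num.max 1 m.
have Y0 : 0 < Y by rewrite mulr_gt0 ?divr_gt0// lt_max ltr01.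
pose r : R := Num.max 2^-1 (1 - Y^-1).
have Yi : 0 < Y^-1 by rewrite invr_gt0.
have r01 : 0 < r < 1.
  rewrite lt_max invr_gt0 ltr0n/= gt_max; apply/andP; split; last by move: Yi; clear; lra.
  by rewrite invf_lt1// ltr1n.
have [T0 hT0] := th_hprod r01 e0.
(* The three summands serve [mean_exists], [adm_gap] and [adm_T4], in this order; Y is an upper
   bound for 1 / (1 - q). *)
pose X : R := 9 * m + m / gap_cst R + 4 * Y.
have mg : 0 < m / gap_cst R by rewrite divr_gt0.
have X0 : 0 <= X by move: mg m0 Y0; rewrite /X; clear; lra.
pose T := (T0 + n + Num.bound X)%N.
have T1 : (0 < T)%N by rewrite /T; move: n0; clear; lia.
have XT : X < T%:R ^+ 2.
  apply: (lt_le_trans (archi_boundP X0)).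
  rewrite -natrX ler_nat; apply: (@leq_trans T); first by rewrite /T leq_addl.
  by rewrite -{1}[T]expn1 leq_pexp2l.
have T9 : 9 * m < T%:R ^+ 2 by move: XT mg Y0; rewrite /X; clear; lra.
have Tg : m < gap_cst R * T%:R ^+ 2.
  rewrite mulrC -ltr_pdivrMr//; move: XT m0 Y0; rewrite /X; clear; lra.
have TY : 4 * Y <= T%:R ^+ 2 by move: XT mg m0; rewrite /X; clear; lra.
have [q q01 mq] := mean_exists T1 m0 T9.
have yq := gap_le T1 q01 mq Tg.
have /andP[q0 q1] := q01; have y0 : 0 < 1 - q by rewrite subr_gt0.
exists T, q; split.
- split=> //; apply: (le_trans _ (ler_wpM2r (ltW y0) TY)).
  rewrite -mulrA ler_peMr// -ler_pdivrMr// mul1r; exact: yq.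
- by rewrite /T; clear; lia.
have T0T : (T0 <= T)%N by rewrite /T -addnA leq_addr.
have [M0 hM0] := hT0 T T0T.
exists M0 => M z t MM zq; apply: hM0 => //; apply: (le_trans zq).
rewrite le_max; apply/orP; right.
have : Y^-1 <= 1 - q by rewrite -[leRHS]invrK lef_pV2 ?posrE ?invr_gt0.
by clear; lra.
Qed.

Lemma half_mean_sphsum d n T (q : R) Q (xi : 'rV[R]_d) : (0 < d)%N -> 0 < q < 1 ->
  (0 < T)%N -> (n <= T)%N -> (d * T ^ 2 < 2 * Q.*2.+1)%N ->
  half_mean n T q Q xi + (- 1) ^+ n * half_mean n T q Q (xi - halfv R d) =
  (q ^+ n / Th T q ^+ d)%:C * sphsum n xi.
Proof.
move=> d0 /andP[q0 q1] T0 nT TQ.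
have Th0 : 0 < Th T q by apply: Th_gt0; exact: ltW.
have nT2 : (n <= d * T ^ 2)%N.
  apply: (leq_trans nT); rewrite -{1}[T]expn1; apply: (@leq_trans (T ^ 2)).
    by rewrite leq_pexp2l.
  by rewrite leq_pmull.
have rE (eta : 'rV[R]_d) k : ratio_prod T q Q eta k = genf T (q%:C * ce (node R Q k)) eta / (Th T q ^+ d)%:C.
  by rewrite /ratio_prod /nth_ratio /genf prodf_div prodr_const card_ord rmorphXn.
have -> : (q ^+ n / Th T q ^+ d)%:C * sphsum n xi =
    (q ^+ n)%:C * sphsum n xi / (Th T q ^+ d)%:C.
  by rewrite fmorph_div mulrAC.
rewrite -(sphere_filter q xi nT nT2 TQ) /half_mean /avg -mulrA -isumZr mulrCA -mulrDr.
rewrite -isumZl -isumD; congr (_ * _); apply: eq_isum => k _.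
by rewrite !rE; ring.
Qed.

(** The link to [local_limit]: together with [half_mean_sphsum] at xi = 0 it bounds below the
    quantity by which everything is divided. *)
Lemma half_mean0 d n T (q : R) Q :
  half_mean n T q Q (0 : 'rV[R]_d) + (- 1) ^+ n * half_mean n T q Q (0 - halfv R d) =
  avg Q (fun k => kernel d n T q (node R Q k)).
Proof.
have rc t k : ratio_prod T q Q (const_mx t : 'rV_d) k = nth_ratio T q (node R Q k) t ^+ d.
  rewrite /ratio_prod (eq_bigr (fun=> nth_ratio T q (node R Q k) t)) => [|j _].
    by rewrite prodr_const card_ord.
  by rewrite mxE.
have e0 : 0 = const_mx 0 :> 'rV[R]_d by apply/rowP => j; rewrite !mxE.
have eh : 0 - halfv R d = const_mx (- 2^-1) :> 'rV[R]_d.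
  by apply/rowP => j; rewrite !mxE sub0r.
rewrite eh {1}e0 /half_mean /avg mulrCA -mulrDr -isumZl -isumD; congr (_ * _).
by apply: eq_isum => k _; rewrite !rc /kernel; ring.
Qed.

Lemma width_inv_le d n T (q : R) : admissible d n T q ->
  (width (minn n d) q)^-1 <= 4 / gap_cst R * (minn n d)%:R ^+ 4.
Proof.
move=> adm; have /andP[q0 q1] := adm_q adm.
have D1 : (0 < minn n d)%N by rewrite leq_min (adm_d adm) andbT; have /andP[] := adm_n adm.
have sD : Num.sqrt (minn n d)%:R <= (minn n d)%:R :> R.
  rewrite -{2}[(minn n d)%:R]sqr_sqrtr// expr2 ler_peMl ?sqrtr_ge0//.
  by rewrite -{1}sqrtr1 ler_sqrt ?ler1n.
rewrite /width invf_div mulrC (exprSr _ 3) mulrA; apply: ler_pM.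
- by rewrite invr_ge0 subr_ge0 ltW.
- exact: sqrtr_ge0.
- exact: adm_gap_le adm.
- exact: sD.
Qed.

Lemma cn_sign n : cn ((- 1) ^+ n : R[i]) = 1.
Proof. by rewrite cnX cnN cn1 expr1n. Qed.

(** With L = 2 N nodes the interpolation error (rad sqrt D)^(-L) is of order D^(-N). Errors and
    coefficients are of order w before division by p >= c w, hence of order D^(-N) and 1 after
    it. *)
Lemma gauss_approx N : exists K C, 0 <= C /\ forall d n, (0 < d)%N -> (0 < n <= d ^ 4)%N ->
  (K <= minn n d)%N -> exists (alpha : 'I_(2 * N) -> R[i]) (r : 'I_(2 * N) -> R),
  [/\ forall nu, 0 < r nu < 1, \sum_nu cn (alpha nu) <= C &
    forall xi : 'rV[R]_d,
      cn (sphere_mean n xi - \sum_nu alpha nu * fourier_gauss (r nu) xi -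
          \sum_nu (- 1) ^+ n * alpha nu * fourier_gauss (r nu) (xi - halfv R d)) <=
      C * (minn n d)%:R ^- N].
Proof.
have [c c0 [K0 hK0]] := local_limit R.
pose L := (2 * N)%N.
have [G0 G00 hG0] := powgauss_le (L + 2) (rate_gt0 R).
pose G := 2 * G0; have G_ge0 : 0 <= G by rewrite mulr_ge0// ltW.
have hG s : 0 <= s -> gprof L s * (1 + s) ^+ 2 <= G.
  move=> s0; rewrite /G /gprof -mulrA ler_pM2l//; have := hG0 s s0.
  by rewrite exprD mulrAC.
have mr0 : 0 < minor_rate R.
  by rewrite /minor_rate mulr_gt0 ?rate_gt0// divr_gt0// exprn_gt0// rad_gt0.
(* D^4 pays for 1 / w and D^N for the required decay. *)
have [K1 hK1] := pow_expR_small (4 + N) mr0 (@ltr01 R).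
have rad0 := rad_gt0 R; have g0 := gap_cst_gt0 R.
pose K2 := Num.bound ((2 * L%:R / rad R) ^+ 2).
(* 12 = 3 * 4: three exponentials, one from d eps and two from the minor arcs, each at most w (4 /
   gap_cst) D^(-N). *)
pose B : R := 12 / gap_cst R + G * interp_cst R L * (rad R ^+ 2) ^- N.
have I0 : 0 <= interp_cst R L by rewrite /interp_cst mulr_ge0// addr_ge0.
have B0 : 0 <= B.
  apply: addr_ge0; first by rewrite divr_ge0// ltW.
  by apply: mulr_ge0; [exact: mulr_ge0|rewrite invr_ge0 exprn_ge0 ?sqr_ge0].
pose A : R := L%:R * (L%:R ^+ L * G) / c.
have A0 : 0 <= A.
  by apply: divr_ge0 (ltW c0); apply: mulr_ge0 => //; rewrite mulr_ge0 ?exprn_ge0.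
have B2 : 0 <= 2 * B / c by apply: divr_ge0 (ltW c0); exact: mulr_ge0.
exists (maxn K0 (maxn K1 K2)), (A + 2 * B / c); split; first exact: addr_ge0.
move=> d n d0 nd; rewrite !geq_max => /and3P[DK0 DK1 DK2].
have /andP[n0 n4] := nd; set D := minn n d in DK0 DK1 DK2 *.
have D1 : (0 < D)%N by rewrite leq_min n0 d0.
have D0 : (0 : R) < D%:R by rewrite ltr0n.
(* Divided by d because [major_bound] pays [eps] once per coordinate. *)
pose eps : R := expR (- (minor_rate R * D%:R)) / d%:R.
have eps0 : 0 < eps by rewrite divr_gt0 ?expR_gt0 ?ltr0n.
have [T [q [adm nT hT]]] := params_exist d0 nd eps0.
have /andP[q0 q1] := adm_q adm; have T0 := adm_T adm.
have w0 : 0 < width D q by rewrite divr_gt0 ?sqrtr_gt0// subr_gt0.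
have DL : 2 * L%:R <= rad R * Num.sqrt D%:R.
  rewrite [rad R * _]mulrC -ler_pdivrMr//.
  apply: (@le_trans _ _ (Num.sqrt ((2 * L%:R / rad R) ^+ 2))).
    by rewrite sqrtr_sqr ler_norm.
  rewrite ler_sqrt//; apply: ltW; apply: lt_le_trans (archi_boundP (sqr_ge0 _)) _.
  by rewrite ler_nat.
have [Q0 hQ0] := hK0 d n T q adm DK0.
have [Q1 hQ1] := mesh_small w0.
pose Q := (Q0 + Q1 + d * T ^ 2)%N.
have mw : mesh R Q <= width D q by apply: hQ1; rewrite /Q; clear; lia.
have TQ : (d * T ^ 2 < 2 * Q.*2.+1)%N by rewrite /Q; clear; lia.
have := hQ0 Q; rewrite /Q -addnA leq_addr addnA -/Q => /(_ isT).
have [a a0 [aE ha]] := @sphsum_le d n.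
pose h : R := q ^+ n / Th T q ^+ d.
have Th0 : 0 < Th T q by apply: Th_gt0; exact: ltW.
have h0 : 0 < h by rewrite divr_gt0 ?exprn_gt0.
have sphE xi := half_mean_sphsum xi d0 (adm_q adm) T0 nT TQ.
have -> : (2 * Q.*2.+1%:R)^-1%:C * isum Q (fun k => kernel d n T q (node R Q k)) = (h * a)%:C.
  rewrite (_ : (_^-1)%:C = (2 * Q.*2.+1%:R)^-1); last by rewrite fmorphV rmorphM !rmorph_nat.
  by rewrite -/(avg _ _) -half_mean0 sphE aE -rmorphM.
rewrite -/D => /= pw; set p := h * a in pw.
have p0 : 0 < p by apply: lt_le_trans pw; exact: mulr_gt0.
have a1 : 0 < a by move: p0; rewrite pmulr_rgt0.
have pC : p%:C != 0 :> R[i] by rewrite (inj_eq (@complexI R)) gt_eqF.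
have pwi : p^-1 <= (c * width D q)^-1 by rewrite lef_pV2 ?posrE// mulr_gt0.
pose W (nu : 'I_L) : R[i] := wcoef d n T q Q nu.
exists (fun nu => W nu / p%:C), (fun nu : 'I_L => gridpt d n q nu); split.
- by move=> nu; exact: gridpt_itv adm DL nu.
- apply: (@le_trans _ _ A); last by rewrite lerDl.
  apply: (@le_trans _ _ (\sum_(nu < L) (L%:R ^+ L * G / c))).
    apply: ler_sum => nu _; rewrite cnM cnV cn_real (gtr0_norm p0).
    have -> : L%:R ^+ L * G / c = L%:R ^+ L * (width D q * G) * (c * width D q)^-1.
      by field; rewrite !gt_eqF.
    apply: ler_pM; rewrite ?cn_ge0 ?invr_ge0 ?(ltW p0)//.
    exact: (@wcoef_bound R d n T L q adm Q nu G G_ge0 hG mw).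
  by rewrite sumr_const card_ord -/L -[leLHS]mulr_natl /A !mulrA.
move=> xi.
pose S (eta : 'rV[R]_d) := \sum_nu W nu * fourier_gauss (gridpt d n q nu) eta : R[i].
have Sp eta : \sum_nu W nu / p%:C * fourier_gauss (gridpt d n q nu) eta = S eta / p%:C.
  by rewrite /S mulr_suml; apply: eq_bigr => nu _; rewrite mulrAC.
have Sp' eta : \sum_nu (- 1) ^+ n * (W nu / p%:C) * fourier_gauss (gridpt d n q nu) eta =
    (- 1) ^+ n * S eta / p%:C.
  by rewrite -[RHS]mulrA -Sp mulr_sumr; apply: eq_bigr => nu _; rewrite [RHS]mulrA.
have mE : sphere_mean n xi = (half_mean n T q Q xi +
    (- 1) ^+ n * half_mean n T q Q (xi - halfv R d)) / p%:C.
  rewrite sphE sphere_meanE aE -/h (_ : p%:C = h%:C * a%:C); last by rewrite -rmorphM.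
  have hC : h%:C != 0 :> R[i] by rewrite (inj_eq (@complexI R)) gt_eqF.
  have aC : a%:C != 0 :> R[i] by rewrite (inj_eq (@complexI R)) gt_eqF.
  by rewrite [X in _ = _ * X]invfM mulrACA mulfV// mul1r.
pose E : R := d%:R * eps + 2 * expR (- (minor_rate R * D%:R)) +
    width D q * G * interp_cst R L * (rad R * Num.sqrt D%:R) ^- L.
have hE eta : cn (half_mean n T q Q eta - S eta) <= E.
  exact: (@half_approx R d n T L q adm DL eps eta (ltW eps0) hT Q G G_ge0 hG mw).
rewrite Sp Sp' mE.
have -> : (half_mean n T q Q xi + (- 1) ^+ n * half_mean n T q Q (xi - halfv R d)) / p%:C -
    S xi / p%:C - (- 1) ^+ n * S (xi - halfv R d) / p%:C =
  ((half_mean n T q Q xi - S xi) +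
   (- 1) ^+ n * (half_mean n T q Q (xi - halfv R d) - S (xi - halfv R d))) / p%:C by ring.
rewrite cnM cnV cn_real (gtr0_norm p0) ler_pdivrMr//.
apply: (@le_trans _ _ (2 * E)).
  rewrite mulr_natl mulr2n; apply: (le_trans (cnD _ _)); apply: lerD => //.
  by rewrite cnM cn_sign mul1r.
have EB : E <= width D q * (B * D%:R ^- N).
  have -> : E = 3 * expR (- (minor_rate R * D%:R)) +
      width D q * G * interp_cst R L * ((rad R ^+ 2) ^- N * D%:R ^- N).
    have sE : (rad R * Num.sqrt D%:R) ^- L = (rad R ^+ 2) ^- N * D%:R ^- N.
      have s2 : (rad R * Num.sqrt D%:R) ^+ 2 = rad R ^+ 2 * D%:R.
        by rewrite exprMn sqr_sqrtr// ltW.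
      by rewrite /L exprM s2 (exprMn N (rad R ^+ 2)) invfM.
    rewrite /E /eps [d%:R * _]mulrC divfK ?pnatr_eq0 -?lt0n//.
    by rewrite sE; ring.
  have e1 : expR (- (minor_rate R * D%:R)) <= width D q * (4 / gap_cst R * D%:R ^- N).
    have wl : 1 <= width D q * (4 / gap_cst R * D%:R ^+ 4).
      rewrite -ler_pdivrMl// mulr1; exact: width_inv_le adm.
    have := hK1 D DK1; rewrite exprD => k1.
    have k2 : D%:R ^+ 4 * expR (- (minor_rate R * D%:R)) <= D%:R ^- N.
      by rewrite -[leRHS]mul1r ler_pdivlMr ?exprn_gt0//; rewrite mulrAC.
    apply: (@le_trans _ _ (width D q * (4 / gap_cst R * D%:R ^+ 4) *
        expR (- (minor_rate R * D%:R)))); first by rewrite ler_peMl ?expR_ge0.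
    by rewrite -[leLHS]mulrA ler_pM2l// -[leLHS]mulrA ler_pM2l// divr_gt0.
  have -> : width D q * (B * D%:R ^- N) = 3 * (width D q * (4 / gap_cst R * D%:R ^- N)) +
      width D q * G * interp_cst R L * ((rad R ^+ 2) ^- N * D%:R ^- N).
    rewrite /B; field; rewrite !gt_eqF ?exprn_gt0//.
  by rewrite lerD2r ler_pM2l.
have DN0 : 0 <= D%:R ^- N :> R by rewrite invr_ge0 exprn_ge0.
apply: (@le_trans _ _ (2 * B / c * D%:R ^- N * (c * width D q))).
  have -> : 2 * B / c * D%:R ^- N * (c * width D q) = 2 * (width D q * (B * D%:R ^- N)).
    by move: (D%:R ^- N) => X; field; rewrite gt_eqF.
  by rewrite ler_pM2l.
apply: ler_pM => //; first by rewrite mulr_ge0.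
  by rewrite mulr_ge0// ltW.
by rewrite ler_wpM2r// lerDr.
Qed.

End Assembly.

Unset Implicit Arguments.
Set Strict Implicit.
Set Printing Implicit Defensive.

Theorem proposition5 (R : realType) (N : nat) (N_ge1 : (1 <= N)%N) :
  exists (L : nat) (C : R), [/\ (1 <= L)%N, 0 < C &
    forall d n : nat, (5 <= d)%N -> (1 <= n <= d ^ 4)%N ->
    exists (alpha beta : 'I_L -> R[i]) (r r' : 'I_L -> R),
      [/\ forall nu, 0 < r nu < 1,
          forall nu, 0 < r' nu < 1,
          \sum_(nu < L) (`|alpha nu| + `|beta nu|) <= C%:C &
          forall xi : 'rV[R]_d,
            `| sphere_mean n xi
               - \sum_(nu < L) alpha nu * fourier_gauss (r nu) xi
               - \sum_(nu < L) beta nu * fourier_gauss (r' nu) (xi - halfv R d) |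
            <= (C * (minn n d)%:R ^- N)%:C]].
Proof.
have [K [C0 [C00 large]]] := @gauss_approx R N.
(* 2 C0 covers alpha and beta together. K^N covers D < K, where zero coefficients are taken and the
   mean, at most 1, is bounded by K^N D^(-N). *)
pose C := 2 * C0 + K%:R ^+ N + 1 : R.
have KN0 : 0 <= K%:R ^+ N :> R by rewrite exprn_ge0.
exists (2 * N)%N, C; split=> [||d n d5 n4]; first by rewrite muln_gt0.
  by rewrite /C; lra.
have d0 : (0 < d)%N by exact: leq_trans d5.
have D0 : (0 < minn n d)%N by rewrite leq_min d0 andbT; case/andP: n4.
have DN0 : 0 < (minn n d)%:R ^- N :> R by rewrite invr_gt0 exprn_gt0// ltr0n.
case: (leqP K (minn n d)) => KD.
  have [alpha [r [r01 sa err]]] := large d n d0 n4 KD.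
  exists alpha, (fun nu => (- 1) ^+ n * alpha nu), r, r; split=> // [|xi].
    rewrite (eq_bigr (fun nu => (2 * cn (alpha nu))%:C)).
      by rewrite -rmorph_sum lecR -mulr_sumr /C; lra.
    by move=> nu _; rewrite !normE cnM cn_sign mul1r -rmorphD mulr_natl mulr2n.
  rewrite normE lecR; apply: (le_trans (err xi)); rewrite ler_wpM2r ?(ltW DN0)// /C; lra.
have h01 : 0 < (2^-1 : R) < 1 by apply/andP; split; lra.
exists (fun=> 0), (fun=> 0), (fun=> 2^-1), (fun=> 2^-1); split=> // [|xi].
  by rewrite big1 => [|nu _]; rewrite ?normr0 ?addr0// -(rmorph0 (real_complex R)) lecR /C; lra.
rewrite !big1; try by move=> nu _; rewrite mul0r.
rewrite !subr0 normE lecR; apply: (le_trans (cn_sphere_mean n xi)).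
apply: (@le_trans _ _ (K%:R ^+ N * (minn n d)%:R ^- N)).
  rewrite ler_pdivlMr ?exprn_gt0 ?ltr0n// mul1r; apply: lerXn2r; rewrite ?nnegrE//.
  by rewrite ler_nat ltnW.
by rewrite ler_wpM2r ?(ltW DN0)// /C; lra.
Qed.
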